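(* Let $q=1$ or $2$, and let $k,\nu\in\mathbb N_0$ be such that either $\nu\ge q$ or $q\le k+\nu\le q+1$. Then, for any $r\ge k+\nu-1$ and any partition $\mathbf z_n=(z_i)_{i=0}^n$ of $[-1,1]$, there exists a constant $\delta=\delta(r)>0$ (depending only on $r$) such that for any $\tilde{\mathbf z}_m\in\mathcal R_\delta(\mathbf z_n)$ and every $f\in\Delta^q\cap C^\nu[-1,1]$, there exists a spline $\tilde s\in\widetilde{\mathcal S}_r(\tilde{\mathbf z}_m)\cap\Delta^q$ satisfying \[ \|f-\tilde s\|_{L_\infty(\mathcal I_j)}\le c(k,\nu,r,\vartheta(\mathbf z_n))\,|J_j|^\nu\,\omega_k(f^{(\nu)},[z_{j-1},z_{j+1}])_\infty \] for all $0\le j\le n$ (where for $j=n$ the factor $|J_n|$ is understood as $|J_{n-1}|$). Moreover, this estimate is no longer true in general for $k$ and $\nu$ which satisfy neither $\nu\ge q$ nor $q\le k+\nu\le q+1$: if $k,\nu\in\mathbb N_0$, $k+\nu\ge q$, and neither $\nu\ge q$ nor $q\le k+\nu\le q+1$ holds, then for every $r\ge k+\nu-1$, every partition $\mathbf z_n$ of $[-1,1]$, every $\delta>0$, every $\tilde{\mathbf z}_m\in\mathcal R_\delta(\mathbf z_n)$ and any constant $c$ in place of $c(k,\nu,r,\vartheta(\mathbf z_n))$, there exists a function $f\in\Delta^q\cap C^\nu[-1,1]$ such that no $\tilde s\in\widetilde{\mathcal S}_r(\tilde{\mathbf z}_m)\cap\Delta^q$ satisfies \[ \|f-\tilde s\|_{L_\infty(\mathcal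 I_j)}\le c\,|J_j|^\nu\,\omega_k(f^{(\nu)},[z_{j-1},z_{j+1}])_\infty \] for all $0\le j\le n$ (with $|J_n|$ again understood as $|J_{n-1}|$).
   Context: A partition $\mathbf z_n=(z_i)_{i=0}^n$ of $[-1,1]$ is a sequence $-1=z_0<z_1<\dots<z_n=1$; set $z_j:=z_0$ for $j<0$ and $z_j:=z_n$ for $j>n$; $J_j:=[z_j,z_{j+1}]$, $|J|$ is the length of $J$, $\mathcal I_j:=[(z_{j-1}+z_j)/2,(z_j+z_{j+1})/2]$, and the scale is $\vartheta(\mathbf z_n):=\max_{0\le j\le n-1}|J_{j\pm1}|/|J_j|$ (maximum over both signs). $\mathcal S_r(\mathbf z_n)$: functions that on each $(z_i,z_{i+1})$, $0\le i\le n-1$, are algebraic polynomials of degree $\le r$. $\widetilde{\mathcal S}_r(\mathbf z_n):=\mathcal S_r(\mathbf z_n)\cap C^{r-1}[-1,1]$ (for $r=0$ there is no smoothness condition). $\delta$-remesh: a partition $\tilde{\mathbf z}_m=(\tilde z_i)_{i=0}^m$ of $[-1,1]$ is a $\delta$-remesh of $\mathbf z_n$ if, for each $0\le j\le n-1$, \[ \max\{\tilde z_{i+1}-\tilde z_i : [\tilde z_i,\tilde z_{i+1}]\cap(z_j,z_{j+1})\ne\emptyset\}\le\delta\min_{\nu=j-1,j,j+1}|z_{\nu+1}-z_\nu|, \] where in this definition only $z_{-1}:=-\infty$, $z_{n+1}:=+\infty$. $\mathcal R_\delta(\mathbf z_n)$ is the class of all $\delta$-remeshes of $\mathbf z_n$.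 $\Delta^q=\Delta^q[-1,1]$: $q$-monotone functions on $[-1,1]$, i.e. all divided differences $[f;t_0,\dots,t_q]$ at $q+1$ distinct points are nonnegative ($q=1$: nondecreasing; $q=2$: convex). $\Delta_h^k(f,x,J)=\sum_{i=0}^k\binom ki(-1)^{k-i}f(x-kh/2+ih)$ if $x\pm kh/2\in J$, and $0$ otherwise ($k\in\mathbb N_0$); $\omega_k(f,t,J)_p=\sup_{0<h\le t}\|\Delta_h^k(f,\cdot,J)\|_{L_p(J)}$; $\omega_k(f,J)_p:=\omega_k(f,|J|,J)_p$; $\|\cdot\|_{L_\infty}$ is the essential supremum norm. $c(\dots)$ denotes a positive constant depending only on the parameters in parentheses. *)

(* Defs.v *)
From HB Require Import structures.
From mathcomp Require Export all_boot all_order all_algebra.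
From mathcomp Require Export all_classical all_reals all_analysis.

Set Implicit Arguments.
Unset Strict Implicit.
Unset Printing Implicit Defensive.

Import Order.TTheory GRing.Theory Num.Theory.
Import numFieldNormedType.Exports.

Local Open Scope classical_set_scope.
Local Open Scope ring_scope.

(* A real function on [-1, 1] is represented by a function R -> R of which only
   the values on [-1, 1] are ever used; a partition z_0 < ... < z_n is
   represented by n and a function z : nat -> R of which only z 0, ..., z n are
   ever used. *)

Section Defs.
Context {R : realType}.
Implicit Types (f s : R -> R) (A J : set R) (z : nat -> R) (a b x h t : R).

Definition is_partition (n : nat) z : Prop :=
  [/\ z 0%N = -1, z n = 1 & forall i, (i < n)%N -> z i < z i.+1].

(* z_j for j in Z, with z_j = z_0 for j < 0 and z_j = z_n for j > n. *)
Definition knot (n : nat) z (j : int) : R :=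
  z (minn n (if j is Posz i then i else 0%N)).

(* |J_j| = z_(j+1) - z_j; by the convention above |J_(-1)| = |J_n| = 0. *)
Definition J_len (n : nat) z (j : int) : R := knot n z (j + 1) - knot n z j.

Definition I_set (n : nat) z (j : int) : set R :=
  `[(knot n z (j - 1) + knot n z j) / 2, (knot n z j + knot n z (j + 1)) / 2].

(* All the ratios are nonnegative, so 0 is a legitimate default value. *)
Definition scale (n : nat) z : R :=
  \big[Num.max/0]_(j < n)
    Num.max (J_len n z (j%:Z - 1) / J_len n z j%:Z)
            (J_len n z (j%:Z + 1) / J_len n z j%:Z).

(* For remeshes only, z_j is -oo for j < 0 and +oo for j > n. *)
Definition eknot (n : nat) z (j : int) : \bar R :=
  if (j < 0)%R then -oo%E else if (n%:Z < j)%R then +oo%E else (knot n z j)%:E.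

Definition eJ_len (n : nat) z (j : int) : \bar R :=
  (eknot n z (j + 1) - eknot n z j)%E.

Definition is_remesh (delta : R) (n : nat) z (m : nat) (zt : nat -> R) : Prop :=
  is_partition m zt /\
  forall j, (j < n)%N ->
  forall i, (i < m)%N ->
    `[zt i, zt i.+1] `&` `]z j, z j.+1[ !=set0 ->
    let lmin := Order.min (eJ_len n z (j%:Z - 1))
                  (Order.min (eJ_len n z j%:Z) (eJ_len n z (j%:Z + 1))) in
    ((zt i.+1 - zt i)%:E <= delta%:E * lmin)%E.

(* Derivatives relative to A; they are one-sided at the ends of an interval. *)
Definition diff_quot f x : R -> R := fun y => (f y - f x) / (y - x).

Definition derivable_on A f x : Prop := cvg (diff_quot f x @ within A x^').

Definition derive_on A f : R -> R :=
  fun x => lim (diff_quot f x @ within A x^').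

Definition derive_on_n A (n : nat) f : R -> R := iter n (derive_on A) f.

Definition Cn A (n : nat) f : Prop :=
  (forall i, (i < n)%N -> forall x, A x -> derivable_on A (derive_on_n A i f) x)
  /\ {within A, continuous (derive_on_n A n f)}.

Definition is_spline (r n : nat) z s : Prop :=
  forall i, (i < n)%N -> exists2 p : {poly R}, (size p <= r.+1)%N &
    forall x, z i < x < z i.+1 -> s x = p.[x].

Definition is_smooth_spline (r n : nat) z s : Prop :=
  is_spline r n z s /\ ((0 < r)%N -> Cn `[-1, 1] r.-1 s).

Definition divided_difference (q : nat) f (t : 'I_q.+1 -> R) : R :=
  \sum_i f (t i) / \prod_(j | j != i) (t i - t j).

Definition q_monotone (q : nat) f : Prop :=
  forall t : 'I_q.+1 -> R, injective t -> (forall i, -1 <= t i <= 1) ->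
    0 <= divided_difference f t.

Definition Linfty_norm J f : \bar R :=
  Lnorm (@lebesgue_measure R) +oo%E (fun x => if x \in J then (f x)%:E else 0%E).

Definition fin_diff (k : nat) h f x J : R :=
  if (x - k%:R * h / 2 \in J) && (x + k%:R * h / 2 \in J) then
    \sum_(i < k.+1) 'C(k, i)%:R * (-1) ^+ (k - i) *
       f (x - k%:R * h / 2 + i%:R * h)
  else 0.

Definition omega_t (k : nat) f t J : \bar R :=
  ereal_sup [set Linfty_norm J (fun x => fin_diff k h f x J) |
             h in [set h | 0 < h <= t]].

Definition omega (k : nat) f a b : \bar R := omega_t k f (b - a) `[a, b].

(* In the bound |J_n| = 0 is replaced with |J_(n-1)|. *)
Definition local_estimate (k nu n : nat) z (c : R) f s : Prop :=
  let fnu := derive_on_n `[-1, 1] nu f in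
  forall j, (j <= n)%N ->
    let err := Linfty_norm (I_set n z j%:Z) (fun x => f x - s x) in
    let w := omega k fnu (knot n z (j%:Z - 1)) (knot n z (j%:Z + 1)) in
    let l := J_len n z (minn j n.-1)%:Z in
    (err <= (c * l ^+ nu)%:E * w)%E.

Definition admissible (q k nu : nat) : Prop :=
  (q <= nu)%N \/ (q <= k + nu <= q.+1)%N.

End Defs.

(* Main.v *)
Require Import Defs.
From mathcomp Require Import ess_sup_inf.
From mathcomp Require Import ring lra zify.

Set Implicit Arguments.
Unset Strict Implicit.
Unset Printing Implicit Defensive.

Import Order.TTheory GRing.Theory Num.Theory.
Import numFieldNormedType.Exports.
Local Open Scope classical_set_scope.
Local Open Scope ring_scope.

(** * Shape preserving spline approximation on remeshes

    The estimate is proved by approximating [f] first with polynomial pieces [F] on intervals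
    comparable to the cells of the given partition, and then smoothing the corners of [F] with
    the many knots of the remesh.

    Pieces.  On one interval Whitney's inequality ([whitney]) provides a polynomial close to [f]
    or to a derivative of [f].  Three devices give it the right shape.  If [q = 1] and [f'] is
    used, a polynomial above [f'] is integrated and scaled down until it interpolates [f] at
    both ends ([monotone_piece]).  If [q = 2] and [f''] is used, a polynomial above [f''] is
    integrated twice into a function vanishing at both ends, and as much of it is added to the
    chord of [f] as the slopes of [f] at the ends allow ([convex_piece]); two adjacent pieces
    then form a convex corner, because the slope of [f] separates theirs.  If only the moduli
    of [f] itself may be used, chords do for moduli of order at most 2, and for convex [f] and
    order 3 quadratic pieces on overlapping pairs of half cells ([quad_piece]).  Splines of
    degree [q - 1] have no smoothness to gain from smoothing, and interpolate at the remesh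
    ([approximable_of_jumps]).  The condition on [k] and [nu] says precisely that one of these
    devices applies; the modulus of [f^(nu)] bounds the ones used by the mean value theorem.

    Smoothing.  At a corner two polynomials [P] and [Q] meet, whose distance is bounded by the
    local error.  A spline switching from [P] to [Q] in a narrow interval around the corner may
    violate the shape there, by an amount proportional to the size [E] of the [q]-th derivative
    of [Q - P].  But both [P^(q)] on the left and [Q^(q)] on the right are nonnegative and
    one of them is at least of size [E / 2]; so it is large on some subinterval, which can
    spend a little of its convexity to make up for the defect of the transition, the narrower
    the less ([glue_unit]).  All splines are written as a polynomial plus a combination [spl]
    of truncated powers, for which integration in the degree is immediate and smoothness is
    automatic; steps with prescribed dense knots are obtained by induction on the degree
    ([smooth_step]).  The corners are treated one by one ([assemble]), and how dense the knots
    have to be depends on the degree alone.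

    Sharpness.  In the remaining cases [nu < q] and [q + 2 <= k + nu].  The function
    [(x + 1 - b)_+^(q + 1)] is [q]-monotone and differs from the polynomial
    [p = (x + 1 - b)^(q + 1)] on [-1, -1 + b] only, where their [nu]-th derivatives are at a
    distance of order [b ^ 2].  Differences of order [k] annihilate [p^(nu)], so the modulus is
    of order [b ^ 2] as well.  A spline within this error would be a polynomial on its first
    cell, close to [p] up to order [b ^ 2] with all derivatives, while [p^(q)] is negative of
    order [b] near -1 ([not_approximable]). *)

Section Polynomials.
Context {R : realType}.
Implicit Types (p q : {poly R}) (x y a b h A M : R).

Lemma lerp_itv a b x : a <= b -> 0 <= x <= 1 -> a <= a + (b - a) * x <= b.
Proof.
move=> ab /andP[x0 x1].
have : 0 <= (b - a) * x by rewrite mulr_ge0// subr_ge0.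
have : (b - a) * x <= (b - a) * 1 by rewrite ler_wpM2l// subr_ge0.
lra.
Qed.

Lemma interpolating_poly (n : nat) (x v : nat -> R) :
  {in gtn n &, injective x} ->
  exists2 p : {poly R}, (size p <= n)%N & forall i, (i < n)%N -> p.[x i] = v i.
Proof.
elim: n => [|n IH] xinj; first by exists 0; rewrite ?size_poly0.
have [i j|p sp pv] := IH; first by rewrite !inE => hi hj; apply: xinj; rewrite inE ltnW.
pose s := [seq x i | i <- iota 0 n].
pose w : {poly R} := \prod_(c <- s) ('X - c%:P).
have w0 i : (i < n)%N -> w.[x i] = 0.
  by move=> ilt; apply/rootP; rewrite root_prod_XsubC map_f// mem_iota.
have wn : w.[x n] != 0.
  rewrite -[_ == 0]/(root w (x n)) root_prod_XsubC; apply/negP => /mapP[i].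
  rewrite mem_iota add0n /= => ilt /xinj; rewrite !inE => h.
  by move: (ilt); have -> : i = n; [apply/esym/h; rewrite ltnS // ltnW|rewrite ltnn].
have sw : size w = n.+1 by rewrite size_prod_XsubC size_map size_iota.
exists (p + ((v n - p.[x n]) / w.[x n]) *: w).
  rewrite (leq_trans (size_polyD _ _))// geq_max (leq_trans sp)//=.
  by rewrite (leq_trans (size_scale_leq _ _))// sw.
move=> i; rewrite ltnS leq_eqVlt hornerD hornerZ => /orP[/eqP->|ilt].
  by rewrite divfK// addrC subrK.
by rewrite (w0 i)// mulr0 addr0 pv.
Qed.

Lemma poly0_of_roots (n : nat) (x : nat -> R) p :
  {in gtn n &, injective x} -> (size p <= n)%N ->
  (forall i, (i < n)%N -> p.[x i] = 0) -> p = 0.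
Proof.
move=> xinj sp p0; apply: (@roots_geq_poly_eq0 _ _ [seq x i | i <- iota 0 n]).
- by apply/allP => y /mapP[i]; rewrite mem_iota add0n /= => ilt ->; apply/rootP/p0.
- rewrite map_inj_in_uniq ?iota_uniq// => i j; rewrite !mem_iota /= !add0n => hi hj.
  exact: xinj.
- by rewrite size_map size_iota.
Qed.

Lemma horner_le (n : nat) p x A B : (size p <= n)%N -> 1 <= B -> `|x| <= B ->
  (forall j, `|p`_j| <= A) -> `|p.[x]| <= n%:R * B ^+ n * A.
Proof.
move=> sp B1 xB pA; have A0 : 0 <= A by apply: le_trans (pA 0%N).
rewrite (horner_coef_wide _ sp) (le_trans (ler_norm_sum _ _ _))//.
rewrite -mulrA mulr_natl -[in X in _ *+ X](card_ord n) -sumr_const.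
apply: ler_sum => i _; rewrite normrM mulrC. apply: ler_pM => //.
rewrite normrX (@le_trans _ _ (B ^+ i))//; first by rewrite lerXn2r ?nnegrE// (le_trans _ B1).
by rewrite ler_weXn2l// ltnW.
Qed.

Lemma coef_deriv_le (n : nat) p A : (size p <= n)%N ->
  (forall j, `|p`_j| <= A) -> forall j, `|p^`()`_j| <= n%:R * A.
Proof.
move=> sp pA j; rewrite coef_deriv; have A0 : 0 <= A by apply: le_trans (pA 0%N).
have [nj|jn] := leqP n j.+1.
  by rewrite nth_default ?mul0rn ?normr0 ?mulr_ge0// (leq_trans sp).
by rewrite normrMn -[leLHS]mulr_natl ler_pM// ler_nat ltnW.
Qed.

Lemma size_derivn_le (n i : nat) p : (size p <= n)%N -> (size p^`(i) <= n - i)%N.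
Proof.
move=> sp; apply/leq_sizeP => j hj; rewrite coef_derivn nth_default ?mul0rn//.
by rewrite (leq_trans sp)// -leq_subLR.
Qed.

(** All norms on a finite-dimensional space are equivalent; here the coefficients of a
    polynomial are controlled by its value at a single well-chosen point of an interval,
    namely the best among enough interpolation nodes. *)
Lemma poly_coef_bound (n : nat) a b : a < b ->
  exists2 C : R, 0 < C & forall p : {poly R}, (size p <= n)%N ->
    exists2 x, a <= x <= b & forall j, `|p`_j| <= C * `|p.[x]|.
Proof.
move=> ab; case: n => [|n].
  exists 1 => // p; rewrite leqn0 size_poly_eq0 => /eqP->.
  by exists a; [lra|move=> j; rewrite coef0 normr0 mulr_ge0].
pose x (i : nat) := a + (b - a) * (i%:R / n.+1%:R).
have xinj : injective x.
  have nz : b - a != 0 by rewrite subr_eq0 gt_eqF.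
  have nz' : n.+1%:R^-1 != 0 :> R by rewrite invr_neq0.
  by move=> i j /addrI /(mulfI nz) /(mulIf nz') /eqP; rewrite eqr_nat => /eqP.
have /choice[l lP] (i : 'I_n.+1) : exists p : {poly R}, (size p <= n.+1)%N /\
    forall j, (j < n.+1)%N -> p.[x j] = (j == i)%:R.
  have [|p sp pv] := @interpolating_poly n.+1 x (fun j => (j == i)%:R).
    by move=> ? ? _ _; exact: xinj.
  by exists p.
pose C : R := 1 + \sum_i \sum_(j < n.+1) `|(l i)`_j|.
have C0 : 0 < C.
  by rewrite ltr_pwDl// sumr_ge0// => i _; apply: sumr_ge0.
exists C => // p sp.
have [i _ imax] := @arg_maxP _ R _ (ord0 : 'I_n.+1) xpredT (fun i => `|p.[x i]|) isT.
have pE : p = \sum_(k < n.+1) p.[x k] *: l k.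
  apply/eqP; rewrite -subr_eq0; apply/eqP.
  apply: (@poly0_of_roots n.+1 x) => [? ? _ _||k kn].
  - exact: xinj.
  - rewrite (leq_trans (size_polyD _ _))// geq_max sp size_polyN /=.
    apply: (leq_trans (size_sum _ _ _)); apply/bigmax_leqP => k _.
    by rewrite (leq_trans (size_scale_leq _ _))//; have [] := lP k.
  - rewrite hornerD hornerN horner_sum (bigD1 (Ordinal kn))//= hornerZ (lP _).2// eqxx mulr1.
    rewrite big1 ?addr0 ?subrr// => k' k'k; rewrite hornerZ (lP _).2// [k == _]eq_sym.
    by rewrite (negPf _ : (k' == k :> nat) = false) ?mulr0//; apply: contra k'k => /eqP e; apply/eqP/val_inj.
exists (x i).
  apply: lerp_itv; first exact: ltW.
  by rewrite divr_ge0// ler_pdivrMr// mul1r ler_nat ltnW.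
move=> j; rewrite {1}pE coef_sum (le_trans (ler_norm_sum _ _ _))//.
rewrite (@le_trans _ _ ((\sum_i \sum_(j < n.+1) `|(l i)`_j|) * `|p.[x i]|))//; last first.
  by rewrite ler_wpM2r// lerDr.
rewrite mulr_suml; apply: ler_sum => k _; rewrite coefZ normrM mulrC ler_pM//; last exact: imax.
have [jn|nj] := ltnP j n.+1; last first.
  by rewrite nth_default ?normr0 ?sumr_ge0// (leq_trans _ nj)// (lP k).1.
by rewrite (bigD1 (Ordinal jn))//= lerDl sumr_ge0.
Qed.

Lemma horner_affine p a h x : (p \Po (a%:P + h *: 'X)).[x] = p.[a + h * x].
Proof. by rewrite horner_comp hornerD hornerC hornerZ hornerX. Qed.

Lemma size_affine p a h : (size (p \Po (a%:P + h *: 'X)) <= size p)%N.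
Proof.
have [->|p0] := eqVneq p 0; first by rewrite comp_poly0.
rewrite (leq_trans (size_comp_poly_leq _ _))//.
have : (size (a%:P + h *: 'X : {poly R})%R <= 2)%N.
  rewrite (leq_trans (size_polyD _ _))// geq_max (leq_trans (size_polyC_leq1 _))//=.
  by rewrite (leq_trans (size_scale_leq _ _))// size_polyX.
move: p0; rewrite -size_poly_gt0; case: (size p) => [|s] //= _.
by case: (size _) => [|[|[|]]] //= _; rewrite ?muln0 ?muln1.
Qed.

Lemma deriv_affine p a h :
  (p \Po (a%:P + h *: 'X))^`() = h *: (p^`() \Po (a%:P + h *: 'X)).
Proof.
rewrite deriv_comp derivD derivC derivZ derivX add0r.
by rewrite -alg_polyC mulrC -scalerAl mul1r.
Qed.

(** The values outside [a, b] and the derivative are bounded through the coefficients after an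
    affine change of variable to [0, 1]. *)
Lemma poly_growth (n : nat) : exists2 C : R, 0 < C & forall (p : {poly R}) a b M, (size p <= n)%N ->
  a < b -> (forall x, a <= x <= b -> `|p.[x]| <= M) ->
  forall x, a - (b - a) <= x <= b + (b - a) ->
    `|p.[x]| <= C * M /\ `|p^`().[x]| * (b - a) <= C * M.
Proof.
have [C C0 CP] := @poly_coef_bound n 0 1 ltr01.
pose K := n%:R * 2 ^+ n * (1 + n%:R) * C + 1 : R.
have n0 : 0 <= n%:R :> R by [].
have e0 : 0 <= 2 ^+ n :> R by rewrite exprn_ge0.
have K0 : 0 < K by rewrite /K ltr_pwDr// !mulr_ge0 ?addr_ge0// ltW.
exists K => // p a b M sp ab pM x xab.
pose q := p \Po (a%:P + (b - a) *: 'X).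
have sq : (size q <= n)%N by rewrite (leq_trans (size_affine _ _ _)).
have [t t01 qt] := CP q sq.
have qtM : `|q.[t]| <= M.
  by rewrite /q horner_affine pM// lerp_itv// ltW.
have M0 : 0 <= M by apply: le_trans qtM.
have qc j : `|q`_j| <= C * M by apply: le_trans (qt j) _; rewrite ler_wpM2l// ltW.
pose y := (x - a) / (b - a).
have ba : b - a != 0 by rewrite subr_eq0 gt_eqF.
have xy : x = a + (b - a) * y by rewrite /y mulrC divfK// addrC subrK.
have y2 : `|y| <= 2.
  have ba0 : 0 < b - a by rewrite subr_gt0.
  rewrite ler_norml /y ler_pdivlMr// ler_pdivrMr//; lra.
have qx : q.[y] = p.[x] by rewrite /q horner_affine -xy.
have q'x : q^`().[y] = p^`().[x] * (b - a).
  by rewrite /q deriv_affine hornerZ horner_affine -xy mulrC.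
have H1 := horner_le sq (ler1n R 2) y2 qc.
have sq' : (size q^`() <= n)%N by rewrite (leq_trans (size_poly _ _))// (leq_trans (leq_pred _)).
have H2 := horner_le sq' (ler1n R 2) y2 (coef_deriv_le sq qc).
have CM0 : 0 <= C * M by rewrite mulr_ge0// ltW.
have a1 : 0 <= n%:R * 2 ^+ n * n%:R * (C * M) by apply: mulr_ge0 => //; do ?apply: mulr_ge0.
have a2 : 0 <= n%:R * 2 ^+ n * (C * M) by apply: mulr_ge0 => //; do ?apply: mulr_ge0.
have KE : K * M = n%:R * 2 ^+ n * (C * M) + n%:R * 2 ^+ n * n%:R * (C * M) + M.
  by rewrite /K; ring.
split; first by rewrite -qx (le_trans H1)// KE; lra.
rewrite -[b - a]gtr0_norm ?subr_gt0// -normrM -q'x (le_trans H2)// KE !mulrA.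
rewrite !mulrA in a1 a2 *; lra.
Qed.

End Polynomials.

Section Calculus.
Context {R : realType}.
Implicit Types (g : R -> R) (a b x h M w e : R) (k n : nat).

(** Continuity on a compact interval in epsilon-delta form, which is convenient for
    compositions with shifts. *)
Definition cont_on a b g := forall x e, a <= x <= b -> 0 < e ->
  exists2 d, 0 < d & forall y, a <= y <= b -> `|y - x| < d -> `|g y - g x| <= e.

Lemma cont_onP a b g : {within `[a, b], continuous g} <-> cont_on a b g.
Proof.
split=> [/subspace_continuousP gc x e xab e0|gc].
  have /cvgrPdist_le/(_ e e0) := gc x xab.
  rewrite near_withinE => /nbhs_ballP[d /= d0 dP]; exists d => // y yab yx.
  by rewrite distrC; apply: dP => //; rewrite /ball/= distrC.
apply/subspace_continuousP => x xab; apply/cvgrPdist_le => e e0.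
have [d d0 dP] := gc x e xab e0.
rewrite near_withinE; apply/nbhs_ballP; exists d => //= y; rewrite /ball/= => xy yab.
by rewrite distrC; apply: dP; rewrite // distrC.
Qed.

Lemma cont_on_sub a b a' b' g : a <= a' -> b' <= b -> cont_on a b g -> cont_on a' b' g.
Proof.
move=> aa bb gc x e xab e0; have [|d d0 dP] := gc x e _ e0; first by move: xab; lra.
by exists d => // y yab; apply: dP; move: yab; lra.
Qed.

Lemma cont_onT g a b : continuous g -> cont_on a b g.
Proof. by move=> gc; apply/cont_onP/continuous_subspaceT. Qed.

Lemma cont_onD a b g1 g2 : cont_on a b g1 -> cont_on a b g2 ->
  cont_on a b (fun x => g1 x + g2 x).
Proof.
move=> c1 c2 x e xab e0; have e20 : 0 < e / 2 by lra.
have [d1 d10 d1P] := c1 x _ xab e20; have [d2 d20 d2P] := c2 x _ xab e20.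
exists (Num.min d1 d2); first by rewrite lt_min d10.
move=> y yab; rewrite lt_min => /andP[y1 y2].
have := d1P y yab y1; have := d2P y yab y2; rewrite !ler_norml; lra.
Qed.

Lemma cont_onN a b g : cont_on a b g -> cont_on a b (fun x => - g x).
Proof.
move=> c x e xab e0; have [d d0 dP] := c x _ xab e0.
by exists d => // y yab yx; rewrite -opprD normrN; apply: dP.
Qed.

Lemma cont_onB a b g1 g2 : cont_on a b g1 -> cont_on a b g2 ->
  cont_on a b (fun x => g1 x - g2 x).
Proof. by move=> c1 c2; apply: cont_onD => //; apply: cont_onN. Qed.

Lemma cont_on_eq a b g1 g2 : (forall x, a <= x <= b -> g1 x = g2 x) ->
  cont_on a b g1 -> cont_on a b g2.
Proof.
move=> gE c x e xab e0; have [d d0 dP] := c x _ xab e0.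
by exists d => // y yab yx; rewrite -!gE//; apply: dP.
Qed.

Lemma cont_on_affine a b s c g : cont_on a b g -> 0 < c ->
  cont_on ((a - s) / c) ((b - s) / c) (fun x => g (s + c * x)).
Proof.
move=> gc c0 x e /andP[xa xb] e0.
have tr y : (a - s) / c <= y <= (b - s) / c -> a <= s + c * y <= b.
  rewrite ler_pdivrMr// ler_pdivlMr// mulrC; lra.
have [|d d0 dP] := gc (s + c * x) e _ e0; first by apply: tr; rewrite xa.
exists (d / c); first by rewrite divr_gt0.
move=> y /tr yab yx; apply: dP => //.
rewrite (_ : _ - _ = c * (y - x)); last by ring.
by rewrite normrM gtr0_norm// mulrC -ltr_pdivlMr.
Qed.

Lemma cont_on_shift a b s g : cont_on a b g -> cont_on (a - s) (b - s) (fun x => g (x + s)).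
Proof.
move=> /(@cont_on_affine _ _ s 1)/(_ ltr01); rewrite !divr1.
by apply: cont_on_eq => x _; rewrite mul1r addrC.
Qed.

Lemma cont_on_poly a b (p : {poly R}) : cont_on a b (horner p).
Proof. by apply: cont_onT; exact: continuous_horner. Qed.

Lemma cont_on_bounded a b g : a <= b -> cont_on a b g ->
  exists2 c, a <= c <= b & forall x, a <= x <= b -> `|g x| <= `|g c|.
Proof.
move=> ab gc; have gc' : cont_on a b (fun x => `|g x|).
  move=> x e xab e0; have [d d0 dP] := gc x _ xab e0; exists d => // y yab yx.
  by rewrite (le_trans (ler_dist_dist _ _))//; apply: dP.
have [c cab cmax] := EVT_max ab ((cont_onP _ _ _).2 gc').
by exists c => // x xab; apply: cmax.
Qed.

(** The hypotheses of the mean value theorem. *)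
Definition diff_on a b g g' :=
  cont_on a b g /\ forall x, a < x < b -> is_derive x 1 g (g' x).

Lemma diff_on_sub a b a' b' g g' : a <= a' -> b' <= b -> diff_on a b g g' -> diff_on a' b' g g'.
Proof.
move=> aa bb [gc gd]; split; first exact: cont_on_sub gc.
by move=> x xab; apply: gd; move: xab; lra.
Qed.

Lemma diff_on_poly a b (p : {poly R}) : diff_on a b (horner p) (horner p^`()).
Proof. by split; [exact: cont_on_poly|move=> x _; exact: is_derive_poly]. Qed.

Lemma diff_onB a b g1 g1' g2 g2' : diff_on a b g1 g1' -> diff_on a b g2 g2' ->
  diff_on a b (fun x => g1 x - g2 x) (fun x => g1' x - g2' x).
Proof.
move=> [c1 d1] [c2 d2]; split; first exact: cont_onB.
by move=> x xab; apply: is_deriveB; [exact: d1|exact: d2].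
Qed.

Lemma diff_on_shift a b s g g' : diff_on a b g g' ->
  diff_on (a - s) (b - s) (fun x => g (x + s)) (fun x => g' (x + s)).
Proof.
move=> [gc gd]; split; first exact: cont_on_shift.
move=> x xab; have gx : is_derive (x + s) 1 g (g' (x + s)) by apply: gd; lra.
have sx := is_derive_shift x (1 : R) s.
by have := @is_derive1_comp _ g (shift s) x _ _ gx sx; rewrite mulr1.
Qed.

Lemma mean_value a b g g' : a < b -> diff_on a b g g' ->
  exists2 c, a < c < b & g b - g a = g' c * (b - a).
Proof.
move=> ab [gc gd].
have gd' x : x \in `]a, b[ -> is_derive x 1 g (g' x) by exact: gd.
by have [c cab cE] := MVT ab gd' ((cont_onP _ _ _).2 gc); exists c.
Qed.

Lemma diff_on_incr_le a b g g' m M : a <= b -> diff_on a b g g' ->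
  (forall x, a < x < b -> m <= g' x <= M) -> m * (b - a) <= g b - g a <= M * (b - a).
Proof.
rewrite le_eqVlt => /orP[/eqP<-|ab gd gM]; first by rewrite !subrr !mulr0 lexx.
have [c cab ->] := mean_value ab gd; have /andP[? ?] := gM c cab.
by rewrite !ler_pM2r ?subr_gt0//; apply/andP.
Qed.

Lemma diff_on_dist_le a b g g' M x y : diff_on a b g g' ->
  (forall x, a < x < b -> `|g' x| <= M) -> a <= x <= b -> a <= y <= b ->
  `|g x - g y| <= M * `|x - y|.
Proof.
move=> gd gM; wlog xy : x y / x <= y.
  move=> H xab yab; have [/H->//|/ltW yx] := leP x y.
  by rewrite distrC (distrC x) H.
move=> xab yab.
have gd' : diff_on x y g g' by apply: diff_on_sub gd; lra.
have gM' t : x < t < y -> - M <= g' t <= M.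
  by move=> txy; rewrite -ler_norml; apply: gM; lra.
have /andP[h1 h2] := diff_on_incr_le xy gd' gM'.
by rewrite distrC (distrC x) (ger0_norm (_ : 0 <= y - x)) ?subr_ge0// ler_norml -mulNr h1.
Qed.

(** * Finite differences *)

Fixpoint fdiff h k g x : R :=
  if k is k'.+1 then fdiff h k' g (x + h) - fdiff h k' g x else g x.

Lemma fdiffD h k g1 g2 x :
  fdiff h k (fun t => g1 t + g2 t) x = fdiff h k g1 x + fdiff h k g2 x.
Proof. by elim: k x => //= k IH x; rewrite !IH; ring. Qed.

Lemma fdiffN h k g x : fdiff h k (fun t => - g t) x = - fdiff h k g x.
Proof. by elim: k x => //= k IH x; rewrite !IH; ring. Qed.

Lemma fdiffB h k g1 g2 x :
  fdiff h k (fun t => g1 t - g2 t) x = fdiff h k g1 x - fdiff h k g2 x.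
Proof. by rewrite fdiffD fdiffN. Qed.

Lemma fdiff_affine h k g s c x :
  fdiff h k (fun t => g (s + c * t)) x = fdiff (c * h) k g (s + c * x).
Proof. by elim: k x => //= k IH x; rewrite !IH mulrDr addrA. Qed.

Lemma fdiff_reflect h k g s x :
  fdiff h k (fun t => g (s - t)) x = (-1) ^+ k * fdiff h k g (s - x - k%:R * h).
Proof.
elim: k x => [|k IH] x /=; first by rewrite mul0r subr0 expr0 mul1r.
rewrite !IH exprS -natr1.
rewrite (_ : s - (x + h) - k%:R * h = s - x - (k%:R + 1) * h); last by ring.
rewrite (_ : s - x - k%:R * h = s - x - (k%:R + 1) * h + h); last by ring.
by ring.
Qed.

Lemma fdiff_le h k g x M : (forall i, (i <= k)%N -> `|g (x + i%:R * h)| <= M) ->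
  `|fdiff h k g x| <= 2 ^+ k * M.
Proof.
elim: k x => [|k IH] x gM /=; first by have := gM 0%N isT; rewrite mul0r addr0 expr0 mul1r.
have h1 : `|fdiff h k g x| <= 2 ^+ k * M by apply: IH => i ik; rewrite gM// leqW.
have h2 : `|fdiff h k g (x + h)| <= 2 ^+ k * M.
  apply: IH => i ik; have := gM i.+1 ik.
  by rewrite -natr1 mulrDl mul1r (addrC _ h) addrA.
by rewrite exprS -mulrA (le_trans (ler_normB _ _))//; lra.
Qed.

Lemma fdiff_last h k g x M : 0 <= M -> (forall i, (i < k)%N -> `|g (x + i%:R * h)| <= M) ->
  `|fdiff h k g x - g (x + k%:R * h)| <= 2 ^+ k * M.
Proof.
move=> M0; elim: k x => [|k IH] x gM /=.
  by rewrite mul0r addr0 subrr normr0 expr0 mul1r.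
have h1 : `|fdiff h k g x| <= 2 ^+ k * M by apply: fdiff_le => i ik; apply: gM.
have h2 : `|fdiff h k g (x + h) - g (x + k.+1%:R * h)| <= 2 ^+ k * M.
  rewrite (_ : x + k.+1%:R * h = x + h + k%:R * h); last by rewrite -natr1; ring.
  apply: IH => i ik; have := gM i.+1 ik.
  by rewrite -natr1 mulrDl mul1r (addrC _ h) addrA.
move: h1 h2; rewrite exprS -mulrA !ler_norml; lra.
Qed.

Lemma cont_on_fdiff a b h k g : 0 <= h -> cont_on a b g ->
  cont_on a (b - k%:R * h) (fdiff h k g).
Proof.
move=> h0; elim: k a b => [|k IH] a b gc; first by rewrite mul0r subr0.
have kh : 0 <= k%:R * h by rewrite mulr_ge0.
have -> : b - k.+1%:R * h = b - k%:R * h - h by rewrite -natr1; ring.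
apply: (@cont_onB _ _ (fun x => fdiff h k g (x + h)) (fdiff h k g)).
  by apply: (cont_on_sub _ _ (cont_on_shift (s := h) (IH _ _ gc))); lra.
by apply: (cont_on_sub _ _ (IH _ _ gc)); lra.
Qed.

Lemma diff_on_fdiff a b h k g g' : 0 <= h -> diff_on a b g g' ->
  diff_on a (b - k%:R * h) (fdiff h k g) (fdiff h k g').
Proof.
move=> h0; elim: k a b => [|k IH] a b gc; first by rewrite mul0r subr0.
have kh : 0 <= k%:R * h by rewrite mulr_ge0.
have -> : b - k.+1%:R * h = b - k%:R * h - h by rewrite -natr1; ring.
apply: (@diff_onB _ _ (fun x => fdiff h k g (x + h)) (fun x => fdiff h k g' (x + h))
                      (fdiff h k g) (fdiff h k g')).
  by apply: (diff_on_sub _ _ (diff_on_shift h (IH _ _ gc))); lra.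
by apply: (diff_on_sub _ _ (IH _ _ gc)); lra.
Qed.

(** Stands for a bound [w] of the modulus of smoothness of order [k] on [a, b].  Differences
    whose nodes reach both ends of the interval are left out because, as functions of their
    first node, they are supported by a single point, which an essential supremum ignores. *)
Definition mod_le k g a b w := forall h x, 0 < h -> k%:R * h < b - a ->
  a <= x -> x + k%:R * h <= b -> `|fdiff h k g x| <= w.

Lemma mod_le_sub k g a b a' b' w : a <= a' -> b' <= b -> mod_le k g a b w -> mod_le k g a' b' w.
Proof. by move=> aa bb gw h x h0 kh xa xb; apply: gw => //; lra. Qed.

Lemma mod_le_ge0 k g a b w : a < b -> mod_le k g a b w -> 0 <= w.
Proof.
move=> ab gw; have k0 : 0 < k.+1%:R :> R by [].
have hk : k%:R * ((b - a) / k.+1%:R) < b - a.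
  by rewrite mulrA ltr_pdivrMr// mulrC ltr_pM2l ?subr_gt0// ltr_nat.
have h0 : 0 < (b - a) / k.+1%:R by rewrite divr_gt0// subr_gt0.
by apply: le_trans (gw _ a h0 hk (lexx a) _) => //; rewrite -lerBrDl ltW.
Qed.

Lemma mod_leS k g a b w : mod_le k g a b w -> mod_le k.+1 g a b (2 * w).
Proof.
move=> gw h x h0; rewrite -natr1 mulrDl mul1r => kh xa xb /=.
rewrite (le_trans (ler_normB _ _))// mulr2n mulrDl mul1r lerD//; apply: gw => //; lra.
Qed.

Lemma mod_le_addn k m g a b w : mod_le k g a b w -> mod_le (m + k) g a b (2 ^+ m * w).
Proof.
move=> gw; elim: m => [|m IH]; first by rewrite expr0 mul1r.
by rewrite exprS -mulrA; apply: mod_leS.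
Qed.

Lemma mod_le_deriv k g g' a b w : a < b -> diff_on a b g g' ->
  mod_le k g' a b w -> mod_le k.+1 g a b ((b - a) * w).
Proof.
move=> ab gd gw h x h0; rewrite -natr1 mulrDl mul1r => kh xa xb /=.
have kh0 : 0 <= k%:R * h by rewrite mulr_ge0// ltW.
have xh : x < x + h by lra.
have [|c cx ->] := @mean_value x (x + h) (fdiff h k g) (fdiff h k g') xh.
  by apply: diff_on_sub (diff_on_fdiff k (ltW h0) gd) => //; lra.
rewrite addrC addKr normrM (gtr0_norm h0) mulrC ler_pM//; first exact: ltW; first lra.
by apply: gw => //; move: cx; lra.
Qed.

Lemma mod_le_poly k (p : {poly R}) a b : a < b -> (size p <= k)%N -> mod_le k (horner p) a b 0.
Proof.
move=> ab; elim: k p => [|k IH] p sp.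
  by move: sp; rewrite leqn0 size_poly_eq0 => /eqP-> h x _ _ _ _ /=; rewrite horner0 normr0.
rewrite -(mulr0 (b - a)); apply: mod_le_deriv ab (diff_on_poly _ _ _) _; apply: IH.
by rewrite (leq_trans (size_poly _ _))//; case: (size p) sp.
Qed.

Lemma mod_le_subpoly k g (p : {poly R}) a b w : a < b -> (size p <= k)%N ->
  mod_le k g a b w -> mod_le k (fun x => g x - p.[x]) a b w.
Proof.
move=> ab sp gw h x h0 kh xa xb; rewrite fdiffB.
have := mod_le_poly ab sp h0 kh xa xb; rewrite normr_le0 => /eqP->.
by rewrite subr0; apply: gw.
Qed.

End Calculus.

(** * Whitney's inequality *)
Section Whitney.
Context {R : realType}.
Implicit Types (g : R -> R) (a b x h M w e : R) (k n i j : nat).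

(** The operator [(1 + E) ^ k], where [E] is the shift by [h]; it relates the differences with
    steps [2 h] and [h] because [E ^ 2 - 1 = (1 + E) (E - 1)]. *)
Fixpoint fsum h k g x : R :=
  if k is k'.+1 then fsum h k' g (x + h) + fsum h k' g x else g x.

Lemma fsum_diff h k g x :
  fsum h k (fun t => g (t + h) - g t) x = fsum h k g (x + h) - fsum h k g x.
Proof. by elim: k x => //= k IH x; rewrite !IH; ring. Qed.

Lemma fdiff_double h k g x : fdiff (2 * h) k g x = fsum h k (fdiff h k g) x.
Proof.
elim: k x => //= k IH x; rewrite !IH.
have fE y : fsum h k (fun x => fdiff h k g (x + h) - fdiff h k g x) y =
    fsum h k (fdiff h k g) (y + h) - fsum h k (fdiff h k g) y by rewrite fsum_diff.
by rewrite !fE (_ : x + 2 * h = x + h + h); ring.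
Qed.

Lemma fsum_near h k g x M : (forall i, (i < k)%N -> `|g (x + i.+1%:R * h) - g (x + i%:R * h)| <= M) ->
  `|fsum h k g x - 2 ^+ k * g x| <= k%:R * 2 ^+ k * M.
Proof.
elim: k x => [|k IH] x gM /=; first by rewrite expr0 mul1r subrr normr0 !mul0r.
have h1 : `|fsum h k g x - 2 ^+ k * g x| <= k%:R * 2 ^+ k * M.
  by apply: IH => i ik; rewrite gM// ltnW.
have h2 : `|fsum h k g (x + h) - 2 ^+ k * g (x + h)| <= k%:R * 2 ^+ k * M.
  apply: IH => i ik; have := gM i.+1 ik.
  have sh (m : nat) : x + h + m%:R * h = x + m.+1%:R * h by rewrite -natr1; ring.
  by rewrite !sh.
have h3 : `|2 ^+ k * (g (x + h) - g x)| <= 2 ^+ k * M.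
  rewrite normrM ger0_norm ?exprn_ge0// ler_wpM2l ?exprn_ge0//.
  by have := gM 0%N isT; rewrite mul1r mul0r addr0.
have M0 : 0 <= 2 ^+ k * M by apply: le_trans h3.
rewrite exprS -natr1; move: h1 h2 h3; rewrite !ler_norml; lra.
Qed.

(** A weak form of Marchaud's inequality.  Differences of order [j] with step [2 h] are
    [2 ^ j] times those with step [h], up to differences of order [j + 1]; so repeated halving
    of the step makes the differences of all orders from [k - 1] down to [1] decay, up to a
    multiple of the modulus of order [k]. The starting points keep away from the right end by
    a distance that decreases with the order, so that all nodes stay in the interval. *)
Lemma fdiff_decay k d j : (0 < j)%N -> (j + d = k)%N ->
  exists A B, [/\ 0 <= A, 0 <= B & forall g M w h, 0 < h -> k%:R * h <= (4 * k%:R)^-1 ->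
    (forall x, 0 <= x <= 1 -> `|g x| <= M) -> mod_le k g 0 1 w ->
    forall i x, 0 <= x <= 2^-1 + j%:R * (4 * k%:R)^-1 ->
      `|fdiff (h / 2 ^+ i) j g x| <= A * (3 / 4) ^+ i * M + B * w].
Proof.
move=> j0 jdk; have k0 : (0 < k)%N by rewrite -jdk addn_gt0 j0.
set q : R := (4 * k%:R)^-1.
have k1 : 1 <= k%:R :> R by rewrite ler1n.
have qP : k%:R * q = 4^-1 by rewrite /q; field; rewrite pnatr_eq0 -lt0n.
have q0 : 0 < q by rewrite /q invr_gt0; lra.
have q4 : q <= 4^-1 by rewrite -qP ler_peMl// ltW.
have jq j' : (j' <= k)%N -> j'%:R * q <= 4^-1.
  by move=> jk; rewrite -qP ler_wpM2r ?ler_nat// ltW.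
elim: d j j0 jdk => [|d IH] j j0 jdk.
  exists 0, 1; split=> // g M w h h0 kh gM gw i x /andP[x0 x1].
  have jk : j = k by rewrite -jdk addn0.
  have e1 : 1 <= 2 ^+ i :> R by rewrite exprn_ege1// ler1n.
  have h1 : h / 2 ^+ i <= h by rewrite ler_pdivrMr ?exprn_gt0// ler_peMr// ltW.
  have h2 : 0 < h / 2 ^+ i by rewrite divr_gt0// exprn_gt0.
  have h3 : k%:R * (h / 2 ^+ i) <= k%:R * h by rewrite ler_wpM2l.
  rewrite !mul0r add0r mul1r jk; apply: gw => //; first lra.
  by have := jq j; rewrite jk leqnn => /(_ isT); rewrite jk in x1; lra.
have [//||A' [B' [A'0 B'0 AB]]] := IH j.+1; first by rewrite addSnnS.
have j1 : 1 <= j%:R :> R by rewrite ler1n.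
have jA : 0 <= j%:R * A' by rewrite mulr_ge0.
have jB : 0 <= j%:R * B' by rewrite mulr_ge0.
have e2j : 0 <= 2 ^+ j :> R by rewrite exprn_ge0.
exists (2 ^+ j + 3 * (j%:R * A')), (2 * (j%:R * B')).
split=> [||g M w h h0 kh gM gw]; [lra|lra|].
have w0 := mod_le_ge0 (@ltr01 R) gw.
have M0 : 0 <= M by apply: le_trans (gM 0 _); rewrite ?lexx ?ler01.
elim=> [|i IHi] x /andP[x0 x1].
  rewrite expr0 divr1 mulr1 (@le_trans _ _ (2 ^+ j * M))//.
    apply: fdiff_le => i ij; apply: gM; apply/andP; split.
      by rewrite addr_ge0// mulr_ge0// ltW.
    have : i%:R * h <= k%:R * h by rewrite ler_wpM2r ?ler_nat ?(leq_trans ij)// ?(ltW h0)// -jdk leq_addr.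
    by have := jq j; rewrite -[X in (_ <= X)%N]jdk leq_addr => /(_ isT); rewrite -/q in x1 kh; lra.
  have : 0 <= j%:R * A' * M by rewrite mulr_ge0.
  have : 0 <= j%:R * B' * w by rewrite mulr_ge0.
  lra.
set hi := h / 2 ^+ i.+1.
have h2 : h / 2 ^+ i = 2 * hi by rewrite /hi exprS; field; rewrite expf_neq0.
have hi0 : 0 < hi by rewrite divr_gt0// exprn_gt0.
have hih : hi <= h by rewrite ler_pdivrMr ?exprn_gt0// ler_peMr ?(ltW h0)// exprn_ege1// ler1n.
have := IHi x; rewrite x0 x1 => /(_ isT); rewrite h2 fdiff_double => H1.
pose Bw : R := A' * (3 / 4) ^+ i.+1 * M + B' * w.
have H2 : `|fsum hi j (fdiff hi j g) x - 2 ^+ j * fdiff hi j g x| <= j%:R * 2 ^+ j * Bw.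
  apply: fsum_near => m mj.
  have := AB g M w h h0 kh gM gw i.+1 (x + m%:R * hi).
  rewrite -/hi /= (_ : x + m%:R * hi + hi = x + m.+1%:R * hi); last by rewrite -natr1; ring.
  apply; apply/andP; split; first by rewrite addr_ge0// mulr_ge0// ltW.
  have m1 : m%:R * hi <= k%:R * h.
    by rewrite ler_pM ?(ltW hi0)// ler_nat (leq_trans (ltnW mj))// -jdk leq_addr.
  by rewrite -[j.+1%:R]natr1 mulrDl mul1r; lra.
have H3 : 2 ^+ j * `|fdiff hi j g x| <= (2 ^+ j + 3 * (j%:R * A')) * (3 / 4) ^+ i * M + 2 * (j%:R * B') * w
    + j%:R * 2 ^+ j * Bw.
  rewrite -{1}[2 ^+ j]ger0_norm// -normrM; move: H1 H2; rewrite !ler_norml; lra.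
have e2 : 2 <= 2 ^+ j :> R by case: (j) j0 => // j' _; rewrite exprS ler_peMr// exprn_ege1// ler1n.
set X := (2 ^+ j + 3 * (j%:R * A')) * (3 / 4) ^+ i * M + 2 * (j%:R * B') * w in H3.
have t0 : 0 <= (3 / 4) ^+ i :> R by rewrite exprn_ge0.
have X0 : 0 <= X by rewrite /X addr_ge0// !mulr_ge0//; lra.
have H4 : 2 ^+ j * `|fdiff hi j g x| <= 2 ^+ j * (X / 2 + j%:R * Bw).
  rewrite (le_trans H3)//.
  have -> : 2 ^+ j * (X / 2 + j%:R * Bw) = 2 ^+ j * X / 2 + j%:R * 2 ^+ j * Bw by ring.
  rewrite lerD2r.
  have : 2 * X <= 2 ^+ j * X by rewrite ler_wpM2r.
  lra.
move: H4; rewrite ler_pM2l ?exprn_gt0// => /le_trans; apply.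
rewrite /X /Bw exprS.
set t := (3 / 4) ^+ i in t0 *.
have u1 : 0 <= 2 ^+ j * t * M by rewrite !mulr_ge0.
have u2 : 0 <= j%:R * A' * t * M by rewrite !mulr_ge0.
lra.
Qed.

Lemma near_lipschitz k : (0 < k)%N -> exists A B, [/\ 0 <= A, 0 <= B & forall g M w,
  (forall x, 0 <= x <= 1 -> `|g x| <= M) -> mod_le k g 0 1 w ->
  forall i h x, 0 < h -> k%:R * (h * 2 ^+ i) <= (4 * k%:R)^-1 -> 0 <= x <= 2^-1 ->
    `|g (x + h) - g x| <= A * (3 / 4) ^+ i * M + B * w].
Proof.
move=> k0; have [|A [B [A0 B0 AB]]] := @fdiff_decay k k.-1 1%N isT.
  by rewrite add1n prednK.
exists A, B; split=> // g M w gM gw i h x h0 kh x01.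
have := AB g M w (h * 2 ^+ i) _ kh gM gw i x; rewrite mulfK ?expf_neq0//=; apply.
  by rewrite mulr_gt0// exprn_gt0.
have : 0 <= (4 * k%:R : R)^-1 by rewrite invr_ge0 mulr_ge0.
lra.
Qed.

Lemma geometric_small (A e : R) : 0 < e -> exists i : nat, A * (3 / 4) ^+ i <= e.
Proof.
move=> e0; have [i iP] : exists i : nat, A / e <= i%:R / 3.
  exists (Num.truncn (3 * (`|A| / e))).+1.
  have := truncnS_gt (3 * (`|A| / e)).
  have : A / e <= `|A| / e by rewrite ler_pM2r ?invr_gt0// ler_norm.
  lra.
exists i; have bern (m : nat) : m%:R / 3 * (3 / 4) ^+ m <= 1 :> R.
  suff : (1 + m%:R / 3) * (3 / 4) ^+ m <= 1 :> R.
    have : 0 <= (3 / 4) ^+ m :> R by rewrite exprn_ge0.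
    by lra.
  elim: m => [|m IH]; first by rewrite mul0r addr0 expr0 mulr1.
  rewrite exprS -[m.+1%:R]natr1; have s0 := ler0n R m.
  have t0 : 0 <= (3 / 4) ^+ m :> R by rewrite exprn_ge0.
  have : 0 <= m%:R * (3 / 4) ^+ m :> R by rewrite mulr_ge0.
  lra.
have t0 : 0 < (3 / 4) ^+ i :> R by rewrite exprn_gt0.
rewrite -(@ler_pM2r _ e^-1) ?invr_gt0// mulrAC divff ?gt_eqF//.
by rewrite (le_trans _ (bern i))// ler_wpM2r// ltW.
Qed.

(** On a function with small modulus of order [k], a bound at the points of a fine uniform
    grid gives a bound everywhere: between the grid points the function varies by at most a
    quarter of its maximum. *)
Lemma grid_bound k : (0 < k)%N -> exists N B, [/\ (k < N)%N, 0 <= B & forall g M w e,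
  (forall x, 0 <= x <= 1 -> `|g x| <= M) -> mod_le k g 0 1 w ->
  (forall l, (l <= N)%N -> `|g (l%:R / N%:R)| <= e) ->
  forall x, 0 <= x <= 2^-1 -> `|g x| <= M / 4 + B * w + e].
Proof.
move=> k0; have [A [B [A0 B0 AB]]] := near_lipschitz k0.
have [i iP] := @geometric_small A 4^-1 (ltac:(by rewrite invr_gt0)).
have k1 : 1 <= k%:R :> R by rewrite ler1n.
(* steps up to [1 / N] can be doubled [i] times before they exceed [1 / (4 k ^ 2)] *)
pose Q : R := 4 * k%:R * k%:R * 2 ^+ i.
pose N := (k + (Num.truncn Q).+1)%N.
have NQ : Q <= N%:R by rewrite /N natrD (le_trans (ltW (truncnS_gt Q)))// lerDr.
have kN : (k < N)%N by rewrite /N addnS ltnS leq_addr.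
have N2 : (2 <= N)%N by rewrite /N; lia.
have N0 : 0 < N%:R :> R by rewrite ltr0n; lia.
exists N, B; split=> // g M w e gM gw ge x /andP[x0 x1].
have M0 : 0 <= M by apply: le_trans (gM 0 _); rewrite ?lexx ?ler01.
pose l := (Num.truncn (x * N%:R)).+1.
have xN : 0 <= x * N%:R by rewrite mulr_ge0// ltW.
have l1 : x * N%:R < l%:R := truncnS_gt _.
have l2 : l%:R <= x * N%:R + 1 by rewrite /l -natr1 lerD2r truncn_le.
have lN : (l <= N)%N.
  have h2 : 2 <= N%:R :> R by rewrite (ler_nat _ 2).
  have h1 : x * N%:R <= 2^-1 * N%:R by rewrite ler_wpM2r// ltW.
  by rewrite -(ler_nat R); lra.
have h0 : 0 < l%:R / N%:R - x by rewrite subr_gt0 ltr_pdivlMr.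
have hN : l%:R / N%:R - x <= N%:R^-1.
  by rewrite -(ler_pM2r N0) mulVf ?gt_eqF// mulrBl divfK ?gt_eqF//; lra.
have xE : x + (l%:R / N%:R - x) = l%:R / N%:R by rewrite addrC subrK.
have := AB g M w gM gw i _ x h0; rewrite xE x0 x1 => H.
have {H} : `|g (l%:R / N%:R) - g x| <= A * (3 / 4) ^+ i * M + B * w.
  apply: H => //; rewrite (@le_trans _ _ (k%:R * (N%:R^-1 * 2 ^+ i)))//.
    by rewrite ler_wpM2l// ler_wpM2r// exprn_ge0.
  rewrite mulrCA ler_pdivrMl// ler_pdivlMr; last lra.
  by move: NQ; rewrite /Q; lra.
have : A * (3 / 4) ^+ i * M <= 4^-1 * M by rewrite ler_wpM2r.
have := ge l lN; rewrite !ler_norml; lra.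
Qed.

Lemma whitney01 k : exists2 C : R, 0 < C & forall g w, cont_on 0 1 g -> mod_le k g 0 1 w ->
  exists2 p : {poly R}, (size p <= k)%N & forall x, 0 <= x <= 1 -> `|g x - p.[x]| <= C * w.
Proof.
case: k => [|k'].
  exists 1 => // g w gc gw; exists 0; first by rewrite size_poly0.
  move=> x /andP[x0 x1]; rewrite horner0 subr0 mul1r.
  by apply: (gw 1 x) => //; rewrite mul0r ?subr0// addr0.
set k := k'.+1; have [N [B [kN B0 NB]]] := @grid_bound k isT.
have N0 : 0 < N%:R :> R by rewrite ltr0n; lia.
pose D : R := (2 ^+ k + 1) ^+ N.
have D0 : 0 < D by rewrite exprn_gt0// ltr_wpDl// exprn_ge0.
exists (2 * (B + D)); first by rewrite mulr_gt0// ltr_wpDl.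
move=> g w gc gw; have w0 := mod_le_ge0 (@ltr01 R) gw.
have [|p sp pv] := @interpolating_poly R k (fun l => l%:R / N%:R) (fun l => g (l%:R / N%:R)).
  move=> l l' _ _ /(mulIf _) -/(_ _)/eqP; rewrite eqr_nat => H; apply/eqP/H.
  by rewrite invr_neq0// gt_eqF.
exists p => //; pose g1 x := g x - p.[x]; rewrite -/(g1 _).
have g1c : cont_on 0 1 g1 by apply: cont_onB => //; exact: cont_on_poly.
have g1w : mod_le k g1 0 1 w by apply: mod_le_subpoly => //; exact: ltr01.
have grid l : (l <= N)%N -> `|g1 (l%:R / N%:R)| <= (2 ^+ k + 1) ^+ l * w.
  have e0 : 0 <= 2 ^+ k :> R by rewrite exprn_ge0.
  have e1 (m : nat) : 1 <= (2 ^+ k + 1) ^+ m :> R by rewrite exprn_ege1//; lra.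
  elim/ltn_ind: l => l IH lN.
  have [lk|kl] := ltnP l k.
    by rewrite /g1 pv// subrr normr0 mulr_ge0// (le_trans ler01)// e1.
  pose x : R := (l - k)%:R / N%:R.
  have xi i : x + i%:R * N%:R^-1 = (l - k + i)%:R / N%:R by rewrite /x natrD mulrDl.
  have kN1 : k%:R * N%:R^-1 < 1 :> R by rewrite ltr_pdivrMr// mul1r ltr_nat.
  have H1 : `|fdiff N%:R^-1 k g1 x| <= w.
    apply: g1w; rewrite ?invr_gt0 ?subr0//; first by rewrite divr_ge0// ltW.
    by rewrite xi subnK// ler_pdivrMr// mul1r ler_nat.
  have [l' lE] : exists l', l = l'.+1 by exists l.-1; rewrite prednK// (leq_trans _ kl).
  have H2 : `|fdiff N%:R^-1 k g1 x - g1 (x + k%:R * N%:R^-1)| <= 2 ^+ k * ((2 ^+ k + 1) ^+ l' * w).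
    apply: fdiff_last; first by rewrite mulr_ge0// (le_trans ler01)// e1.
    move=> i ik; rewrite xi (le_trans (IH _ _ _))//.
    - by lia.
    - by lia.
    - rewrite ler_wpM2r// ler_weXn2l//; first lra; lia.
  rewrite xi subnK// in H2; rewrite lE in H2 *; rewrite exprS.
  have : w <= (2 ^+ k + 1) ^+ l' * w by rewrite ler_peMl.
  move: H1 H2; rewrite !ler_norml; lra.
have gridD l : (l <= N)%N -> `|g1 (l%:R / N%:R)| <= D * w.
  move=> lN; rewrite (le_trans (grid l lN))// ler_wpM2r// ler_weXn2l//.
  by rewrite lerDr exprn_ge0.
have [c c01 cmax] := cont_on_bounded ler01 g1c.
set M := `|g1 c| in cmax.
have M0 : 0 <= M by rewrite /M.
have main : M <= M / 4 + B * w + D * w.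
  have [c2|c2] := leP c 2^-1.
    by apply: NB cmax g1w gridD _ _; move: c01; lra.
  have := NB (fun x => g1 (1 - x)) M w (D * w) _ _ _ (1 - c).
  rewrite subKr; apply; last by move: c01; lra.
  - by move=> x x01; apply: cmax; move: x01; lra.
  - move=> h x h0; rewrite subr0 => kh x0 xk; rewrite fdiff_reflect normrM normrX normrN1 expr1n mul1r.
    by apply: g1w => //; lra.
  - move=> l lN; have -> : 1 - l%:R / N%:R = (N - l)%:R / N%:R :> R.
      by rewrite natrB// mulrBl divff ?gt_eqF.
    by apply: gridD; rewrite leq_subr.
move=> x x01; rewrite (le_trans (cmax x x01))//.
have : 0 <= B * w by rewrite mulr_ge0.
have : 0 <= D * w by rewrite mulr_ge0// ltW.
lra.
Qed.

(** Whitney's inequality.  After interpolation at the first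
    points of a fine uniform grid, the values at the other points of the grid are bounded by
    recursion, and near-Lipschitz continuity absorbs the rest. *)
Theorem whitney k : exists2 C : R, 0 < C & forall g a b w, a < b -> cont_on a b g ->
  mod_le k g a b w ->
  exists2 p : {poly R}, (size p <= k)%N & forall x, a <= x <= b -> `|g x - p.[x]| <= C * w.
Proof.
have [C C0 CP] := whitney01 k; exists C => // g a b w ab gc gw.
have ba : 0 < b - a by rewrite subr_gt0.
have [||p sp pP] := CP (fun t => g (a + (b - a) * t)) w.
- have := cont_on_affine gc ba (s := a).
  by rewrite subrr mul0r divff ?gt_eqF.
- move=> h x h0; rewrite subr0 => kh x0 x1; rewrite fdiff_affine; apply: gw.
  + by rewrite mulr_gt0.
  + by rewrite mulrCA gtr_pMr.
  + by rewrite lerDl mulr_ge0// ltW.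
  + have : (b - a) * (x + k%:R * h) <= (b - a) * 1 by rewrite ler_pM2l.
    by rewrite mulrDr mulr1 mulrCA; lra.
pose s := - a / (b - a).
exists (p \Po (s%:P + (b - a)^-1 *: 'X)); first by rewrite (leq_trans (size_affine _ _ _)).
move=> x xab; rewrite horner_affine.
have -> : s + (b - a)^-1 * x = (x - a) / (b - a) by rewrite /s; field; rewrite gt_eqF.
have := pP ((x - a) / (b - a)).
rewrite (_ : a + (b - a) * ((x - a) / (b - a)) = x); last by field; rewrite gt_eqF.
apply.
by rewrite divr_ge0 ?ler_pdivrMr//; lra.
Qed.

End Whitney.

(** * Truncated powers *)
Section TruncatedPowers.
Context {R : realType}.
Implicit Types (p Q : {poly R}) (l : seq (R * R)) (a b x y t h M : R) (d i j k n : nat).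

Lemma is_derive_eps (f : R -> R) x df :
  (forall e, 0 < e -> exists2 del, 0 < del &
     forall h, `|h| < del -> `|f (x + h) - f x - df * h| <= e * `|h|) ->
  is_derive x 1 f df.
Proof.
move=> fP.
have H : (fun h => h^-1 *: (f (h *: (1 : R) + x) - f x)) @ 0^' --> df.
  apply/cvgrPdist_le => e e0; have [del del0 dP] := fP e e0.
  rewrite near_withinE; apply/nbhs_ballP; exists del => //= h.
  rewrite /ball /= sub0r normrN => hdel h0.
  rewrite /GRing.scale /= mulr1 distrC (addrC h).
  rewrite -(@ler_pM2r _ `|h|) ?normr_gt0// -normrM mulrBl mulrAC mulVf// mul1r.
  exact: dP.
by apply: DeriveDef; [apply/cvg_ex; exists df|exact: cvg_lim].
Qed.

(** The truncated power, divided by the factorial so that the derivative lowers the degree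
    and does nothing else. In degree 0 it is the right-continuous step. *)
Definition tpow d x : R := if 0 <= x then x ^+ d / d`!%:R else 0.

(** Weights and knots are kept in a list, so that the derivative of [spl d.+1 l] is [spl d l],
    with the same list. *)
Definition spl d l x : R := \sum_(c <- l) c.1 * tpow d (x - c.2).

Definition right_poly d l : {poly R} := \sum_(c <- l) (c.1 / d`!%:R) *: ('X - c.2%:P) ^+ d.

Definition scale_spl t l : seq (R * R) := [seq (t * c.1, c.2) | c <- l].

Lemma spl_cat d l1 l2 x : spl d (l1 ++ l2) x = spl d l1 x + spl d l2 x.
Proof. by rewrite /spl big_cat. Qed.

Lemma spl_scale d t l x : spl d (scale_spl t l) x = t * spl d l x.
Proof. by rewrite /spl big_map mulr_sumr; apply: eq_bigr => c _; rewrite mulrA. Qed.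

Lemma right_poly_cat d l1 l2 : right_poly d (l1 ++ l2) = right_poly d l1 + right_poly d l2.
Proof. by rewrite /right_poly big_cat. Qed.

Lemma right_poly_scale d t l : right_poly d (scale_spl t l) = t *: right_poly d l.
Proof.
by rewrite /right_poly big_map scaler_sumr; apply: eq_bigr => c _; rewrite scalerA mulrA.
Qed.

Lemma spl_nil d x : spl d [::] x = 0.
Proof. by rewrite /spl big_nil. Qed.

Lemma right_poly_nil d : right_poly d [::] = 0.
Proof. by rewrite /right_poly big_nil. Qed.

Lemma spl_left d l x : (forall c, c \in l -> x < c.2) -> spl d l x = 0.
Proof.
move=> lx; rewrite /spl big_seq big1// => c /lx xc.
by rewrite /tpow subr_ge0 leNgt xc /= mulr0.
Qed.

Lemma spl_right d l x : (forall c, c \in l -> c.2 <= x) -> spl d l x = (right_poly d l).[x].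
Proof.
move=> lx; rewrite /spl /right_poly horner_sum big_seq [RHS]big_seq.
apply: eq_bigr => c /lx xc; rewrite /tpow subr_ge0 xc hornerZ horner_exp hornerXsubC.
by rewrite mulrA mulrAC.
Qed.

Lemma deriv_right_poly d l : (right_poly d.+1 l)^`() = right_poly d l.
Proof.
rewrite /right_poly raddf_sum; apply: eq_bigr => c _ /=.
rewrite derivZ deriv_exp derivXsubC mul1r -[X in _ *: X]scaler_nat scalerA factS natrM; congr (_ *: _).
by rewrite invfM [_^-1 * _]mulrC mulrA divfK ?pnatr_eq0.
Qed.

Lemma derivn_right_poly d j l : (j <= d)%N -> (right_poly d l)^`(j) = right_poly (d - j) l.
Proof.
elim: j => [|j IH] jd; first by rewrite subn0.
by rewrite derivnS IH ?(ltnW jd)// -(deriv_right_poly (d - j.+1)) subnSK.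
Qed.

Lemma size_right_poly d l : (size (right_poly d l) <= d.+1)%N.
Proof.
rewrite (leq_trans (size_sum _ _ _))//; apply/bigmax_leqP_seq => c _ _.
by rewrite (leq_trans (size_scale_leq _ _))// size_exp_XsubC.
Qed.

Lemma tpowSE d x : tpow d.+1 x = Num.max 0 x ^+ d.+1 / d.+1`!%:R.
Proof.
rewrite /tpow; case: ifPn => [x0|]; first by rewrite max_r.
by rewrite -ltNge => /ltW x0; rewrite max_l// expr0n/= mul0r.
Qed.

Lemma cont_on_tpowS a b d t : cont_on a b (fun x => tpow d.+1 (x - t)).
Proof.
apply: cont_onT => x.
have -> : (fun x => tpow d.+1 (x - t)) = (fun x => Num.max 0 (x - t) ^+ d.+1 / d.+1`!%:R).
  by apply/funext => y; rewrite tpowSE.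
apply: cvgMl; apply: (@cvg_comp _ _ _ (fun x => Num.max 0 (x - t)) (fun y => y ^+ d.+1) _
  (nbhs (Num.max 0 (x - t)))); last exact: exprn_continuous.
have mE y : Num.max 0 (y - t) = (y - t + `|y - t|) / 2.
  by have [h|h] := leP 0 (y - t); [rewrite ger0_norm//; lra|rewrite ltr0_norm//; lra].
rewrite (_ : (fun x => Num.max 0 (x - t)) = (fun y => (y - t + `|y - t|) / 2)); last first.
  by apply/funext => y; rewrite mE.
rewrite mE; apply: cvgMl; have h : (fun y => y - t) @ x --> x - t.
  by apply: cvgB; [exact: cvg_id|exact: cvg_cst].
by apply: cvgD => //; exact: cvg_norm.
Qed.

Lemma cont_on_splS a b d l : cont_on a b (spl d.+1 l).
Proof.
elim: l => [|c l IH].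
  apply: (@cont_on_eq _ _ _ (fun _ => 0)) => [x _|]; first by rewrite spl_nil.
  by apply: cont_onT => x; exact: cvg_cst.
apply: (@cont_on_eq _ _ _ (fun x => c.1 * tpow d.+1 (x - c.2) + spl d.+1 l x)) => [x _|].
  by rewrite /spl big_cons.
apply: cont_onD => //.
have /cont_onP/subspace_continuousP H := @cont_on_tpowS a b d c.2.
by apply/cont_onP/subspace_continuousP => x xab; apply: cvgMr; exact: H.
Qed.

Lemma is_derive_tpow d x t : (0 < d)%N || (x != t) ->
  is_derive x 1 (fun x => tpow d.+1 (x - t)) (tpow d (x - t)).
Proof.
have E k : tpow k = (fun y : R => if 0 <= y then y ^+ k / k`!%:R else 0) by [].
have [xt _|xt _|-> ] := ltgtP x t.
- apply: is_derive_eps => e e0; exists (t - x); first by rewrite subr_gt0.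
  move=> h; rewrite ltr_norml => hx; rewrite /tpow !ifF; [|apply/negbTE; rewrite -ltNge; lra..].
  by rewrite mul0r subrr subr0 normr0 mulr_ge0// ltW.
- have := is_derive_poly ((d.+1`!%:R)^-1 *: ('X - t%:P) ^+ d.+1) x.
  rewrite derivZ deriv_exp derivXsubC mul1r hornerZ hornerMn horner_exp hornerXsubC => H.
  have -> : tpow d (x - t) = (d.+1`!%:R)^-1 * ((x - t) ^+ d.+1.-1 *+ d.+1).
    rewrite /tpow subr_ge0 (ltW xt) factS natrM -[(_ ^+ _) *+ _]mulr_natr /=.
    by rewrite [RHS]mulrC invfM mulrA mulfK ?pnatr_eq0.
  apply: near_eq_is_derive H.
  apply/nbhs_ballP; exists (x - t); first by rewrite /= subr_gt0.
  move=> y; rewrite /ball /= ltr_norml => xy.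
  have yt : 0 <= y - t by lra.
  by rewrite /tpow yt hornerZ horner_exp hornerXsubC; exact: mulrC.
- rewrite orbF => d0; rewrite subrr; case: d d0 => // d _.
  have -> : tpow d.+1 0 = 0 by rewrite /tpow lexx expr0n /= mul0r.
  apply: is_derive_eps => e e0; exists (Num.min 1 e); first by rewrite lt_min ltr01.
  move=> h; rewrite lt_min => /andP[h1 he].
  rewrite subrr /tpow lexx expr0n /= mul0r !subr0 mul0r subr0 addrAC subrr add0r.
  case: ifP => _; last by rewrite normr0 mulr_ge0// ltW.
  rewrite normrM normrX normfV (ger0_norm (ler0n _ _)).
  have f1 : d.+2`!%:R^-1 <= 1 :> R by rewrite invf_le1 ?ltr0n ?ler1n fact_gt0.
  have h2 : `|h| ^+ d.+2 <= e * `|h|.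
    rewrite exprS mulrC ler_wpM2r// (le_trans _ (ltW he))// exprS ler_piMr//.
    by rewrite exprn_ile1// ltW.
  by apply: le_trans h2; apply: ler_piMr => //; exact: exprn_ge0.
Qed.

Lemma is_derive_spl d l x : (0 < d)%N || (x \notin [seq c.2 | c <- l]) ->
  is_derive x 1 (spl d.+1 l) (spl d l x).
Proof.
elim: l => [|c l IH] dx.
  have -> : spl d.+1 [::] = cst 0 by apply/funext => y; rewrite spl_nil.
  by rewrite spl_nil; exact: is_derive_cst.
have -> : spl d.+1 (c :: l) = c.1 \*: (fun x => tpow d.+1 (x - c.2)) + spl d.+1 l.
  by apply/funext => y; rewrite /spl big_cons.
rewrite {2}/spl big_cons; apply: is_deriveD.
  apply: is_deriveZ; apply: is_derive_tpow.
  by move: dx; rewrite /= inE negb_or => /orP[->//|/andP[-> _]]; rewrite orbT.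
by apply: IH; move: dx; rewrite /= inE negb_or => /orP[->//|/andP[_ ->]]; rewrite orbT.
Qed.

(** The mean value theorem applies between consecutive exceptional points. *)
Lemma incr_except (s : seq R) (g g' : R -> R) a b : a <= b -> cont_on a b g ->
  (forall x, a < x < b -> x \notin s -> is_derive x 1 g (g' x)) ->
  (forall x, a < x < b -> 0 <= g' x) -> g a <= g b.
Proof.
elim: s a b => [|c s IH] a b ab gc gd g0.
  have gd' : diff_on a b g g' by split=> // x xab; apply: gd.
  move: ab; rewrite le_eqVlt => /orP[/eqP->//|ab].
  have [t tab e] := mean_value ab gd'.
  by rewrite -subr_ge0 e mulr_ge0 ?g0// subr_ge0 ltW.
have [/andP[ac cb]|nc] := boolP (a < c < b).
  apply: (@le_trans _ _ (g c)); apply: IH.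
  - exact: ltW.
  - by apply: cont_on_sub gc => //; exact: ltW.
  - by move=> x xac xs; apply: gd; rewrite ?inE ?negb_or ?xs ?andbT; [lra|rewrite lt_eqF//; lra].
  - by move=> x xac; apply: g0; lra.
  - exact: ltW.
  - by apply: cont_on_sub gc => //; exact: ltW.
  - by move=> x xac xs; apply: gd; rewrite ?inE ?negb_or ?xs ?andbT; [lra|rewrite gt_eqF//; lra].
  - by move=> x xac; apply: g0; lra.
apply: IH => // x xab xs; apply: gd => //; rewrite inE negb_or xs andbT.
by apply: contra nc => /eqP <-.
Qed.

Lemma spl_nondecr d l p a b : a <= b ->
  (forall x, a < x < b -> 0 <= p^`().[x] + spl d l x) ->
  p.[a] + spl d.+1 l a <= p.[b] + spl d.+1 l b.
Proof.
move=> ab pl0; apply: (@incr_except [seq c.2 | c <- l] (fun x => p.[x] + spl d.+1 l x)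
  (fun x => p^`().[x] + spl d l x)) => //.
- by apply: cont_onD; [exact: cont_on_poly|exact: cont_on_splS].
- move=> x _ xl; apply: (@is_deriveD _ _ _ (horner p) (spl d.+1 l)).
  by apply: is_derive_spl; rewrite xl orbT.
Qed.

Lemma spl_incr_le d l a b m M : a <= b -> (forall x, a < x < b -> m <= spl d l x <= M) ->
  m * (b - a) <= spl d.+1 l b - spl d.+1 l a <= M * (b - a).
Proof.
move=> ab lM.
have E t x : (t *: 'X)^`().[x] = t by rewrite derivZ derivX hornerZ hornerC mulr1.
have H1 : (- m *: 'X).[a] + spl d.+1 l a <= (- m *: 'X).[b] + spl d.+1 l b.
  by apply: spl_nondecr => // x xab; rewrite E; have := lM x xab; lra.
have H2 : (M *: 'X).[a] + spl d.+1 (scale_spl (-1) l) a <=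
          (M *: 'X).[b] + spl d.+1 (scale_spl (-1) l) b.
  by apply: spl_nondecr => // x xab; rewrite E spl_scale; have := lM x xab; lra.
by move: H1 H2; rewrite !hornerZ !hornerX !spl_scale; lra.
Qed.

Lemma deriv_eq0 p : p^`() = 0 -> p = (p`_0)%:P.
Proof.
move=> p'0; apply/polyP => -[|i]; rewrite coefC//=.
have /polyP/(_ i) := p'0; rewrite coef_deriv coef0 => /eqP.
by rewrite mulrn_eq0 => /eqP.
Qed.

(** ** Smooth transitions with given knots *)

Definition knots_in (K : R -> Prop) a b l := forall c, c \in l -> [/\ a < c.2, c.2 < b & K c.2].

Definition dense_in (K : R -> Prop) a b (rho : R) := forall u v,
  a <= u -> u < v -> v <= b -> rho <= v - u -> exists2 t, u < t < v & K t.

Lemma knots_in_cat K a b l1 l2 : knots_in K a b l1 -> knots_in K a b l2 ->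
  knots_in K a b (l1 ++ l2).
Proof. by move=> h1 h2 c; rewrite mem_cat => /orP[/h1|/h2]. Qed.

Lemma knots_in_scale K a b t l : knots_in K a b l -> knots_in K a b (scale_spl t l).
Proof. by move=> h c /mapP[c' /h h' ->]. Qed.

Lemma knots_in_sub K a b a' b' l : a' <= a -> b <= b' -> knots_in K a b l -> knots_in K a' b' l.
Proof. by move=> aa bb h c /h[ac cb Kc]; split=> //; lra. Qed.

Lemma dense_in_sub K a b a' b' rho : a <= a' -> b' <= b -> dense_in K a b rho -> dense_in K a' b' rho.
Proof. by move=> aa bb h u v au uv vb; apply: h => //; lra. Qed.

Lemma knots_left K a b l d x : knots_in K a b l -> x <= a -> spl d l x = 0.
Proof. by move=> kl xa; apply: spl_left => c /kl[ac _ _]; lra. Qed.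

Lemma knots_right K a b l d x : knots_in K a b l -> b <= x -> spl d l x = (right_poly d l).[x].
Proof. by move=> kl xa; apply: spl_right => c /kl[_ cb _]; lra. Qed.

(** A monotone smooth step from 0 to 1.  In the next degree it is the normalized integral of
    a bump, the difference of two steps in the outer thirds of the interval. *)
Lemma smooth_step d : exists2 C : R, 0 < C & forall (K : R -> Prop) a b rho, a < b ->
  dense_in K a b rho -> 3 ^+ d * rho <= b - a ->
  exists l, [/\ knots_in K a b l, right_poly d l = 1, forall x, 0 <= spl d l x <= 1,
    forall i x, (i <= d)%N -> `|spl i l x| * (b - a) ^+ (d - i) <= C &
    (0 < d)%N -> forall x, 0 <= spl d.-1 l x].
Proof.
elim: d => [|d [C C0 IH]].
  exists 1 => // K a b rho ab Kd; rewrite expr0 mul1r => rab.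
  have [t tab Kt] := Kd a b (lexx _) ab (lexx _) rab.
  have s01 x : 0 <= spl 0 [:: (1, t)] x <= 1.
    by rewrite /spl big_seq1 /tpow; case: ifP => _ /=; rewrite ?mulr0 ?expr0 ?fact0 ?divr1 ?mulr1 ?lexx ler01.
  exists [:: (1, t)]; split=> //.
  - by move=> c; rewrite inE => /eqP->; split=> //=; move: tab; lra.
  - by rewrite /right_poly big_seq1 expr0 fact0 divr1 scale1r.
  - move=> i x; rewrite leqn0 => /eqP->; rewrite subnn expr0 mulr1 ler_norml.
    by have := s01 x; lra.
exists (6 * C * 3 ^+ d + 1); first by rewrite ltr_pwDr// !mulr_ge0 ?exprn_ge0// ltW.
move=> K a b rho ab Kd rab; pose L := b - a.
have L0 : 0 < L by rewrite subr_gt0.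
pose a1 := a + L / 3; pose b1 := b - L / 3.
have aa1 : a < a1 by rewrite /a1; lra.
have bb1 : b1 < b by rewrite /b1; lra.
have ab1 : b1 = a1 + L / 3 by rewrite /b1 /a1 /L; field.
have [l1 [k1 r1 s1 t1 _]] : exists l, [/\ knots_in K a a1 l, right_poly d l = 1,
    forall x, 0 <= spl d l x <= 1,
    forall i x, (i <= d)%N -> `|spl i l x| * (a1 - a) ^+ (d - i) <= C &
    (0 < d)%N -> forall x, 0 <= spl d.-1 l x].
  apply: (IH K a a1 rho) => //; first by apply: dense_in_sub Kd => //; lra.
  by move: rab; rewrite exprS /a1 /L; lra.
have [l2 [k2 r2 s2 t2 _]] : exists l, [/\ knots_in K b1 b l, right_poly d l = 1,
    forall x, 0 <= spl d l x <= 1,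
    forall i x, (i <= d)%N -> `|spl i l x| * (b - b1) ^+ (d - i) <= C &
    (0 < d)%N -> forall x, 0 <= spl d.-1 l x].
  apply: (IH K b1 b rho) => //; first by apply: dense_in_sub Kd => //; lra.
  by move: rab; rewrite exprS /b1 /L; lra.
pose B := l1 ++ scale_spl (-1) l2.
have BE i x : spl i B x = spl i l1 x - spl i l2 x by rewrite spl_cat spl_scale mulN1r.
have kB : knots_in K a b B.
  by apply: knots_in_cat; [apply: knots_in_sub k1; lra|apply: knots_in_scale; apply: knots_in_sub k2; lra].
have B1 x : a1 <= x -> x <= b1 -> spl d B x = 1.
  by move=> ax xb; rewrite BE (knots_right _ k1)// (knots_left _ k2)// r1 hornerC subr0.
have B01 x : 0 <= spl d B x <= 1.
  have := s1 x; have := s2 x; rewrite BE; have [xb|bx] := leP x b1.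
    by rewrite (knots_left _ k2 xb); lra.
  rewrite (knots_right _ k1); last lra.
  by rewrite r1 hornerC; lra.
pose m := spl d.+1 B b.
have Ba : spl d.+1 B a = 0 by rewrite (knots_left _ kB).
have mon x y : x <= y -> spl d.+1 B x <= spl d.+1 B y.
  by move=> xy; have /andP[] := @spl_incr_le d B x y 0 1 xy (fun x _ => B01 x); lra.
have mL : L / 3 <= m.
  have := mon _ _ (ltW aa1); have := mon _ _ (ltW bb1); rewrite -/m Ba.
  have a1b1 : a1 <= b1 by rewrite ab1; lra.
  have B11 x : a1 < x < b1 -> 1 <= spl d B x <= 1 by move=> xab; rewrite B1 ?lexx//; lra.
  by have /andP[] := spl_incr_le a1b1 B11; rewrite ab1; lra.
have m0 : 0 < m by lra.
have rB : right_poly d.+1 B = m%:P.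
  have rB' : right_poly d.+1 B = ((right_poly d.+1 B)`_0)%:P.
    by apply: deriv_eq0; rewrite deriv_right_poly right_poly_cat right_poly_scale r1 r2 scaleN1r subrr.
  rewrite rB'; congr (_%:P).
  by have := knots_right d.+1 kB (lexx b); rewrite -/m rB' hornerC => ->; rewrite coefC.
exists (scale_spl m^-1 B); split.
- exact: knots_in_scale.
- by rewrite right_poly_scale rB -mul_polyC -polyCM mulVf ?gt_eqF.
- move=> x; rewrite spl_scale mulrC ler_pdivrMr// mul1r divr_ge0 ?(ltW m0)//=.
    have [xb|/ltW bx] := leP x b; first exact: mon.
    by rewrite (knots_right _ kB)// rB hornerC.
  have [xa|/ltW ax] := leP x a; first by rewrite (knots_left _ kB).
  by rewrite -Ba mon.
- move=> i x; rewrite leq_eqVlt => /orP[/eqP->|].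
    rewrite subnn expr0 mulr1 spl_scale normrM gtr0_norm ?invr_gt0// mulrC ler_pdivrMr//.
    have : 0 <= spl d.+1 B x <= m.
      have [xb|/ltW bx] := leP x b.
        rewrite mon// andbT; have [xa|/ltW ax] := leP x a; first by rewrite (knots_left _ kB).
        by rewrite -Ba mon.
      by rewrite (knots_right _ kB)// rB hornerC lexx ltW.
    move=> /andP[h0 h1]; rewrite ger0_norm// (le_trans h1)// ler_peMl ?(ltW m0)// lerDr.
    by rewrite !mulr_ge0 ?exprn_ge0// ltW.
  rewrite ltnS => id; rewrite subSn// exprS.
  have := t1 i x id; have := t2 i x id.
  have -> : a1 - a = L / 3 by rewrite /a1; ring.
  have -> : b - b1 = L / 3 by rewrite /b1; ring.
  rewrite expr_div_n !mulrA !ler_pdivrMr ?exprn_gt0// => h2 h1.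
  rewrite spl_scale BE normrM gtr0_norm ?invr_gt0// -/L.
  set P := L ^+ (d - i) in h1 h2 *; have P0 : 0 <= P by rewrite exprn_ge0// ltW.
  have e3 : C * 3 ^+ (d - i) <= C * 3 ^+ d.
    by rewrite ler_wpM2l ?(ltW C0)// ler_weXn2l ?leq_subr// ler1n.
  have h3 : `|spl i l1 x - spl i l2 x| * P <= 2 * (C * 3 ^+ d).
    apply: (@le_trans _ _ ((`|spl i l1 x| + `|spl i l2 x|) * P)); last lra.
    by rewrite ler_wpM2r// ler_normB.
  rewrite (_ : _ * _ * _ * _ = (`|spl i l1 x - spl i l2 x| * P) * (L / m)); last by ring.
  have h4 : L / m <= 3 by rewrite ler_pdivrMr//; lra.
  apply: (@le_trans _ _ (2 * (C * 3 ^+ d) * 3)); last by lra.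
  by rewrite ler_pM ?mulr_ge0 ?invr_ge0 ?(ltW L0) ?(ltW m0).
- by move=> _ x; rewrite spl_scale mulr_ge0 ?invr_ge0 ?(ltW m0)//; have /andP[] := B01 x.
Qed.

(** A transition from 0 to any polynomial, with all derivatives bounded in the scale of the
    interval. It integrates the transition to the derivative and repairs the constant of
    integration with a step. *)
Lemma smooth_transition d : exists2 C : R, 0 < C & forall (K : R -> Prop) a b rho Q M, a < b ->
  dense_in K a b rho -> 3 ^+ d * rho <= b - a -> (size Q <= d.+1)%N ->
  (forall j x, (j <= d)%N -> a <= x <= b -> `|Q^`(j).[x]| * (b - a) ^+ j <= M) ->
  exists l, [/\ knots_in K a b l, right_poly d l = Q &
    forall i x, (i <= d)%N -> a <= x <= b -> `|spl i l x| * (b - a) ^+ (d - i) <= C * M].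
Proof.
elim: d => [|d [C C0 IH]].
  exists 1 => // K a b rho Q M ab Kd; rewrite expr0 mul1r => rab sQ QM.
  have [t tab Kt] := Kd a b (lexx _) ab (lexx _) rab.
  have QE : Q = (Q`_0)%:P by apply: size1_polyC.
  have QM0 : `|Q`_0| <= M.
    by have := QM 0%N a isT; rewrite expr0 mulr1 derivn0 QE hornerC -QE; apply; rewrite lexx ltW.
  exists [:: (Q`_0, t)]; split=> //.
  - by move=> c; rewrite inE => /eqP->; split=> //=; move: tab; lra.
  - by rewrite /right_poly big_seq1 expr0 fact0 divr1 alg_polyC -QE.
  - move=> i x; rewrite leqn0 => /eqP-> _; rewrite subnn expr0 mulr1 mul1r.
    rewrite /spl big_seq1 /tpow; case: ifP => _ /=; first by rewrite expr0 fact0 divr1 mulr1.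
    by rewrite mulr0 normr0 (le_trans _ QM0).
have [D D0 DP] := smooth_step d.+1.
have CD0 : 0 < (1 + C) * D by rewrite mulr_gt0// addr_gt0.
exists (C + (1 + C) * D + (1 + C)); first by lra.
move=> K a b rho Q M ab Kd rab sQ QM; pose L := b - a.
have L0 : 0 < L by rewrite subr_gt0.
have M0 : 0 <= M by apply: le_trans (QM 0%N a isT _); rewrite ?mulr_ge0// lexx ltW.
have rho_le : 3 ^+ d * rho <= b - a.
  have [r0|r0] := leP rho 0; last first.
    have : 0 < 3 ^+ d * rho by rewrite mulr_gt0// exprn_gt0.
    by move: rab; rewrite exprS; lra.
  have : 0 <= 3 ^+ d * - rho by rewrite mulr_ge0 ?exprn_ge0// oppr_ge0.
  by move: L0; rewrite /L; lra.
have [||l0 [k0 r0 s0]] := IH K a b rho Q^`() (M / L) ab Kd rho_le.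
- by rewrite (leq_trans (size_poly _ _))//; case: (size Q) sQ.
- move=> j x jd xab; rewrite -derivSn ler_pdivlMr// -mulrA -exprSr.
  exact: QM.
have {}s0 i x : (i <= d)%N -> a <= x <= b -> `|spl i l0 x| * L ^+ (d.+1 - i) <= C * M.
  by move=> id xab; rewrite subSn// exprSr mulrA -ler_pdivlMr// -mulrA; apply: s0.
have [l1 [k1 r1 s1 t1 _]] := DP K a b rho ab Kd rab.
have [c cE] : exists c, Q - right_poly d.+1 l0 = c%:P.
  eexists; apply: deriv_eq0.
  by rewrite derivB deriv_right_poly r0 subrr.
have l0M x : a <= x <= b -> `|spl d.+1 l0 x| <= C * M.
  move=> xab; have := @spl_incr_le d l0 a x (- (C * M / L)) (C * M / L).
  rewrite (knots_left d.+1 k0 (lexx a)) subr0 => H.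
  have {H} : - (C * M / L) * (x - a) <= spl d.+1 l0 x <= C * M / L * (x - a).
    apply: H; first by move: xab; lra.
    move=> y yab; rewrite -ler_norml ler_pdivlMr//.
    by have := s0 d y (leqnn _); rewrite subSnn expr1; apply; lra.
  have : C * M / L * (x - a) <= C * M / L * L.
    by rewrite ler_wpM2l ?divr_ge0 ?mulr_ge0 ?(ltW L0) ?(ltW C0)// /L; move: xab; lra.
  rewrite divfK ?gt_eqF// ler_norml mulNr; lra.
have cM : `|c| <= (1 + C) * M.
  have bab : a <= b <= b by rewrite lexx ltW.
  have : c = Q.[b] - spl d.+1 l0 b.
    by rewrite (knots_right _ k0)// -hornerN -hornerD cE hornerC.
  move=> ->; rewrite (le_trans (ler_normB _ _))// mulrDl mul1r lerD ?l0M//.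
  by have := QM 0%N b isT bab; rewrite expr0 mulr1.
exists (l0 ++ scale_spl c l1); split.
- by apply: knots_in_cat => //; exact: knots_in_scale.
- by rewrite right_poly_cat right_poly_scale r1 alg_polyC -cE addrC subrK.
- move=> i x id xab; rewrite spl_cat spl_scale.
  have h1 : `|spl i l0 x| * L ^+ (d.+1 - i) <= C * M.
    move: id; rewrite leq_eqVlt => /orP[/eqP->|id]; last exact: s0.
    by rewrite subnn expr0 mulr1 l0M.
  have h2 : `|c * spl i l1 x| * L ^+ (d.+1 - i) <= (1 + C) * M * D.
    by rewrite normrM -[leLHS]mulrA; apply: ler_pM (t1 _ _ id) => //; rewrite mulr_ge0// exprn_ge0// ltW.
  apply: (@le_trans _ _ (`|spl i l0 x| * L ^+ (d.+1 - i) + `|c * spl i l1 x| * L ^+ (d.+1 - i))).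
    by rewrite -mulrDl ler_wpM2r ?exprn_ge0 ?(ltW L0)// ler_normD.
  have : 0 <= (1 + C) * M by rewrite mulr_ge0// addr_ge0// ltW.
  lra.
Qed.

(** Integrated steps placed on both sides of [y] have corners on both sides of [y]; a convex
    combination of the two moves the corner to [y] exactly. *)
Lemma smooth_corner d (K : R -> Prop) a y b rho : a < y -> y < b ->
  dense_in K a b rho -> 3 ^+ d * rho <= y - a -> 3 ^+ d * rho <= b - y ->
  exists l, [/\ knots_in K a b l, right_poly d.+1 l = 'X - y%:P,
    forall x, 0 <= spl d l x <= 1 & (0 < d)%N -> forall x, 0 <= spl d.-1 l x].
Proof.
have [C C0 CP] := smooth_step d.
have step u v : u < v -> a <= u -> v <= b -> dense_in K a b rho -> 3 ^+ d * rho <= v - u ->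
  exists l t, [/\ knots_in K u v l, u <= t <= v, right_poly d.+1 l = 'X - t%:P,
    forall x, 0 <= spl d l x <= 1 & (0 < d)%N -> forall x, 0 <= spl d.-1 l x].
  move=> uv au vb Kd rho_le.
  have [|l [kl rl s1 _ s2]] := CP K u v rho uv _ rho_le; first by apply: dense_in_sub Kd.
  have /deriv_eq0 rE : ('X - right_poly d.+1 l)^`() = 0.
    by rewrite derivB derivX deriv_right_poly rl subrr.
  exists l, ('X - right_poly d.+1 l)`_0; split=> //; last by rewrite -rE subKr.
  have := @spl_incr_le d l u v 0 1 (ltW uv) (fun x _ => s1 x).
  rewrite (knots_left d.+1 kl (lexx u)) (knots_right d.+1 kl (lexx v)) subr0.
  have : ('X - right_poly d.+1 l).[v] = ('X - right_poly d.+1 l)`_0 by rewrite {1}rE hornerC.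
  rewrite hornerD hornerN hornerX => <-; lra.
move=> ay yb Kd r1 r2.
have [l1 [t1 [k1 t1y e1 s1 u1]]] := step a y ay (lexx _) (ltW yb) Kd r1.
have [l2 [t2 [k2 t2y e2 s2 u2]]] := step y b yb (ltW ay) (lexx _) Kd r2.
(* the weights for which the corners at [t1] and [t2] have the centre of mass [y] *)
pose m := (t2 - y) / (t2 - t1).
have mE : m * t1 + (1 - m) * t2 = y.
  rewrite /m; have [t12|t12] := eqVneq t2 t1.
    by rewrite t12 subrr invr0 mulr0 mul0r add0r subr0 mul1r; lra.
  by field; rewrite subr_eq0.
have m01 : 0 <= m <= 1.
  rewrite /m; have [t12|t12] := eqVneq t2 t1; first by rewrite t12 subrr invr0 mulr0 lexx ler01.
  have t120 : 0 < t2 - t1 by rewrite subr_gt0 lt_neqAle eq_sym t12; lra.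
  by rewrite divr_ge0 ?ler_pdivrMr//; lra.
exists (scale_spl m l1 ++ scale_spl (1 - m) l2); split.
- by apply: knots_in_cat; apply: knots_in_scale; [apply: knots_in_sub k1|apply: knots_in_sub k2]; lra.
- rewrite right_poly_cat !right_poly_scale e1 e2 -mE -!mul_polyC.
  by rewrite !(polyCD, polyCN, polyCM) ?polyC1; ring.
- move=> x; rewrite spl_cat !spl_scale; have := s1 x; have := s2 x.
  move=> /andP[? ?] /andP[? ?]; case/andP: m01 => m0 m1.
  have : 0 <= m * spl d l1 x by rewrite mulr_ge0.
  have : 0 <= (1 - m) * spl d l2 x by rewrite mulr_ge0// subr_ge0.
  have : m * spl d l1 x <= m * 1 by rewrite ler_wpM2l.
  have : (1 - m) * spl d l2 x <= (1 - m) * 1 by rewrite ler_wpM2l// subr_ge0.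
  lra.
- move=> d0 x; rewrite spl_cat !spl_scale; case/andP: m01 => m0 m1.
  by rewrite addr_ge0// mulr_ge0 ?u1 ?u2// subr_ge0.
Qed.

End TruncatedPowers.

(** * Gluing polynomials smoothly under a shape constraint *)
Section Gluing.
Context {R : realType}.
Implicit Types (p P Q : {poly R}) (l : seq (R * R)) (a b x y t h M D E rho eta : R).
Implicit Types (d i j k n q r : nat) (K : R -> Prop).

Lemma smooth_bump d K a a1 b1 b rho : a < a1 -> a1 <= b1 -> b1 < b ->
  dense_in K a b rho -> 3 ^+ d * rho <= a1 - a -> 3 ^+ d * rho <= b - b1 ->
  exists l, [/\ knots_in K a b l, right_poly d l = 0, forall x, 0 <= spl d l x <= 1 &
    forall x, a1 <= x <= b1 -> spl d l x = 1].
Proof.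
move=> aa ab bb Kd r1 r2; have [C C0 CP] := @smooth_step R d.
have [|l1 [k1 e1 s1 _ _]] := CP K a a1 rho aa _ r1; first by apply: dense_in_sub Kd => //; lra.
have [|l2 [k2 e2 s2 _ _]] := CP K b1 b rho bb _ r2; first by apply: dense_in_sub Kd => //; lra.
have BE x : spl d (l1 ++ scale_spl (-1) l2) x = spl d l1 x - spl d l2 x.
  by rewrite spl_cat spl_scale mulN1r.
exists (l1 ++ scale_spl (-1) l2); split.
- by apply: knots_in_cat; [apply: knots_in_sub k1|apply: knots_in_scale; apply: knots_in_sub k2]; lra.
- by rewrite right_poly_cat right_poly_scale e1 e2 scaleN1r subrr.
- move=> x; have := s1 x; have := s2 x; rewrite BE; have [xb|bx] := leP x b1.
    by rewrite (knots_left d k2 xb); lra.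
  rewrite (knots_right d k1); last lra.
  by rewrite e1 hornerC; lra.
- move=> x /andP[ax xb]; rewrite BE (knots_left d k2 xb) (knots_right d k1 ax).
  by rewrite e1 hornerC subr0.
Qed.

Lemma derivn_affine p a h j :
  (p \Po (a%:P + h *: 'X))^`(j) = h ^+ j *: (p^`(j) \Po (a%:P + h *: 'X)).
Proof.
elim: j => [|j IH]; first by rewrite expr0 scale1r.
by rewrite derivnS IH derivZ deriv_affine scalerA exprSr derivnS.
Qed.

Lemma coef_derivn_le n j p M : (size p <= n)%N -> (forall i, `|p`_i| <= M) ->
  forall i, `|p^`(j)`_i| <= n%:R ^+ j * M.
Proof.
move=> sp pM; elim: j => [|j IH] i; first by rewrite expr0 mul1r.
rewrite derivnS exprS -mulrA; apply: coef_deriv_le => //.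
by rewrite (leq_trans (size_derivn_le j sp))// leq_subr.
Qed.

Definition coefl1 p : R := \sum_(i < size p) `|p`_i|.

Lemma coef_le_l1 p i : `|p`_i| <= coefl1 p.
Proof.
have [ip|pi] := ltnP i (size p); last by rewrite nth_default// normr0 sumr_ge0.
by rewrite /coefl1 (bigD1 (Ordinal ip))//= lerDl sumr_ge0.
Qed.

Lemma coefl1_ge0 p : 0 <= coefl1 p. Proof. exact: sumr_ge0. Qed.

Lemma coefl1_le n p M : (size p <= n)%N -> (forall i, `|p`_i| <= M) -> coefl1 p <= n%:R * M.
Proof.
move=> sp pM; have M0 : 0 <= M by apply: le_trans (pM 0%N).
apply: (@le_trans _ _ ((size p)%:R * M)); last by rewrite ler_wpM2r// ler_nat.
rewrite mulr_natl -[in X in _ *+ X](card_ord (size p)) -sumr_const.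
exact: ler_sum.
Qed.

Lemma horner_le1 n p x M : (size p <= n)%N -> `|x| <= 1 -> (forall i, `|p`_i| <= M) ->
  `|p.[x]| <= n%:R * M.
Proof. by move=> sp x1 pM; have := horner_le sp (lexx 1) x1 pM; rewrite expr1n mulr1. Qed.

(** Near the point where a polynomial is comparable to its norm it stays so on an interval of
    fixed length, because its derivative is bounded by its norm. *)
Lemma poly_large_somewhere n a b : -1 <= a -> a < b -> b <= 1 ->
  exists c kap : R, [/\ 0 < c, 0 < kap & forall p, (size p <= n)%N ->
    exists2 s, a <= s <= b & forall x, s <= x <= s + kap -> x <= 1 -> c * coefl1 p <= `|p.[x]|].
Proof.
move=> a1 ab b1; have [C C0 CP] := @poly_coef_bound R n a b ab.
pose m : R := n%:R + 1; have m0 : 0 < m by rewrite ltr_wpDl.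
exists ((2 * m * C)^-1), ((2 * m ^+ 3 * C)^-1); split.
- by rewrite invr_gt0 !mulr_gt0.
- by rewrite invr_gt0 !mulr_gt0// exprn_gt0.
move=> p sp; have [s sab ps] := CP p sp; exists s => // x xs x1.
set S := coefl1 p; have S0 : 0 <= S := coefl1_ge0 p.
have nm : n%:R <= m by rewrite /m lerDl.
have h1 : S <= m * (C * `|p.[s]|).
  by rewrite (le_trans (coefl1_le sp ps))// ler_wpM2r// mulr_ge0// ltW.
have h2 : `|p.[x] - p.[s]| <= m * (m * S) * `|x - s|.
  apply: (@diff_on_dist_le _ (-1) 1 (horner p) (horner p^`())); [exact: diff_on_poly| |lra|lra].
  move=> y y1; have := @horner_le1 n p^`() y (n%:R * S) _ _ (coef_deriv_le sp (coef_le_l1 p)).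
  move=> H; have {H} := H _ _; rewrite (leq_trans (size_poly _ _)) ?(leq_trans (leq_pred _))//.
  rewrite ler_norml => /(_ isT) H; have {}H := H _.
  rewrite (le_trans (H _)) ?ler_pM ?mulr_ge0// ?ler_wpM2r//; lra.
have h3 : m * (m * S) * `|x - s| <= (2 * m * C)^-1 * S.
  have xs' : `|x - s| <= (2 * m ^+ 3 * C)^-1 by rewrite ger0_norm; lra.
  apply: (@le_trans _ _ (m * (m * S) * (2 * m ^+ 3 * C)^-1)).
    by rewrite ler_wpM2l// !mulr_ge0// ltW.
  rewrite le_eqVlt; apply/orP; left; apply/eqP; field.
  by rewrite !gt_eqF.
have h4 : 2 * ((2 * m * C)^-1 * S) <= `|p.[s]|.
  have -> : 2 * ((2 * m * C)^-1 * S) = (m * C)^-1 * S by field; rewrite !gt_eqF.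
  by rewrite ler_pdivrMl ?mulr_gt0// -mulrA.
have := ler_distD p.[x] p.[s] 0; rewrite !subr0 (distrC p.[s]); lra.
Qed.

(** Each integral of a narrow bump is small, like its width, and remains small when it is
    integrated further over an interval of length 2. *)
Lemma bump_integrals K d eta l : 0 < eta -> 3 * eta <= 1 -> knots_in K (- (3 * eta)) (3 * eta) l ->
  right_poly d l = 0 -> (forall x, 0 <= spl d l x <= 1) ->
  forall i x, -1 <= x <= 1 -> `|spl (d + i.+1) l x| <= 6 * eta * 4 ^+ i /\
    `|(right_poly (d + i.+1) l).[x]| <= 6 * eta * 4 ^+ i.
Proof.
move=> eta0 eta1 kl rl s01; elim=> [|i IH] x x1.
  rewrite expr0 mulr1 addn1.
  have h t : - (3 * eta) <= t <= 3 * eta -> 0 <= spl d.+1 l t <= 6 * eta.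
    move=> /andP[t1 t2]; have := @spl_incr_le _ d l _ t 0 1 t1 (fun x _ => s01 x).
    by rewrite (knots_left d.+1 kl (lexx _)); lra.
  have rE : right_poly d.+1 l = ((right_poly d.+1 l)`_0)%:P.
    by apply: deriv_eq0; rewrite deriv_right_poly.
  have rx t : (right_poly d.+1 l).[t] = spl d.+1 l (3 * eta).
    by rewrite (knots_right d.+1 kl (lexx _)) rE !hornerC.
  have h3 := h (3 * eta) (ltac:(lra)).
  split; last by rewrite rx ger0_norm; lra.
  have [xl|lx] := leP x (- (3 * eta)); first by rewrite (knots_left d.+1 kl xl) normr0; lra.
  have [xr|rx'] := leP x (3 * eta).
    by have := h x (ltac:(lra)) => hx; rewrite ger0_norm; lra.
  by rewrite (knots_right d.+1 kl (ltW rx')) rx ger0_norm; lra.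
rewrite addnS exprS; set M := 6 * eta * 4 ^+ i in IH.
have -> : 6 * eta * (4 * 4 ^+ i) = 4 * M by rewrite /M; ring.
have M0 : 0 <= M by rewrite /M !mulr_ge0 ?exprn_ge0// ltW.
have S t : -1 <= t <= 1 -> `|spl (d + i.+1).+1 l t| <= 2 * M.
  move=> /andP[t0 t1].
  have e0 : spl (d + i.+1).+1 l (-1) = 0 by apply: knots_left kl _; lra.
  have sM u : -1 < u < t -> - M <= spl (d + i.+1) l u <= M.
    by move=> ut; rewrite -ler_norml; apply: (IH u _).1; lra.
  have := spl_incr_le t0 sM; rewrite e0 subr0.
  have : M * (t - -1) <= M * 2 by rewrite ler_wpM2l//; lra.
  rewrite ler_norml; lra.
split; first by have := S x x1; lra.
have e1 : (right_poly (d + i.+1).+1 l).[1] = spl (d + i.+1).+1 l 1.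
  by rewrite (knots_right (d + i.+1).+1 kl); last lra.
have : `|(right_poly (d + i.+1).+1 l).[x] - (right_poly (d + i.+1).+1 l).[1]| <= M * `|x - 1|.
  apply: (@diff_on_dist_le _ (-1) 1 _ (horner (right_poly (d + i.+1).+1 l)^`())); last 2 first.
  - by [].
  - by rewrite lexx andbT; lra.
  - exact: diff_on_poly.
  - by move=> t t1; rewrite deriv_right_poly; apply: (IH t _).2; lra.
have : M * `|x - 1| <= M * 2 by rewrite ler_wpM2l// ler_norml; lra.
have := S 1 (ltac:(lra)); rewrite e1 !ler_norml; lra.
Qed.

End Gluing.

Section Gluing2.
Context {R : realType}.
Implicit Types (p P Q : {poly R}) (l : seq (R * R)) (a b x y t h s M D E rho eta kap mu : R).
Implicit Types (d i j k n q r : nat) (K : R -> Prop).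

(** A polynomial with a zero of order [q] at the origin can be switched on near the origin
    with derivatives of order [q] that stay bounded however narrow the transition is. *)
Lemma narrow_transition q r : (q <= r)%N -> exists2 C : R, 0 < C & forall K eta rho p E,
  0 < eta -> eta <= 1 -> dense_in K (- eta) eta rho -> 3 ^+ r * rho <= 2 * eta ->
  (size p <= r.+1)%N -> (forall i, (i < q)%N -> p`_i = 0) -> (forall i, `|p`_i| <= E) ->
  exists l, [/\ knots_in K (- eta) eta l, right_poly r l = p &
    forall x, - eta <= x <= eta -> `|spl (r - q) l x| <= C * E /\ `|spl r l x| <= C * E].
Proof.
move=> qr; have [C C0 CP] := @smooth_transition R r.
pose N : R := r.+1%:R; have N1 : 1 <= N by rewrite ler1n.
pose m : R := 2 ^+ r * (N * N ^+ r).
have m0 : 0 < m by rewrite !mulr_gt0// ?exprn_gt0// (lt_le_trans ltr01).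
exists (C * m); first by rewrite mulr_gt0.
move=> K eta rho p E eta0 eta1 Kd rle sp p0 pE.
have E0 : 0 <= E by apply: le_trans (pE 0%N).
have etaq0 : 0 < eta ^+ q by rewrite exprn_gt0.
have etaq1 : eta ^+ q <= 1 by rewrite exprn_ile1// ltW.
have e2 : eta - - eta = 2 * eta by ring.
pose p1 := p \Po (0%:P + eta *: 'X).
have sp1 : (size p1 <= r.+1)%N by rewrite (leq_trans (size_affine _ _ _)).
have p1E i : `|p1`_i| <= E * eta ^+ q.
  have -> : p1`_i = p`_i * eta ^+ i.
    rewrite /p1 add0r comp_polyE coef_sum.
    under eq_bigr => k _ do rewrite coefZ exprZn coefZ coefXn.
    have [ip|pi] := ltnP i (size p).
      rewrite (bigD1 (Ordinal ip))//= eqxx mulr1 big1 ?addr0// => k ki.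
      rewrite (negPf (_ : i != k)) ?mulr0//; apply: contra ki => /eqP ik.
      exact/eqP/val_inj.
    rewrite nth_default// mul0r big1// => k _.
    by rewrite gtn_eqF ?mulr0// (leq_trans (ltn_ord k)).
  have [iq|qi] := ltnP i q; first by rewrite p0// mul0r normr0 mulr_ge0// ltW.
  rewrite normrM normrX (gtr0_norm eta0) ler_pM// ?exprn_ge0 ?(ltW eta0)//.
  by rewrite -(subnKC qi) exprD ler_piMr ?exprn_ile1 ?(ltW eta0)// ltW.
have M0 : 0 <= N * N ^+ r * (E * eta ^+ q).
  by rewrite !mulr_ge0 ?exprn_ge0// ltW.
have pM j x : (j <= r)%N -> - eta <= x <= eta ->
    `|p^`(j).[x]| * (eta - - eta) ^+ j <= m * E * eta ^+ q.
  move=> jr xeta; rewrite e2 exprMn.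
  have xE : x = 0 + eta * (x / eta) by rewrite add0r mulrC divfK// gt_eqF.
  have dE : p^`(j).[x] * eta ^+ j = p1^`(j).[x / eta].
    by rewrite /p1 derivn_affine hornerZ horner_affine -xE mulrC.
  have u1 : `|x / eta| <= 1.
    by rewrite normrM normfV (gtr0_norm eta0) ler_pdivrMr// mul1r ler_norml.
  have sp1' : (size p1^`(j) <= r.+1)%N.
    by rewrite (leq_trans (size_derivn_le j sp1))// leq_subr.
  have := horner_le1 sp1' u1 (coef_derivn_le j sp1 p1E).
  rewrite -dE normrM (ger0_norm (exprn_ge0 _ (ltW eta0))) -/N => H.
  have Nj : N ^+ j <= N ^+ r by rewrite ler_weXn2l.
  have tj : 2 ^+ j <= 2 ^+ r :> R by rewrite ler_weXn2l// ler1n.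
  have -> : `|p^`(j).[x]| * (2 ^+ j * eta ^+ j) = 2 ^+ j * (`|p^`(j).[x]| * eta ^+ j) by ring.
  have -> : m * E * eta ^+ q = 2 ^+ r * (N * N ^+ r * (E * eta ^+ q)) by rewrite /m; ring.
  rewrite ler_pM ?exprn_ge0 ?mulr_ge0 ?exprn_ge0 ?(ltW eta0)//.
  rewrite (le_trans H)// mulrA ler_wpM2r ?mulr_ge0 ?(ltW etaq0)//.
  by rewrite ler_wpM2l// (le_trans ler01).
have ee : - eta < eta by lra.
have [|l [kl rl sl]] := CP K (- eta) eta rho p (m * E * eta ^+ q) ee Kd _ sp pM.
  by rewrite e2.
exists l; split=> // x xeta.
have mE0 : 0 <= C * (m * E) by apply: mulr_ge0 (ltW C0) (mulr_ge0 (ltW m0) E0).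
have tq : 1 <= 2 ^+ q :> R by rewrite exprn_ege1// ler1n.
split.
  have := sl (r - q)%N x (leq_subr _ _) xeta; rewrite subKn// e2 exprMn.
  rewrite [leLHS]mulrA (_ : C * (m * E * eta ^+ q) = C * (m * E) * eta ^+ q); last by ring.
  rewrite ler_pM2r// => h.
  have : `|spl (r - q) l x| * 1 <= `|spl (r - q) l x| * 2 ^+ q by rewrite ler_wpM2l.
  lra.
have := sl r x (leqnn _) xeta; rewrite subnn expr0 mulr1 => /le_trans; apply.
have : C * (m * E) * eta ^+ q <= C * (m * E) * 1 by rewrite ler_wpM2l.
lra.
Qed.

(** The correction that makes room for the defects of a narrow transition.  Its derivative of
    order [q] starts as a bump at the place of the transition.  The polynomial into which the
    bump integrates is small, like the width of the bump; it is switched off on the interval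
    [s, s + kap], at the price of a small negative derivative of order [q], for which the
    convexity of the glued polynomials pays. *)
Lemma shape_correction q r : (0 < q)%N -> (q <= r)%N -> exists2 C : R, 0 < C &
  forall K eta kap rho s, 0 < eta -> 3 * eta <= 1 -> 0 < kap -> kap <= 1 -> 0 < rho ->
    dense_in K (-1) 1 rho -> 3 ^+ r * rho <= 2 * eta -> 3 ^+ r * rho <= kap ->
    -1 <= s -> s + kap <= 1 ->
    exists l, [/\ knots_in K (-1) 1 l, right_poly r l = 0,
      forall x, -1 <= x <= 1 -> `|spl r l x| <= C &
      forall x, -1 <= x <= 1 -> (- eta <= x <= eta)%R%:R - C * eta / kap ^+ q * (s < x < s + kap)%R%:R
        <= spl (r - q) l x].
Proof.
case: q => // q _ qr; have [C C0 CP] := @smooth_transition R r.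
pose F : R := 6 * 4 ^+ q; have F0 : 0 < F by rewrite mulr_gt0// exprn_gt0.
exists (C * F + 2 * F); first by rewrite addr_gt0 ?mulr_gt0.
move=> K eta kap rho s eta0 eta1 kap0 kap1 rho0 Kd r1 r2 s1 s2.
have r3 : 3 ^+ (r - q.+1) * rho <= 2 * eta.
  by apply: le_trans r1; rewrite ler_wpM2r ?(ltW rho0)// ler_weXn2l ?leq_subr// ler1n.
have [||||||B [kB rB B01 B1]] := @smooth_bump R (r - q.+1) K (- (3 * eta)) (- eta) eta (3 * eta) rho.
- lra.
- lra.
- lra.
- by apply: dense_in_sub Kd; lra.
- lra.
- lra.
have spB := bump_integrals eta0 eta1 kB rB B01.
have F1 i : (i <= q)%N -> 6 * eta * 4 ^+ i <= F * eta.
  by move=> iq; rewrite /F mulrAC ler_wpM2r ?(ltW eta0)// ler_wpM2l// ler_weXn2l// ler1n.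
have Feta : F * eta <= F by rewrite ler_piMr ?(ltW F0)//; lra.
have szB : (size (right_poly r B) <= r.+1)%N := size_right_poly _ _.
have BM j x : (j <= r)%N -> s <= x <= s + kap ->
    `|(right_poly r B)^`(j).[x]| * (s + kap - s) ^+ j <= F * eta.
  move=> jr xs; rewrite derivn_right_poly// addrAC subrr add0r.
  have kj : kap ^+ j <= 1 by rewrite exprn_ile1// ltW.
  have H : `|(right_poly (r - j) B).[x]| <= F * eta.
    have [jq|qj] := leqP j q.
      have -> : (r - j = r - q.+1 + (q - j).+1)%N by clear -jq qr; lia.
      have x1 : -1 <= x <= 1 by lra.
      exact: le_trans (spB (q - j)%N x x1).2 (F1 _ (leq_subr j q)).
    have -> : (r - j = r - q.+1 - (j - q.+1))%N by clear -qj qr jr; lia.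
    rewrite -derivn_right_poly; last by clear -qj qr jr; lia.
    by rewrite rB linear0 ?horner0 ?normr0 ?mulr_ge0 ?(ltW F0) ?(ltW eta0).
  apply: le_trans H; rewrite ler_piMr//.
have [|||g [kg rg sg]] := CP K s (s + kap) rho (right_poly r B) (F * eta) _ _ _ szB BM.
- lra.
- by apply: dense_in_sub Kd; lra.
- by rewrite addrAC subrr add0r.
have rgq : right_poly (r - q.+1) g = 0.
  by rewrite -derivn_right_poly// rg derivn_right_poly.
exists (B ++ scale_spl (-1) g); split.
- by apply: knots_in_cat; [apply: knots_in_sub kB|apply: knots_in_scale; apply: knots_in_sub kg]; lra.
- by rewrite right_poly_cat right_poly_scale rg scaleN1r subrr.
- move=> x x1; rewrite spl_cat spl_scale mulN1r.
  have rE : (r = r - q.+1 + q.+1)%N by rewrite subnK.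
  have h1 : `|spl r B x| <= F by rewrite rE (le_trans (spB q x x1).1)// (le_trans (F1 q _)).
  have h2 : `|spl r g x| <= C * F + F.
    have CF : 0 <= C * F by rewrite mulr_ge0// ltW.
    have [xs|sx] := leP x s; first by rewrite (knots_left r kg xs) normr0 addr_ge0// ltW.
    have [xk|kx] := leP x (s + kap).
      have := sg r x (leqnn _); rewrite subnn expr0 mulr1 => H.
      have {}H := H (ltac:(lra)); rewrite (le_trans H)//.
      by have : C * (F * eta) <= C * F; [rewrite ler_wpM2l// ltW|lra].
    rewrite (knots_right r kg (ltW kx)) rg {1}rE (le_trans (spB q x x1).2)//.
    by rewrite (le_trans (F1 q _))//; lra.
  by rewrite (le_trans (ler_normB _ _))//; lra.
- move=> x x1; rewrite spl_cat spl_scale mulN1r.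
  have hB : (- eta <= x <= eta)%R%:R <= spl (r - q.+1) B x.
    have [xe|_] := boolP (- eta <= x <= eta); first by rewrite (B1 x xe).
    by have /andP[] := B01 x.
  suff : - ((C * F + 2 * F) * eta / kap ^+ q.+1 * (s < x < s + kap)%R%:R) <= - spl (r - q.+1) g x by lra.
  have kq : 0 < kap ^+ q.+1 by rewrite exprn_gt0.
  rewrite lerN2; have [xs|sx] := leP x s.
    by rewrite (knots_left (r - q.+1) kg xs) /= mulr0.
  have [xk|kx] := ltP x (s + kap); last first.
    by rewrite (knots_right (r - q.+1) kg kx) rgq horner0 /= mulr0.
  rewrite mulr1 ler_pdivlMr// (le_trans (ler_norm _))// normrM (gtr0_norm kq).
  have := sg (r - q.+1)%N x (leq_subr _ _); rewrite subKn// addrAC subrr add0r => H.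
  have {}H := H (ltac:(lra)); rewrite (le_trans H)// mulrA ler_wpM2r ?(ltW eta0)//.
  by rewrite lerDl mulr_ge0// ltW.
Qed.

End Gluing2.

Section Gluing3.
Context {R : realType}.
Implicit Types (p P Q : {poly R}) (l : seq (R * R)) (a b x y t h s M D E B rho eta kap mu : R).
Implicit Types (d i j n q r : nat) (k : seq (R * R)) (K : R -> Prop).

Lemma coefl1_wide n p : (size p <= n)%N -> coefl1 p = \sum_(i < n) `|p`_i|.
Proof.
move=> sp; rewrite /coefl1 (big_ord_widen n (fun i => `|p`_i|) sp).
rewrite [LHS]big_mkcond; apply: eq_bigr => i _; case: ltnP => // pi.
by rewrite nth_default// normr0.
Qed.

Lemma coefl1B p1 p2 : coefl1 (p1 - p2) <= coefl1 p1 + coefl1 p2.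
Proof.
pose n := maxn (size p1) (size p2).
have s1 : (size p1 <= n)%N by rewrite leq_maxl.
have s2 : (size p2 <= n)%N by rewrite leq_maxr.
have s3 : (size (p1 - p2)%R <= n)%N by rewrite (leq_trans (size_polyD _ _))// size_polyN.
rewrite (coefl1_wide s1) (coefl1_wide s2) (coefl1_wide s3) -big_split.
by apply: ler_sum => i _; rewrite coefB ler_normB.
Qed.

(** Of two polynomials that are nonnegative on either side of the origin, one is at least
    half as large as their difference, and it exceeds a multiple of this on a whole
    subinterval away from the origin. *)
Lemma large_side n : exists c kap : R, [/\ 0 < c, 0 < kap, kap <= 1/8 &
  forall P Q, (size P <= n)%N -> (size Q <= n)%N ->
    (forall x, -1 <= x <= 0 -> 0 <= P.[x]) -> (forall x, 0 <= x <= 1 -> 0 <= Q.[x]) ->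
    exists s, [/\ -1 <= s, s + kap <= 1, s + kap <= - (1/8) \/ 1/8 <= s &
      forall x, s <= x <= s + kap -> c * coefl1 (Q - P) <= if x < 0 then P.[x] else Q.[x]]].
Proof.
have [ca [ka [ca0 ka0 A]]] := @poly_large_somewhere R n (- (1/2)) (- (1/4)) (ltac:(lra)) (ltac:(lra)) (ltac:(lra)).
have [cb [kb [cb0 kb0 A']]] := @poly_large_somewhere R n (1/4) (1/2) (ltac:(lra)) (ltac:(lra)) (ltac:(lra)).
pose c := Num.min ca cb / 2; have c0 : 0 < c by rewrite /c divr_gt0// lt_min ca0.
have ca2 : 2 * c <= ca by rewrite /c mulrC divfK// ge_min lexx.
have cb2 : 2 * c <= cb by rewrite /c mulrC divfK// ge_min lexx orbT.
pose kap := Num.min (1/8) (Num.min ka kb).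
have kap0 : 0 < kap by rewrite !lt_min ka0 kb0 !andbT; lra.
have kap8 : kap <= 1/8 by rewrite ge_min lexx.
have kapa : kap <= ka by rewrite !ge_min lexx orbT.
have kapb : kap <= kb by rewrite !ge_min lexx !orbT.
clearbody kap c; exists c, kap; split=> // P Q sP sQ P0 Q0.
have E2 := coefl1B Q P; set E := coefl1 (Q - P) in E2 *.
have E0 : 0 <= E := coefl1_ge0 _.
have half c' e v : 2 * c <= c' -> E / 2 <= e -> c' * e <= v -> c * E <= v.
  move=> cc ee; apply: le_trans; clear -c0 cc ee E0.
  by apply: (@le_trans _ _ (2 * c * (E / 2))); [lra|rewrite ler_pM//; lra].
have [EQ|EP] : E / 2 <= coefl1 Q \/ E / 2 <= coefl1 P.
  by clear -E2; have [?|?] := lerP (E / 2) (coefl1 Q); [left|right; lra].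
- have [s sab sc] := A' _ sQ; exists s; split; try (clear -sab kap8; lra).
  move=> x xs; have x1 : x < 0 = false by apply/negbTE; rewrite -leNgt; clear -xs sab; lra.
  rewrite x1; apply: half cb2 EQ _; rewrite -[leRHS]ger0_norm; last first.
    by apply: Q0; clear -xs sab kap8; lra.
  by apply: sc; clear -xs sab kap8 kapb; lra.
- have [s sab sc] := A _ sP; exists s; split; try (clear -sab kap8; lra).
  move=> x xs; have x1 : x < 0 by clear -xs sab kap8; lra.
  rewrite x1; apply: half ca2 EP _; rewrite -[leRHS]ger0_norm; last first.
    by apply: P0; clear -xs sab kap8; lra.
  by apply: sc; clear -xs sab kap8 kapa; lra.
Qed.

(** Positivity at a single point [x]: [pv] and [qv] are the derivatives of order [q] of the two
    polynomials there, [kv], [tv] and [hv] those of the list that carries the low degrees, of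
    the transition and of the correction. *)
Lemma glued_derivative_ge0 (x eta s kap c E CT N w pv qv kv tv hv : R) :
  0 < eta -> 3 * eta <= 1/8 -> 0 <= kv -> 0 <= E -> 0 <= CT -> 0 <= N ->
  s + kap <= - (1/8) \/ 1/8 <= s ->
  (x <= 0 -> 0 <= pv) -> (0 <= x -> 0 <= qv) ->
  (x <= - eta -> tv = 0) -> (eta <= x -> pv + tv = qv) ->
  (- eta <= x <= eta -> - (CT * E) <= tv) -> qv - pv <= N * E ->
  (s <= x <= s + kap -> c * E <= if x < 0 then pv else qv) ->
  (- eta <= x <= eta)%R%:R - w * (s < x < s + kap)%R%:R <= hv -> (CT + N) * E * w <= c * E ->
  0 <= pv + (kv + (tv + (CT + N) * E * hv)).
Proof.
move=> eta0 eta1 kv0 E0 CT0 N0 slr P0 Q0 tl tr tm pq good hx cE.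
have CE : 0 <= CT * E by rewrite mulr_ge0.
have NE : 0 <= N * E by rewrite mulr_ge0.
have KE : 0 <= (CT + N) * E by rewrite mulr_ge0// addr_ge0.
have {}hx := ler_wpM2l KE hx; set H := _ * _ * hv in hx *; clearbody H.
have [xs|xs] := boolP (s < x < s + kap).
  rewrite xs mulr1 mulrBr in hx.
  have e0 : 0 <= (CT + N) * E * (- eta <= x <= eta)%R%:R by rewrite mulr_ge0.
  have {hx} Hc : - (c * E) <= H by clear -e0 hx cE; lra.
  have {}good := good (ltac:(clear -xs; lra)); clear -slr xs good Hc kv0 eta0 eta1 tl tr.
  case: ltP good => x0 good.
    by rewrite tl; lra.
  by have := tr (ltac:(lra)); lra.
rewrite (negPf xs) mulr0 subr0 in hx.
have [xe|xe] := boolP (- eta <= x <= eta); last first.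
  rewrite (negPf xe) mulr0 in hx; clear -hx xe kv0 tl tr P0 Q0 eta0.
  have [x0|x0] := ltP x 0.
    by have := P0 (ltW x0); rewrite tl; lra.
  by have := tr (ltac:(lra)); have := Q0 x0; lra.
rewrite xe mulr1 in hx; have {}tm := tm xe.
have PE : - (N * E) <= pv.
  clear -P0 Q0 NE pq; have [x0|x0] := lerP x 0; first by have := P0 x0; lra.
  by have := Q0 (ltW x0); lra.
by rewrite mulrDl in hx; clear -hx tm PE kv0; lra.
Qed.

(** Two polynomials [P] and [Q] with derivatives of order [q] nonnegative on the left and on
    the right of the origin are glued near the origin. The list [k] takes care of the part of
    [Q - P] of degree less than [q]; the rest of [Q - P] is switched on by a narrow transition
    whose defect is proportional to the size [E] of the derivative of order [q] of [Q - P].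
    One of [P], [Q] has a derivative of order [q] of size at least [E / 2], hence large on
    some subinterval, and a correction moves the missing convexity from there. *)
Lemma glue_unit q r : (0 < q)%N -> (q <= r)%N -> exists eta rho C : R,
  [/\ 0 < eta <= 1, 0 < rho, 3 ^+ r * rho <= eta, 0 < C &
  forall K P Q k B D, dense_in K (-1) 1 rho -> (size P <= r.+1)%N -> (size Q <= r.+1)%N ->
    (forall x, -1 <= x <= 0 -> 0 <= P^`(q).[x]) -> (forall x, 0 <= x <= 1 -> 0 <= Q^`(q).[x]) ->
    (forall x, -1 <= x <= 1 -> `|(Q - P).[x]| <= D) ->
    knots_in K (- eta) eta k -> (size (right_poly r k) <= q)%N ->
    (forall i, (i < q)%N -> (Q - P - right_poly r k)`_i = 0) ->
    (forall x, 0 <= spl (r - q) k x) ->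
    (forall x, -1 <= x <= 1 -> `|spl r k x| <= B) ->
    exists l, [/\ knots_in K (-1) 1 l, right_poly r l = Q - P,
      forall x, -1 <= x <= 1 -> 0 <= P^`(q).[x] + spl (r - q) l x &
      forall x, -1 <= x <= 1 -> `|spl r l x| <= C * D + B]].
Proof.
move=> q0 qr; set n := r.+1.
have m11 : (-1 : R) < 1 by lra.
have [c1 c10 c1P] := @poly_coef_bound R n (-1) 1 m11.
have [c0 [kap [c00 kap0 kap8 A]]] := large_side n.
have [CT CT0 T] := @narrow_transition R q r qr.
have [CS CS0 S] := @shape_correction R q r q0 qr.
pose N : R := n%:R; have N0 : 0 < N by rewrite ltr0n.
pose w : R := CS / kap ^+ q; have w0 : 0 < w by rewrite divr_gt0// exprn_gt0.
have K0 : 0 < CT + N by rewrite addr_gt0.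
have c60 : 0 < (CT + N) * w by rewrite mulr_gt0.
(* the second bound makes the negative part of the correction smaller than the convexity
   available on the subinterval *)
pose eta := Num.min (1/32) (c0 / ((CT + N) * w)).
have eta0 : 0 < eta.
  by rewrite lt_min; apply/andP; split; [clear; lra|exact: divr_gt0].
have eta32 : eta <= 1/32 by rewrite ge_min lexx.
have etac : (CT + N) * w * eta <= c0 by rewrite mulrC -ler_pdivlMr// ge_min lexx orbT.
clearbody eta.
pose rho := Num.min eta kap / 3 ^+ r.
have rho0 : 0 < rho by rewrite divr_gt0 ?exprn_gt0// lt_min eta0.
have rhoE : 3 ^+ r * rho = Num.min eta kap by rewrite mulrC divfK// gt_eqF// exprn_gt0.
have rho1 : 3 ^+ r * rho <= eta by rewrite rhoE ge_min lexx.
have rho2 : 3 ^+ r * rho <= kap by rewrite rhoE ge_min lexx orbT.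
clearbody rho; clear rhoE.
have eta1 : eta <= 1 by clear -eta32; lra.
have eta3 : 3 * eta <= 1/8 by clear -eta32 eta0; lra.
have eta31 : 3 * eta <= 1 by clear -eta3; lra.
have kap1 : kap <= 1 by clear -kap8; lra.
have rho3 : 3 ^+ r * rho <= 2 * eta by clear -rho1 eta0; lra.
have em1 : -1 <= - eta by clear -eta1; lra.
pose c2 := N * (N ^+ q * c1).
have c20 : 0 < c2 by rewrite !mulr_gt0// exprn_gt0.
have K10 : 0 < CT + N + (CT + N) * CS by rewrite addr_gt0// mulr_gt0.
exists eta, rho, ((CT + N + (CT + N) * CS) * c2).
split=> //; [by rewrite eta0 eta1|by rewrite mulr_gt0|].
move=> K P Q k B D Kd sP sQ P0 Q0 PQD kk szk k0 kq kB.
pose Rq := (Q - P)^`(q); pose E := coefl1 Rq.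
have E0 : 0 <= E := coefl1_ge0 _.
have sR : (size (Q - P)%R <= n)%N by rewrite (leq_trans (size_polyD _ _))// geq_max sQ size_polyN.
have sder p : (size p <= n)%N -> (size p^`(q) <= n)%N.
  by move=> sp; rewrite (leq_trans (size_derivn_le q sp))// leq_subr.
have ED : E <= c2 * D.
  have [x x1 cx] := c1P _ sR.
  have cD i : `|(Q - P)`_i| <= c1 * D by rewrite (le_trans (cx i))// ler_wpM2l ?PQD// ltW.
  by have := coefl1_le (sder _ sR) (coef_derivn_le q sR cD); rewrite /c2 -!mulrA.
pose R2 := Q - P - right_poly r k.
have rk0 : right_poly (r - q) k = 0.
  rewrite -derivn_right_poly//; apply/eqP; rewrite -size_poly_leq0.
  by rewrite (leq_trans (size_derivn_le q szk))// subnn.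
have sR2 : (size R2 <= n)%N.
  by rewrite (leq_trans (size_polyD _ _))// geq_max sR size_polyN size_right_poly.
have R2q : R2^`(q) = Rq by rewrite derivnB derivn_right_poly// rk0 subr0.
have R2E i : `|R2`_i| <= E.
  have [iq|qi] := ltnP i q; first by rewrite k0// normr0.
  apply: le_trans (coef_le_l1 Rq (i - q)); rewrite -R2q coef_derivn subnKC// normrMn.
  by rewrite -[leRHS]mulr_natr ler_peMr// ler1n ffact_gt0.
have [t2 [kt rt st]] := T K eta rho R2 E eta0 eta1 (dense_in_sub em1 eta1 Kd) rho3 sR2 k0 R2E.
have [s [s1 s2 slr good]] := A _ _ (sder _ sP) (sder _ sQ) P0 Q0.
have [h [kh rh hM hq]] := S K eta kap rho s eta0 eta31 kap0 kap1 rho0 Kd rho3 rho2 s1 s2.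
have x1N x : -1 <= x <= 1 -> `|x| <= 1 by rewrite ler_norml.
have RqE x : -1 <= x <= 1 -> `|Rq.[x]| <= N * E.
  by move=> /x1N x1; apply: (horner_le1 (sder _ sR) x1 (coef_le_l1 _)).
exists (k ++ t2 ++ scale_spl ((CT + N) * E) h); split.
- apply: knots_in_cat; first exact: knots_in_sub kk.
  by apply: knots_in_cat; [exact: knots_in_sub kt|exact: knots_in_scale].
- by rewrite !right_poly_cat right_poly_scale rh scaler0 addr0 rt /R2 addrC subrK.
- move=> x x1; rewrite !spl_cat spl_scale.
  have /andP[x1l x1r] := x1.
  apply: (@glued_derivative_ge0 x eta s kap c0 E CT N (CS * eta / kap ^+ q) _ Q^`(q).[x]) => //.
  + exact: ltW.
  + by move=> x0; apply: P0; rewrite x1l.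
  + by move=> x0; apply: Q0; rewrite x0.
  + by move=> xe; rewrite (knots_left (r - q) kt xe).
  + move=> ex; rewrite (knots_right (r - q) kt ex) -derivn_right_poly// rt R2q /Rq derivnB.
    by rewrite hornerD hornerN addrC subrK.
  + by move=> xe; have [+ _] := st x xe; rewrite ler_norml => /andP[].
  + have := RqE x x1; rewrite ler_norml /Rq derivnB hornerD hornerN => /andP[_ +].
    by [].
  + by have := good x; rewrite -derivnB.
  + exact: hq.
  + rewrite (_ : _ * _ * _ = (CT + N) * w * eta * E); first by rewrite ler_wpM2r.
    by rewrite /w; move: (kap ^+ q)^-1 => X; clear; ring.
- move=> x x1; rewrite !spl_cat spl_scale.
  have h1 := kB x x1.
  have NE : 0 <= N * E by rewrite mulr_ge0// ltW.
  have CE : 0 <= CT * E by rewrite mulr_ge0// ltW.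
  have h2 : `|spl r t2 x| <= (CT + N) * E.
    have [xl|xl] := lerP x (- eta).
      by rewrite (knots_left r kt xl) normr0 mulrDl addr_ge0.
    have [xr|xr] := lerP x eta.
      have [|_ hx] := st x; first by rewrite xr ltW.
      by rewrite (le_trans hx)// mulrDl lerDl.
    rewrite (knots_right r kt (ltW xr)) rt.
    by rewrite (le_trans (horner_le1 sR2 (x1N _ x1) R2E))// mulrDl lerDr.
  have h3 : `|(CT + N) * E * spl r h x| <= (CT + N) * E * CS.
    by rewrite normrM ger0_norm ?mulr_ge0 ?(ltW K0)// ler_wpM2l ?hM// mulr_ge0// ltW.
  have h4 : (CT + N + (CT + N) * CS) * E <= (CT + N + (CT + N) * CS) * (c2 * D).
    by rewrite ler_wpM2l// ltW.
  have := ler_normD (spl r k x) (spl r t2 x + (CT + N) * E * spl r h x).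
  have := ler_normD (spl r t2 x) ((CT + N) * E * spl r h x).
  clear -h1 h2 h3 h4; lra.
Qed.

End Gluing3.

Section Gluing4.
Context {R : realType}.
Implicit Types (p P Q : {poly R}) (l : seq (R * R)) (a b x y t h s M D E B rho eta kap mu : R).
Implicit Types (d i j n q r : nat) (k : seq (R * R)) (K : R -> Prop).

(** The difference of the two polynomials vanishes at the origin, which suffices for [q = 1];
    for [q = 2] its linear part is taken over by a smooth corner. *)
Lemma glue_normalized q r : q = 1%N \/ q = 2%N -> (q <= r)%N -> exists rho C : R,
  [/\ 0 < rho, 0 < C &
  forall K P Q D, dense_in K (-1) 1 rho -> (size P <= r.+1)%N -> (size Q <= r.+1)%N ->
    (forall x, -1 <= x <= 0 -> 0 <= P^`(q).[x]) -> (forall x, 0 <= x <= 1 -> 0 <= Q^`(q).[x]) ->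
    P.[0] = Q.[0] -> (q = 2%N -> P^`().[0] <= Q^`().[0]) ->
    (forall x, -1 <= x <= 1 -> `|(Q - P).[x]| <= D) ->
    exists l, [/\ knots_in K (-1) 1 l, right_poly r l = Q - P,
      forall x, -1 <= x <= 1 -> 0 <= P^`(q).[x] + spl (r - q) l x &
      forall x, -1 <= x <= 1 -> `|spl r l x| <= C * D]].
Proof.
move=> q12 qr; have q0 : (0 < q)%N by case: q12 => ->.
have [eta [rho [C [/andP[eta0 eta1] rho0 rhoe C0 G]]]] := @glue_unit R q r q0 qr.
case: q12 => qE.
  exists rho, C; split=> // K P Q D Kd sP sQ P0 Q0 PQ _ PQD.
  have [||i|x|x _|l [kl rl l0 lD]] := G K P Q [::] 0 D Kd sP sQ P0 Q0 PQD.
  - by [].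
  - by rewrite right_poly_nil size_poly0.
  - by rewrite qE ltnS leqn0 => /eqP->; rewrite right_poly_nil subr0 -horner_coef0 hornerD hornerN PQ subrr.
  - by rewrite spl_nil.
  - by rewrite spl_nil normr0.
  by exists l; split=> // x x1; have := lD x x1; rewrite addr0.
have m11 : (-1 : R) < 1 by clear; lra.
have [c1 c10 c1P] := @poly_coef_bound R r.+1 (-1) 1 m11.
exists rho, (C + 2 * c1); split=> //; first by rewrite addr_gt0// mulr_gt0.
move=> K P Q D Kd sP sQ P0 Q0 PQ PQ' PQD.
have [d rE] : exists d, r = d.+1 by exists r.-1; rewrite prednK// (leq_trans _ qr)// qE.
have d0 : (0 < d)%N by rewrite -ltnS -rE (leq_trans _ qr)// qE.
have em1 : -1 <= - eta by clear -eta1; lra.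
have e0 : - eta < 0 by rewrite oppr_lt0.
have rd : 3 ^+ d * rho <= eta.
  apply: le_trans rhoe; rewrite rE ler_wpM2r ?(ltW rho0)// ler_weXn2l// ler1n//.
have [|||k [kk rk k01 k0]] := @smooth_corner R d K (- eta) 0 eta rho e0 eta0.
- exact: dense_in_sub Kd.
- by rewrite sub0r opprK.
- by rewrite subr0.
have {}k0 := k0 d0.
pose J := (Q - P)`_1.
have JE : J = Q^`().[0] - P^`().[0].
  by rewrite !horner_coef0 !coef_deriv !mulr1n /J coefB.
have J0 : 0 <= J by rewrite JE subr_ge0 PQ'.
have sR : (size (Q - P)%R <= r.+1)%N.
  by rewrite (leq_trans (size_polyD _ _))// geq_max sQ size_polyN.
have JD : J <= c1 * D.
  have [x x1 cx] := c1P _ sR; rewrite (le_trans (ler_norm _))// (le_trans (cx 1%N))//.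
  by rewrite ler_wpM2l ?PQD// ltW.
have rkE : right_poly r (scale_spl J k) = J *: 'X.
  by rewrite right_poly_scale rE rk subr0.
have [||i|x|x x1|l [kl rl l0 lD]] := G K P Q (scale_spl J k) (2 * J) D Kd sP sQ P0 Q0 PQD.
- exact: knots_in_scale.
- by rewrite rkE qE (leq_trans (size_scale_leq _ _))// size_polyX.
- rewrite qE rkE coefB coefZ coefX; case: i => [|[|//]] _ /=.
    by rewrite mulr0 subr0 -horner_coef0 hornerD hornerN PQ subrr.
  by rewrite mulr1 /J subrr.
- rewrite spl_scale mulr_ge0// qE rE subSS subn1; exact: k0.
- rewrite spl_scale normrM (ger0_norm J0) mulrC ler_wpM2r// rE.
  have xe : - 1 <= x by clear -x1; lra.
  have := @spl_incr_le R d k (-1) x 0 1 xe (fun t _ => k01 t).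
  rewrite (knots_left d.+1 kk em1) subr0 ler_norml; clear -x1; lra.
exists l; split=> // x x1; rewrite (le_trans (lD x x1))// (mulrDl C) lerD2l -[leRHS]mulrA.
by rewrite ler_wpM2l.
Qed.

Definition rescale y mu l : seq (R * R) := [seq (c.1, y + mu * c.2) | c <- l].

Lemma spl_rescale d y mu l x : 0 < mu ->
  spl d (rescale y mu l) x = mu ^+ d * spl d l ((x - y) / mu).
Proof.
move=> mu0; rewrite /spl /rescale big_map mulr_sumr; apply: eq_bigr => c _ /=.
have -> : x - (y + mu * c.2) = mu * ((x - y) / mu - c.2) by field; rewrite gt_eqF.
rewrite mulrCA; congr (_ * _); rewrite /tpow pmulr_rge0//; case: ifP => _; last by rewrite mulr0.
by rewrite exprMn mulrA.
Qed.

Lemma right_poly_rescale d y mu l : 0 < mu ->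
  right_poly d (rescale y mu l) \Po (y%:P + mu *: 'X) = mu ^+ d *: right_poly d l.
Proof.
move=> mu0; rewrite /right_poly /rescale big_map [LHS]raddf_sum scaler_sumr; apply: eq_bigr => c _ /=.
rewrite comp_polyZ [RHS]scalerA [mu ^+ d * _]mulrC -[RHS]scalerA; congr (_ *: _).
rewrite -exprZn [LHS]rmorphXn /= comp_polyB comp_polyX comp_polyC scalerBr.
by rewrite polyCD polyCM mul_polyC opprD addrACA subrr add0r.
Qed.

Lemma comp_affineK p y mu : mu != 0 ->
  (p \Po (y%:P + mu *: 'X)) \Po ((- y / mu)%:P + mu^-1 *: 'X) = p.
Proof.
move=> mu0; rewrite -comp_polyA comp_polyD comp_polyC comp_polyZ comp_polyX scalerDr.
rewrite scalerA divff// scale1r addrA -mul_polyC -polyCM -polyCD mulrC divfK//.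
by rewrite subrr add0r comp_polyXr.
Qed.

(** Smooth gluing of two polynomials under a shape constraint of order [q], at any place and
    in any scale: the knots have to be dense on the scale [mu], and the result differs from
    the polynomials by at most a constant times their distance. *)
Lemma glue q r : q = 1%N \/ q = 2%N -> (q <= r)%N -> exists rho C : R,
  [/\ 0 < rho, 0 < C &
  forall K y mu P Q D, 0 < mu -> dense_in K (y - mu) (y + mu) (rho * mu) ->
    (size P <= r.+1)%N -> (size Q <= r.+1)%N ->
    (forall x, y - mu <= x <= y -> 0 <= P^`(q).[x]) ->
    (forall x, y <= x <= y + mu -> 0 <= Q^`(q).[x]) ->
    P.[y] = Q.[y] -> (q = 2%N -> P^`().[y] <= Q^`().[y]) ->
    (forall x, y - mu <= x <= y + mu -> `|Q.[x] - P.[x]| <= D) ->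
    exists l, [/\ knots_in K (y - mu) (y + mu) l, right_poly r l = Q - P,
      forall x, y - mu <= x <= y + mu -> 0 <= P^`(q).[x] + spl (r - q) l x &
      forall x, y - mu <= x <= y + mu -> `|spl r l x| <= C * D]].
Proof.
move=> q12 qr; have [rho [C [rho0 C0 G]]] := glue_normalized q12 qr.
exists rho, C; split=> // K y mu P Q D mu0 Kd sP sQ P0 Q0 PQ PQ' PQD.
have mun0 : mu != 0 by rewrite gt_eqF.
pose S p := p \Po (y%:P + mu *: 'X).
have SE p x : (S p).[x] = p.[y + mu * x] := horner_affine _ _ _ _.
have SdE p j x : (S p)^`(j).[x] = mu ^+ j * p^`(j).[y + mu * x].
  by rewrite derivn_affine hornerZ horner_affine.
have lo x : -1 <= x -> y - mu <= y + mu * x.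
  by move=> x1; rewrite lerD2l -[- mu]mulrN1 ler_pM2l.
have hi x c : x <= c -> y + mu * x <= y + mu * c by move=> x1; rewrite lerD2l ler_pM2l.
have [|||x /andP[x1 x2]|x /andP[x1 x2]||q2|x /andP[x1 x2]|l [kl rl l0 lD]] :=
    G (fun t => K (y + mu * t)) (S P) (S Q) D.
- move=> u v u1 uv v1 uvr.
  have [||||t /andP[t1 t2] Kt] := Kd (y + mu * u) (y + mu * v).
  + exact: lo.
  + by rewrite ltrD2l ltr_pM2l.
  + by have := hi _ _ v1; rewrite mulr1.
  + by rewrite opprD addrACA subrr add0r -mulrBr mulrC ler_pM2l.
  have tE : t = y + mu * ((t - y) / mu) by field.
  exists ((t - y) / mu); last by rewrite -tE.
  by move: t1 t2; rewrite {1 2}tE !ltrD2l !ltr_pM2l// => -> ->.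
- by rewrite (leq_trans (size_affine _ _ _)).
- by rewrite (leq_trans (size_affine _ _ _)).
- rewrite SdE mulr_ge0 ?exprn_ge0 ?(ltW mu0)//; apply: P0.
  by rewrite lo//=; have := hi _ _ x2; rewrite mulr0 addr0.
- rewrite SdE mulr_ge0 ?exprn_ge0 ?(ltW mu0)//; apply: Q0.
  have := hi _ _ x2; rewrite mulr1 => ->; rewrite andbT.
  by have := hi _ _ x1; rewrite mulr0 addr0.
- by rewrite !SE mulr0 addr0.
- have e p : (S p)^`().[0] = mu * p^`().[y] by rewrite -derivn1 SdE expr1 derivn1 mulr0 addr0.
  by rewrite !e ler_pM2l// PQ'.
- rewrite hornerD hornerN !SE; apply: PQD; rewrite lo//=.
  by have := hi _ _ x2; rewrite mulr1.
pose L := scale_spl (mu ^- r) (rescale y mu l).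
have mur i : mu ^+ i != 0 by rewrite expf_neq0.
have LE x : spl r L x = spl r l ((x - y) / mu).
  by rewrite spl_scale spl_rescale// mulKf.
have tr x : y - mu <= x <= y + mu -> -1 <= (x - y) / mu <= 1.
  by rewrite ler_pdivlMr// ler_pdivrMr//; clear; lra.
have xE x : y + mu * ((x - y) / mu) = x by clear -mun0; field.
exists L; split.
- move=> c /mapP[c' /mapP[c'' /kl[c1 c2 Kc] ->] ->] /=; split=> //.
    by rewrite -[- mu]mulrN1 ltrD2l ltr_pM2l.
  by rewrite -[X in _ < _ + X]mulr1 ltrD2l ltr_pM2l.
- have /(congr1 (fun p => p \Po ((- y / mu)%:P + mu^-1 *: 'X))) := right_poly_rescale r y l mu0.
  rewrite comp_affineK// => e; rewrite right_poly_scale e comp_polyZ scalerA mulVf// scale1r rl.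
  by rewrite comp_polyB !comp_affineK.
- move=> x xy; have h := l0 _ (tr x xy); rewrite SdE xE in h.
  rewrite spl_scale spl_rescale//.
  have -> : mu ^- r * (mu ^+ (r - q) * spl (r - q) l ((x - y) / mu)) =
            mu ^- q * spl (r - q) l ((x - y) / mu).
    by rewrite mulrA; congr (_ * _); rewrite -{1}(subnK qr) exprD invfM mulrC mulrA divff// mul1r.
  have muq : 0 < mu ^+ q by rewrite exprn_gt0.
  rewrite -(@pmulr_rge0 _ (mu ^+ q) (_ + _))// mulrDr.
  by rewrite mulVKf.
- by move=> x xy; rewrite LE; apply: lD; exact: tr.
Qed.

Lemma incr_seq_le N (y : nat -> R) i j : (forall i, (i < N)%N -> y i < y i.+1) ->
  (i <= j)%N -> (j <= N)%N -> y i <= y j.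
Proof.
move=> Hy; elim: j => [|j IH]; first by rewrite leqn0 => /eqP->.
rewrite leq_eqVlt => /orP[/eqP->//|ij] jN; apply: le_trans (ltW (Hy j jN)).
by apply: IH => //; exact: ltnW.
Qed.

(** Assembling a spline from polynomial pieces [F 0], ..., [F N] that meet, with a corner of
    the right sign, at [y 1], ..., [y N]. The corners are smoothed in the disjoint
    neighbourhoods of radii [mu i], one after the other; outside them the spline coincides
    with the pieces. *)
Lemma assemble q r : q = 1%N \/ q = 2%N -> (q <= r)%N -> exists rho C : R,
  [/\ 0 < rho, 0 < C &
  forall K (N : nat) (y mu D : nat -> R) (F : nat -> {poly R}),
    (forall i, (i <= N)%N -> y i < y i.+1) ->
    (forall i, 0 <= mu i) -> (forall i, (i < N)%N -> 0 < mu i.+1) ->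
    (forall i, (i <= N)%N -> y i + mu i <= y i.+1 - mu i.+1) ->
    (forall i, (i < N)%N -> dense_in K (y i.+1 - mu i.+1) (y i.+1 + mu i.+1) (rho * mu i.+1)) ->
    (forall i, (i <= N)%N -> (size (F i) <= r.+1)%N) ->
    (forall i x, (i <= N)%N -> y i <= x <= y i.+1 -> 0 <= (F i)^`(q).[x]) ->
    (forall i, (i < N)%N -> (F i).[y i.+1] = (F i.+1).[y i.+1]) ->
    (forall i, (i < N)%N -> q = 2%N -> (F i)^`().[y i.+1] <= (F i.+1)^`().[y i.+1]) ->
    (forall i x, (i < N)%N -> y i.+1 - mu i.+1 <= x <= y i.+1 + mu i.+1 ->
       `|(F i.+1).[x] - (F i).[x]| <= D i.+1) ->
    exists l, [/\ knots_in K (y 0%N) (y N.+1) l,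
      forall x, y 0%N <= x <= y N.+1 -> 0 <= (F 0%N)^`(q).[x] + spl (r - q) l x &
      forall i x e, (i <= N)%N -> y i <= x <= y i.+1 -> 0 <= e ->
        ((0 < i)%N -> x <= y i + mu i -> D i <= e) ->
        ((i < N)%N -> y i.+1 - mu i.+1 <= x -> D i.+1 <= e) ->
        `|(F 0%N).[x] + spl r l x - (F i).[x]| <= C * e]].
Proof.
move=> q12 qr; have [rho [C [rho0 C0 G]]] := glue q12 qr.
exists rho, (C + 1); split=> //; first exact: addr_gt0.
move=> K N y mu D F Hy mu0 Hmu Hdis HK HsF HF HFy HFy' HD.
suff [l [kl _ _ ? ?]] : exists l, [/\ knots_in K (y 0%N) (y N + mu N) l,
    y 0%N <= y N, right_poly r l = F N - F 0%N,
    forall x, y 0%N <= x <= y N.+1 -> 0 <= (F 0%N)^`(q).[x] + spl (r - q) l x &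
    forall i x e, (i <= N)%N -> y i <= x <= y i.+1 -> 0 <= e ->
        ((0 < i)%N -> x <= y i + mu i -> D i <= e) ->
        ((i < N)%N -> y i.+1 - mu i.+1 <= x -> D i.+1 <= e) ->
        `|(F 0%N).[x] + spl r l x - (F i).[x]| <= (C + 1) * e].
  exists l; split=> //; apply: knots_in_sub kl => //.
  by have := Hdis N (leqnn _); have := mu0 N.+1; clear; lra.
elim: N Hy Hmu Hdis HK HsF HF HFy HFy' HD => [|N IH] Hy Hmu Hdis HK HsF HF HFy HFy' HD.
  exists [::]; split=> // [|x xy|i x e].
  - by rewrite right_poly_nil subrr.
  - by rewrite spl_nil addr0; apply: HF.
  - rewrite leqn0 => /eqP-> _ e0 _ _; rewrite spl_nil addr0 subrr normr0.
    by rewrite mulr_ge0// addr_ge0// ltW.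
have [l [kl y0N rl l0 lD]] := IH (fun i iN => Hy i (leqW iN)) (fun i iN => Hmu i (leqW iN))
  (fun i iN => Hdis i (leqW iN)) (fun i iN => HK i (leqW iN)) (fun i iN => HsF i (leqW iN))
  (fun i x iN => HF i x (leqW iN)) (fun i iN => HFy i (leqW iN)) (fun i iN => HFy' i (leqW iN))
  (fun i x iN => HD i x (leqW iN)); clear IH.
set Y := y N.+1; set M := mu N.+1; have M0 : 0 < M by apply: Hmu.
have YM : y N + mu N <= Y - M by apply: Hdis.
have Y1 : Y + M <= y N.+2 by have := Hdis N.+1 (leqnn _); have := mu0 N.+2; clear; rewrite /Y /M; lra.
have yN : y N < Y by apply: Hy; exact: leqW.
have muN := mu0 N.
have [|||x xY|x xY||||g [kg rg g0 gD]] := G K Y M (F N) (F N.+1) (D N.+1) M0.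
- exact: HK.
- exact: HsF (leqW _).
- exact: HsF.
- by apply: HF; rewrite ?leqW// -/Y; clear -xY YM muN; lra.
- by apply: HF; rewrite // -/Y; clear -xY Y1; lra.
- exact: HFy.
- exact: HFy'.
- by move=> x xY; apply: HD.
have lr j x : (j <= r)%N -> Y - M <= x -> spl (r - j) l x = (F N)^`(j).[x] - (F 0%N)^`(j).[x].
  move=> jr xY; rewrite (knots_right (r - j) kl); last by clear -xY YM; lra.
  by rewrite -derivn_right_poly// rl derivnB hornerD hornerN.
have lr0 x : Y - M <= x -> spl r l x = (F N).[x] - (F 0%N).[x].
  by move=> xY; have := lr 0%N x (leq0n _) xY; rewrite subn0 !derivn0.
exists (l ++ g); split.
- apply: knots_in_cat; first by apply: knots_in_sub kl => //; clear -YM M0; rewrite -/Y -/M; lra.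
  by apply: knots_in_sub kg => //; clear -YM muN y0N; lra.
- by clear -yN y0N; rewrite -/Y; lra.
- by rewrite right_poly_cat rl rg addrC addrA subrK.
- move=> x /andP[x0 x2]; rewrite spl_cat; have [xl|xl] := lerP x (Y - M).
    rewrite (knots_left (r - q) kg xl) addr0; apply: l0; rewrite x0 -/Y.
    by clear -xl M0; lra.
  rewrite (lr q)//; last exact: ltW.
  rewrite addrA addrCA subrr addr0; have [xr|xr] := lerP x (Y + M).
    by apply: g0; rewrite xr ltW.
  rewrite (knots_right (r - q) kg (ltW xr)) -derivn_right_poly// rg derivnB hornerD hornerN.
  rewrite addrCA subrr addr0; apply: HF => //; rewrite x2 -/Y andbT.
  by clear -xr M0; lra.
- move=> i x e iN /andP[xi1 xi2] e0 De1 De2; rewrite spl_cat.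
  have CE : 0 <= C * e by rewrite mulr_ge0// ltW.
  rewrite mulrDl mul1r; move: iN; rewrite leq_eqVlt => /orP[/eqP iE|]; last rewrite ltnS => iN.
    subst i; rewrite -/Y -/M in xi1 xi2 De1.
    rewrite lr0; last by clear -xi1 M0; lra.
    have [xr|xr] := lerP x (Y + M).
      have {}De1 := De1 isT xr.
      have xY : Y - M <= x <= Y + M by rewrite xr andbT; clear -xi1 M0; lra.
      have := gD x xY; have := HD N x (ltnSn _) xY.
      have : C * D N.+1 <= C * e by rewrite ler_wpM2l// ltW.
      rewrite !ler_norml; clear -De1; lra.
    rewrite (knots_right r kg (ltW xr)) rg hornerD hornerN.
    rewrite (_ : _ - _ = 0) ?normr0 ?addr_ge0//; by clear; ring.
  have [xl|xl] := lerP x (Y - M).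
    rewrite (knots_left r kg xl) addr0.
    have := lD i x e iN; rewrite xi1 xi2 mulrDl mul1r => H; apply: H => //.
    by move=> iN' ; apply: De2; exact: leqW.
  have iE : i = N.
    apply/eqP; rewrite eqn_leq iN leqNgt; apply/negP => iltN.
    have : y i.+1 <= y N.
      by apply: (@incr_seq_le N) => // i' i'N; apply: Hy; rewrite leqW// ltnW.
    by clear -xi2 xl YM muN; lra.
  subst i; rewrite lr0; last exact: ltW.
  rewrite -/Y in xi2.
  have xY : Y - M <= x <= Y + M by rewrite (ltW xl)/=; clear -xi2 M0; lra.
  have {}De2 := De2 (ltnSn _) (ltW xl).
  have := gD x xY; have : C * D N.+1 <= C * e by rewrite ler_wpM2l// ltW.
  rewrite !ler_norml; clear -e0; lra.
Qed.

End Gluing4.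

(** * Shape and smoothness of functions on [-1, 1] *)
Section Shape.
Context {R : realType}.
Implicit Types (p : {poly R}) (l : seq (R * R)) (f g s : R -> R) (a b c x y t e : R) (i j k m n q r : nat).

Lemma divided_difference1 f (t : 'I_2 -> R) :
  divided_difference f t = f (t ord0) / (t ord0 - t ord_max) + f (t ord_max) / (t ord_max - t ord0).
Proof.
rewrite /divided_difference; under eq_bigr do rewrite big_mkcond /=.
rewrite !big_ord_recl !big_ord0 /= !mulr1 !mul1r addr0.
by have -> : lift ord0 ord0 = ord_max :> 'I_2 by exact/val_inj.
Qed.

Lemma q_monotone1P f : q_monotone 1 f <->
  (forall x y, -1 <= x -> x <= y -> y <= 1 -> f x <= f y).
Proof.
split=> [fm x y x1 xy y1|fm t tinj t1].
  move: xy; rewrite le_eqVlt => /orP[/eqP->//|xy].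
  pose t (i : 'I_2) := if i == ord0 then x else y.
  have tinj : injective t.
    move=> [[|[|//]] hi] [[|[|//]] hj]; rewrite /t /= => e; apply/val_inj => //=.
      by move: xy; rewrite e ltxx.
    by move: xy; rewrite e ltxx.
  have t1 (i : 'I_2) : -1 <= t i <= 1 by rewrite /t; case: ifP => _; clear -x1 xy y1; lra.
  have := fm t tinj t1; rewrite divided_difference1 /t /=.
  have -> : f x / (x - y) + f y / (y - x) = (f y - f x) / (y - x).
    by field; rewrite !subr_eq0 ?(lt_eqF xy) ?(gt_eqF xy).
  by rewrite pmulr_lge0 ?invr_gt0 ?subr_gt0// subr_ge0.
rewrite divided_difference1; set x := t ord0; set y := t ord_max.
have xy : x != y by apply/eqP => /tinj.
have -> : f x / (x - y) + f y / (y - x) = (f y - f x) / (y - x).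
  by field; rewrite !subr_eq0 ?[y == x]eq_sym ?xy.
have := t1 ord0; have := t1 ord_max; rewrite -/x -/y => /andP[y0 y1] /andP[x0 x1].
have [xy'|yx] := lerP x y.
  by rewrite divr_ge0// subr_ge0// fm.
by rewrite -mulrNN -invrN !opprB divr_ge0// subr_ge0 ?fm// ltW.
Qed.

Lemma divided_difference2 f (t : 'I_3 -> R) (x := t ord0) (y := t (lift ord0 ord0)) (z := t ord_max) :
  divided_difference f t = f x / ((x - y) * (x - z)) + f y / ((y - x) * (y - z))
    + f z / ((z - x) * (z - y)).
Proof.
rewrite /divided_difference; under eq_bigr do rewrite big_mkcond /=.
rewrite !big_ord_recl !big_ord0 /= !mulr1 !mul1r addr0 addrA.
by have -> : lift ord0 (lift ord0 ord0) = ord_max :> 'I_3 by exact/val_inj.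
Qed.

Definition chord_convex f := forall x y z, -1 <= x -> x < y -> y < z -> z <= 1 ->
  (f y - f x) * (z - y) <= (f z - f y) * (y - x).

Lemma q_monotone2P f : q_monotone 2 f <-> chord_convex f.
Proof.
pose dd x y z := f x / ((x - y) * (x - z)) + f y / ((y - x) * (y - z)) + f z / ((z - x) * (z - y)).
have ddE x y z : x < y -> y < z ->
    dd x y z * ((y - x) * (z - y) * (z - x)) = (f z - f y) * (y - x) - (f y - f x) * (z - y).
  move=> xy yz; rewrite /dd; field.
  by rewrite !subr_eq0 ?(gt_eqF yz) ?(gt_eqF xy) ?(lt_eqF yz) ?(lt_eqF xy) ?(gt_eqF (lt_trans xy yz)) ?(lt_eqF (lt_trans xy yz)).
have pos x y z : x < y -> y < z -> 0 < (y - x) * (z - y) * (z - x).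
  by move=> xy yz; rewrite !mulr_gt0 ?subr_gt0// (lt_trans xy).
split=> [fm x y z x1 xy yz z1|fm t tinj t1].
  pose t (i : 'I_3) := if i == ord0 then x else if i == ord_max then z else y.
  have tinj : injective t.
    by move=> [[|[|[|//]]] hi] [[|[|[|//]]] hj]; rewrite /t /= => e; apply/val_inj => //=;
      move: xy yz; rewrite e => xy yz; have := lt_trans xy yz; rewrite ?ltxx in xy yz *.
  have t1 (i : 'I_3) : -1 <= t i <= 1.
    by rewrite /t; do 2?[case: ifP => _]; clear -x1 xy yz z1; lra.
  have := fm t tinj t1; rewrite divided_difference2 /t /= -/(dd x y z) => h.
  by rewrite -subr_ge0 -ddE// mulr_ge0// ltW// pos.
rewrite divided_difference2; set x := t ord0; set y := t (lift ord0 ord0); set z := t ord_max.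
rewrite -/(dd x y z).
have sorted u v w : -1 <= u -> u < v -> v < w -> w <= 1 -> 0 <= dd u v w.
  move=> u1 uv vw w1; rewrite -(pmulr_lge0 _ (pos u v w uv vw)) ddE// subr_ge0.
  exact: fm.
have s12 u v w : dd u v w = dd v u w by rewrite /dd [X in X + _]addrC [(w - u) * _]mulrC.
have s23 u v w : dd u v w = dd u w v.
  by rewrite /dd addrAC [(u - v) * _]mulrC.
have xy : x != y by apply/eqP => /tinj.
have xz : x != z by apply/eqP => /tinj.
have yz : y != z by apply/eqP => /tinj.
have := t1 ord0; have := t1 (lift ord0 ord0); have := t1 ord_max.
rewrite -/x -/y -/z => /andP[z0 z1] /andP[y0 y1] /andP[x0 x1].
case: (ltgtP x y) xy => // xy _; case: (ltgtP y z) yz => // yz _; case: (ltgtP x z) xz => // xz _.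
- exact: sorted.
- by clear -xy yz xz; lra.
- by rewrite s23 sorted.
- by rewrite s23 s12 sorted.
- by rewrite s12 sorted.
- by rewrite s12 s23 sorted.
- by clear -xy yz xz; lra.
- by rewrite s12 s23 s12 sorted.
Qed.

(** ** One-sided derivatives at the ends of [-1, 1] *)

Definition has_wderiv f x (d : R) := forall e, 0 < e -> exists2 del, 0 < del &
  forall y, -1 <= y <= 1 -> `|y - x| < del -> `|f y - f x - d * (y - x)| <= e * `|y - x|.

Lemma diff_quot_cvgP f x d : diff_quot f x @ within `[-1, 1] x^' --> d <-> has_wderiv f x d.
Proof.
have E y : y != x -> forall e, (`|d - diff_quot f x y| <= e) = (`|f y - f x - d * (y - x)| <= e * `|y - x|).
  move=> yx e; rewrite -(@ler_pM2r _ `|y - x|) ?normr_gt0 ?subr_eq0//.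
  by rewrite -normrM mulrBl /diff_quot divfK ?subr_eq0// distrC.
split=> [/cvgrPdist_le H e e0|H].
  have := H e e0; rewrite near_withinE near_withinE => /nbhs_ballP[del /= del0 dP].
  exists del => // y y1 yx; have [->|nyx] := eqVneq y x.
    by rewrite !subrr mulr0 subr0 normr0 mulr0.
  by rewrite -E//; apply: dP => //; rewrite /ball /= distrC.
apply/cvgrPdist_le => e e0; have [del del0 dP] := H e e0.
rewrite near_withinE near_withinE; apply/nbhs_ballP; exists del => //= y.
rewrite /ball/= => xy yx y1; rewrite E//; apply: dP => //.
by rewrite distrC.
Qed.

Lemma within_m11_proper x : -1 <= x <= 1 -> ProperFilter (within (`[-1, 1] : set R) x^').
Proof.
move=> x11; apply: Build_ProperFilter => /nbhs_ballP[del /= del0 dP].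
pose h := Num.min (1/2) (del / 2).
have h0 : 0 < h by rewrite lt_min; apply/andP; split; [clear; lra|rewrite divr_gt0].
have hd : h < del by rewrite gt_min (_ : del / 2 < del) ?orbT//; clear -del0; lra.
have h1 : h <= 1/2 by rewrite ge_min lexx.
pose y := if x <= 0 then x + h else x - h.
have yx : y - x = h \/ y - x = - h by rewrite /y; case: ifP => _; [left|right]; clear; lra.
have nyx : `|x - y| = h by rewrite distrC; case: yx => ->; rewrite ?normrN gtr0_norm.
apply: (dP y).
- by rewrite /ball/= nyx.
- by apply/eqP => e; move: nyx; rewrite e subrr normr0 => h00; move: h0; rewrite -h00 ltxx.
- by rewrite /= in_itv /= /y; case: (leP x 0) => x0; clear -x11 x0 h0 h1; lra.
Qed.

Lemma has_wderiv_derive f x d : -1 <= x <= 1 -> has_wderiv f x d ->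
  derivable_on `[-1, 1] f x /\ derive_on `[-1, 1] f x = d.
Proof.
move=> x1 /diff_quot_cvgP H; have PF := within_m11_proper x1.
split; first by apply/cvg_ex; exists d.
by apply: (@cvg_lim _ _ _ (within `[-1, 1] x^')).
Qed.

Lemma derivable_on_has_wderiv f x : -1 <= x <= 1 -> derivable_on `[-1, 1] f x ->
  has_wderiv f x (derive_on `[-1, 1] f x).
Proof. by move=> x1 H; apply/diff_quot_cvgP. Qed.

Lemma is_derive_has_wderiv f x d : is_derive x 1 f d -> has_wderiv f x d.
Proof.
move=> [fd fE] e e0; have : (fun h => h^-1 *: ((f \o shift x) (h *: (1 : R)) - f x)) @ 0^' --> d.
  by rewrite -fE; exact: fd.
move=> /cvgrPdist_le/(_ e e0); rewrite near_withinE => /nbhs_ballP[del /= del0 dP].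
exists del => // y _ yx; have [->|nyx] := eqVneq y x.
  by rewrite !subrr mulr0 subr0 normr0 mulr0.
have := dP (y - x); rewrite /ball /= sub0r normrN yx subr_eq0 nyx => /(_ isT isT).
rewrite /GRing.scale /= mulr1 subrK => H.
have yx0 : 0 < `|y - x| by rewrite normr_gt0 subr_eq0.
rewrite -(ler_pM2r yx0) -normrM mulrBl mulrAC mulVf ?subr_eq0// mul1r in H.
by rewrite distrC.
Qed.

Lemma has_wderiv_cont f (d : R -> R) : (forall x, -1 <= x <= 1 -> has_wderiv f x (d x)) -> cont_on (-1) 1 f.
Proof.
move=> H x e x1 e0; have [del del0 dP] := H x x1 1 ltr01.
pose M := 1 + `|d x|; have M0 : 0 < M by rewrite ltr_pwDl.
exists (Num.min del (e / M)); first by rewrite lt_min del0 divr_gt0.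
move=> y y1; rewrite lt_min => /andP[yx ye]; have {dP} := dP y y1 yx.
have : `|d x * (y - x)| = `|d x| * `|y - x| by rewrite normrM.
have : M * `|y - x| <= e by rewrite mulrC -ler_pdivlMr// ltW.
rewrite /M => h1 h2 h3; have := ler_normD (f y - f x - d x * (y - x)) (d x * (y - x)).
by rewrite subrK; clear -h1 h2 h3; lra.
Qed.

Lemma has_wderiv_is_derive f x d : -1 < x < 1 -> has_wderiv f x d -> is_derive x 1 f d.
Proof.
move=> x1 H; apply: is_derive_eps => e e0; have [del del0 dP] := H e e0.
exists (Num.min del (Num.min (x + 1) (1 - x))).
  by rewrite !lt_min del0; clear -x1; lra.
move=> h; rewrite !lt_min => /and3P[hd h1 h2]; have := dP (x + h).
rewrite addrAC subrr add0r; apply=> //.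
by move: h1 h2; rewrite !ltr_norml; clear; lra.
Qed.

(** A chain of derivatives in the ordinary sense computes the derivatives relative to
    [-1, 1]. *)
Lemma Cn_of_chain m f (g : nat -> R -> R) : (forall x, -1 <= x <= 1 -> f x = g 0%N x) ->
  (forall i x, (i < m)%N -> -1 <= x <= 1 -> is_derive x 1 (g i) (g i.+1 x)) ->
  cont_on (-1) 1 (g m) ->
  Cn `[-1, 1] m f /\
  (forall i x, (i <= m)%N -> -1 <= x <= 1 -> derive_on_n `[-1, 1] i f x = g i x).
Proof.
move=> fg gd gc.
have dE i : (i <= m)%N -> forall x, -1 <= x <= 1 -> derive_on_n `[-1, 1] i f x = g i x.
  elim: i => [|i IH] im x x1; first exact: fg.
  have [] := @has_wderiv_derive (derive_on_n `[-1, 1] i f) x (g i.+1 x) x1; last by [].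
  move=> e e0; have [del del0 dP] := is_derive_has_wderiv (gd i x im x1) e0.
  by exists del => // y y1 yx; rewrite !IH ?(ltnW im)//; apply: dP.
split; last by move=> i x im x1; exact: dE.
split.
  move=> i im x /= ; rewrite in_itv /= => x1.
  have [] := @has_wderiv_derive (derive_on_n `[-1, 1] i f) x (g i.+1 x) x1; last by [].
  move=> e e0; have [del del0 dP] := is_derive_has_wderiv (gd i x im x1) e0.
  by exists del => // y y1 yx; rewrite !dE ?(ltnW im)//; apply: dP.
apply/cont_onP; apply: cont_on_eq gc => x x1; by rewrite dE.
Qed.

Lemma Cn_diff_on m f i : Cn `[-1, 1] m f -> (i < m)%N ->
  diff_on (-1) 1 (derive_on_n `[-1, 1] i f) (derive_on_n `[-1, 1] i.+1 f).
Proof.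
move=> [fd _] im.
have H x : -1 <= x <= 1 -> has_wderiv (derive_on_n `[-1, 1] i f) x (derive_on_n `[-1, 1] i.+1 f x).
  by move=> x1; apply: derivable_on_has_wderiv => //; apply: fd.
split; first exact: has_wderiv_cont H.
by move=> x x1; apply: has_wderiv_is_derive => //; apply: H; clear -x1; lra.
Qed.

Lemma Cn_cont_on m f i : Cn `[-1, 1] m f -> (i <= m)%N -> cont_on (-1) 1 (derive_on_n `[-1, 1] i f).
Proof.
move=> fC; rewrite leq_eqVlt => /orP[/eqP->|im]; last by have [] := Cn_diff_on fC im.
by apply/cont_onP; have [] := fC.
Qed.

(** ** Splines given by a polynomial and a list of knots *)

Definition knot_of m (zt : nat -> R) t := exists2 i, (0 < i < m)%N & t = zt i.

Lemma is_spline_spl r m (zt : nat -> R) p l : is_partition m zt -> (size p <= r.+1)%N ->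
  (forall c : R * R, c \in l -> knot_of m zt c.2) -> is_spline r m zt (fun x => p.[x] + spl r l x).
Proof.
move=> [_ _ zinc] sp kl i im.
pose ll := [seq c <- l | c.2 <= zt i].
exists (p + right_poly r ll).
  by rewrite (leq_trans (size_polyD _ _))// geq_max sp size_right_poly.
move=> x /andP[x1 x2]; rewrite hornerD; congr (_ + _).
rewrite -spl_right; last by move=> c; rewrite mem_filter => /andP[ci _]; rewrite (le_trans ci)// ltW.
rewrite /spl /ll big_filter [RHS]big_mkcond big_seq [RHS]big_seq; apply: eq_bigr => c /kl[j /andP[_ jm] cj].
case: leP => // ci; rewrite /tpow subr_ge0 ifF ?mulr0//; apply/negbTE; rewrite -ltNge cj (lt_le_trans x2)//.
apply: (incr_seq_le zinc); last exact: ltnW.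
rewrite ltnNge; apply/negP => ji; have := incr_seq_le zinc ji (ltnW im).
by rewrite -cj leNgt ci.
Qed.

Lemma Cn_spl r p l : Cn `[-1, 1] r (fun x => p.[x] + spl r.+1 l x) /\
  (forall i x, (i <= r)%N -> -1 <= x <= 1 ->
     derive_on_n `[-1, 1] i (fun x => p.[x] + spl r.+1 l x) x = p^`(i).[x] + spl (r.+1 - i) l x).
Proof.
apply: (@Cn_of_chain r _ (fun i x => p^`(i).[x] + spl (r.+1 - i) l x)).
- by move=> x _; rewrite derivn0 subn0.
- move=> i x ir _; rewrite derivnS subSS.
  have e : (r.+1 - i = (r - i).+1)%N by rewrite subSn// ltnW.
  rewrite e; apply: (@is_deriveD _ _ _ (horner p^`(i)) (spl (r - i).+1 l)).
  by apply: is_derive_spl; rewrite subn_gt0 ir.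
- rewrite subSn// subnn; apply: cont_onD; [exact: cont_on_poly|exact: cont_on_splS].
Qed.

Lemma is_smooth_spline_spl r m (zt : nat -> R) p l : is_partition m zt -> (size p <= r.+1)%N ->
  (forall c : R * R, c \in l -> knot_of m zt c.2) -> is_smooth_spline r m zt (fun x => p.[x] + spl r l x).
Proof.
move=> zp sp kl; split; first exact: is_spline_spl.
by case: r sp => // r _ _; have [] := Cn_spl r p l.
Qed.

(** For [q = 2] the slopes of two adjacent chords are separated by the derivative at their
    common end. *)
Lemma q_monotone_spl q r p l : q = 1%N \/ q = 2%N ->
  (forall x y, -1 <= x -> x <= y -> y <= 1 ->
     p^`(q.-1).[x] + spl r l x <= p^`(q.-1).[y] + spl r l y) ->
  q_monotone q (fun x => p.[x] + spl (r + q.-1) l x).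
Proof.
case=> -> /= H; first by apply/q_monotone1P => x y x1 xy y1; rewrite addn0; apply: H.
apply/q_monotone2P => x y z x1 xy yz z1; rewrite addn1.
pose v := p^`().[y] + spl r l y.
have vE t : (p - v *: 'X)^`().[t] = p^`().[t] - v.
  by rewrite derivB derivZ derivX hornerD hornerN hornerZ hornerC mulr1.
have vN t : (v *: 'X - p)^`().[t] = v - p^`().[t].
  by rewrite derivB derivZ derivX hornerD hornerN hornerZ hornerC mulr1.
have h1 : (p - v *: 'X).[y] + spl r.+1 l y <= (p - v *: 'X).[z] + spl r.+1 l z.
  apply: spl_nondecr; first exact: ltW.
  move=> t /andP[yt tz]; rewrite vE; have := H y t (ltac:(clear -x1 xy; lra)) (ltW yt) (ltac:(clear -tz z1; lra)).
  by rewrite ?derivn1 /v; clear; lra.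
have h2 : (v *: 'X - p).[x] + spl r.+1 (scale_spl (-1) l) x <=
          (v *: 'X - p).[y] + spl r.+1 (scale_spl (-1) l) y.
  apply: spl_nondecr; first exact: ltW.
  move=> t /andP[xt ty]; rewrite vN spl_scale.
  have := H t y (ltac:(clear -x1 xt; lra)) (ltW ty) (ltac:(clear -yz z1; lra)).
  by rewrite ?derivn1 /v; clear; lra.
rewrite !hornerD !hornerN !hornerZ !hornerX !spl_scale in h1 h2.
clear vE vN H; clearbody v.
have h3 : v * (z - y) <= p.[z] + spl r.+1 l z - (p.[y] + spl r.+1 l y) by clear -h1; lra.
have h4 : p.[y] + spl r.+1 l y - (p.[x] + spl r.+1 l x) <= v * (y - x) by clear -h2; lra.
have zy0 : 0 <= z - y by rewrite subr_ge0 ltW.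
have yx0 : 0 <= y - x by rewrite subr_ge0 ltW.
apply: le_trans (ler_wpM2r zy0 h4) _; apply: le_trans (ler_wpM2r yx0 h3).
by rewrite mulrAC.
Qed.

Lemma q_monotone_spl_ge0 q r p l : q = 1%N \/ q = 2%N -> (q <= r)%N ->
  (forall x, -1 <= x <= 1 -> 0 <= p^`(q).[x] + spl (r - q) l x) ->
  q_monotone q (fun x => p.[x] + spl r l x).
Proof.
move=> q12 qr H; have q0 : (0 < q)%N by case: q12 => ->.
have {1}-> : r = ((r - q).+1 + q.-1)%N by rewrite addSnnS prednK// subnK.
apply: q_monotone_spl => // x y x1 xy y1; apply: spl_nondecr => // t /andP[xt ty].
rewrite -derivnS prednK//; apply: H; clear -x1 y1 xt ty; lra.
Qed.

End Shape.

(** * Essential suprema of continuous functions *)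
Section Norms.
Context {R : realType}.
Implicit Types (f g : R -> R) (J : set R) (a b x h M w e u v : R) (k n : nat).

Lemma lebesgue_measureT_gt0 : (0 < @lebesgue_measure R [set: R])%E.
Proof.
rewrite (@lt_le_trans _ _ (@lebesgue_measure R `[0, 1]))//.
  by rewrite lebesgue_measure_itv/= lte_fin ltr01 sube0 lte_fin ltr01.
by apply: le_measure; rewrite ?inE//; exact: measurableT.
Qed.

Lemma Linfty_normE J f : Linfty_norm J f =
  ess_sup (@lebesgue_measure R) (fun x => (if x \in J then `|f x| else 0)%:E).
Proof.
rewrite /Linfty_norm unlock lebesgue_measureT_gt0; congr ess_sup.
by apply/funext => x /=; case: ifP => _ //=; rewrite normr0.
Qed.

Lemma Linfty_norm_ge0 J f : (0 <= Linfty_norm J f)%E.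
Proof.
rewrite Linfty_normE; apply: ess_sup_gee; first exact: lebesgue_measureT_gt0.
by apply: nearW => x; rewrite lee_fin; case: ifP.
Qed.

Lemma Linfty_norm_le J f M : 0 <= M -> (forall x, J x -> `|f x| <= M) ->
  (Linfty_norm J f <= M%:E)%E.
Proof.
move=> M0 fM; rewrite Linfty_normE; apply/ess_supP; apply: nearW => x; rewrite lee_fin.
by case: ifPn => // /set_mem /fM.
Qed.

(** An essential bound for a continuous function holds at every point of an interval,
    since an excess would persist on an interval of positive measure. *)
Lemma Linfty_norm_point J f M u v x : (Linfty_norm J f <= M%:E)%E -> u < v ->
  (forall y, u <= y <= v -> J y) -> cont_on u v f -> u <= x <= v -> `|f x| <= M.
Proof.
rewrite Linfty_normE => /ess_supP fM uv uvJ fc xuv.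
rewrite leNgt; apply/negP => Mx.
have e0 : 0 < (`|f x| - M) / 2 by rewrite divr_gt0// subr_gt0.
have [d d0 dP] := fc x _ xuv e0.
pose c := Num.max u (x - d / 2); pose c' := Num.min v (x + d / 2).
have cc' : c < c'.
  by rewrite /c /c' gt_max !lt_min; clear -d0 xuv uv; apply/andP; split; apply/andP; split; lra.
have big y : c < y < c' -> M < `|f y|.
  rewrite /c /c' gt_max lt_min => /andP[/andP[y1 y2] /andP[y3 y4]].
  have := dP y (ltac:(clear -y1 y3; lra)) (ltac:(rewrite ltr_norml; clear -y2 y4 d0; lra)).
  by have := lerB_dist (f x) (f y); rewrite distrC; clear -Mx; lra.
have yuv y : c < y < c' -> J y.
  rewrite /c /c' gt_max lt_min => /andP[/andP[y1 y2] /andP[y3 y4]].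
  by apply: uvJ; rewrite !ltW.
have [N [mN N0 NP]] := fM.
have sub : `]c, c'[ `<=` N.
  move=> y; rewrite /= in_itv /= => yc; apply: NP => /=.
  rewrite (mem_set (yuv y yc)) lee_fin; apply/negP.
  by rewrite -ltNge big.
have : (@lebesgue_measure R `]c, c'[ <= @lebesgue_measure R N)%E.
  by apply: le_measure; rewrite ?inE.
by rewrite N0 lebesgue_measure_itv/= lte_fin cc' -EFinB lee_fin subr_le0 leNgt cc'.
Qed.

Lemma sum_fdiff k h g x :
  \sum_(i < k.+1) 'C(k, i)%:R * (-1) ^+ (k - i) * g (x + i%:R * h) = fdiff h k g x.
Proof.
elim: k x => [|k IH] x; first by rewrite big_ord1 bin0 subnn expr0 !mul1r mul0r addr0.
rewrite /= -!IH big_ord_recl bin0 subn0 mul1r mul0r addr0.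
have -> : \sum_(i < k.+1) 'C(k.+1, bump 0 i)%:R * (-1) ^+ (k.+1 - bump 0 i) * g (x + (bump 0 i)%:R * h) =
    \sum_(i < k.+1) 'C(k, i)%:R * (-1) ^+ (k - i) * g (x + h + i%:R * h) +
    \sum_(i < k.+1) 'C(k, i.+1)%:R * (-1) ^+ (k - i) * g (x + i.+1%:R * h).
  rewrite -big_split; apply: eq_bigr => i _ /=.
  rewrite /bump leq0n add1n binS natrD subSS.
  rewrite (_ : x + h + i%:R * h = x + i.+1%:R * h); last by rewrite -[i.+1%:R]natr1; ring.
  by ring.
rewrite addrCA; congr (_ + _).
rewrite big_ord_recr /= bin_small// !mul0r addr0 [in RHS]big_ord_recl bin0 subn0 mul1r mul0r addr0.
rewrite opprD exprS mulN1r mulNr; congr (_ + _).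
rewrite -sumrN; apply: eq_bigr => i _; rewrite /= /bump leq0n add1n.
by rewrite (_ : (k - i = (k - i.+1).+1)%N) ?exprS ?subnSK// mulN1r mulrN mulNr.
Qed.

Lemma fin_diff_itv k h g x a b : a <= x - k%:R * h / 2 -> x + k%:R * h / 2 <= b -> 0 <= h ->
  fin_diff k h g x `[a, b] = fdiff h k g (x - k%:R * h / 2).
Proof.
move=> xa xb h0; have kh : 0 <= k%:R * h by rewrite mulr_ge0.
rewrite /fin_diff sum_fdiff ifT//; apply/andP; split; apply/mem_set; rewrite /= in_itv /=.
  by rewrite xa; clear -xb kh; lra.
by rewrite xb andbT; clear -xa kh; lra.
Qed.

Lemma omega_le k g a b M : 0 <= M ->
  (forall h x, 0 < h -> a <= x -> x + k%:R * h <= b -> `|fdiff h k g x| <= M) ->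
  (omega k g a b <= M%:E)%E.
Proof.
move=> M0 gM; rewrite /omega /omega_t; apply: ge_ereal_sup => _ [h /= /andP[h0 hb] <-].
apply: Linfty_norm_le => // x _; rewrite /fin_diff sum_fdiff.
case: ifP => [/andP[/set_mem + /set_mem]|_]; last by rewrite normr0.
rewrite /= !in_itv /= => /andP[x1 _] /andP[_ x2]; apply: gM => //.
by clear -x2; lra.
Qed.

Lemma omega_ge0 k g a b : a < b -> (0 <= omega k g a b)%E.
Proof.
move=> ab; rewrite /omega /omega_t.
apply: (@le_trans _ _ (Linfty_norm `[a, b] (fun x => fin_diff k (b - a) g x `[a, b]))).
  exact: Linfty_norm_ge0.
by apply: ereal_sup_ubound; exists (b - a) => //=; rewrite subr_gt0 ab lexx.
Qed.

Lemma omega_mod_le k g a b w : a < b -> cont_on a b g -> (omega k g a b <= w%:E)%E ->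
  mod_le k g a b w.
Proof.
move=> ab gc gw; have w0 : 0 <= w by have := le_trans (omega_ge0 k g ab) gw; rewrite lee_fin.
have H h x : 0 < h -> h <= b - a -> k%:R * h < b - a -> a <= x -> x + k%:R * h <= b -> `|fdiff h k g x| <= w.
  move=> h0 hb kh xa xb; set c := k%:R * h / 2.
  pose G y := fin_diff k h g y `[a, b].
  have GE y : a + c <= y <= b - c -> G y = fdiff h k g (y - c).
    by move=> yc; rewrite /G fin_diff_itv ?(ltW h0)//; move: yc; rewrite /c; clear; lra.
  have Gw : (Linfty_norm `[a, b] G <= w%:E)%E.
    by apply: le_trans gw; apply: ereal_sup_ubound; exists h => //=; rewrite h0.
  have kh0 : 0 <= k%:R * h by rewrite mulr_ge0// ltW.
  have := @Linfty_norm_point `[a, b] G w (a + c) (b - c) (x + c) Gw.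
  rewrite GE ?addrK; last by rewrite /c; clear -xa xb; lra.
  apply.
  - by rewrite /c; clear -kh; lra.
  - by move=> y yc; rewrite /= in_itv /=; move: yc; rewrite /c; clear -kh0; lra.
  - apply: (@cont_on_eq _ _ _ (fun y => fdiff h k g (y - c))) => [y yc|]; first by rewrite GE.
    have := cont_on_shift (s := - c) (cont_on_fdiff (k := k) (ltW h0) gc).
    by rewrite !opprK; apply: cont_on_sub; rewrite /c; clear; lra.
  - by rewrite /c; clear -xa xb; lra.
move=> h x h0 kh xa xb; case: (leP h (b - a)) => hb; first exact: H.
case: k kh xb H gw => [|k] kh xb H gw; last first.
  have : h <= k.+1%:R * h by rewrite ler_peMl ?(ltW h0)// ler1n.
  by clear -hb kh; lra.
apply: (H (b - a) x) => //; rewrite ?mul0r ?subr_gt0//.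
by move: xb; rewrite !mul0r.
Qed.

Lemma omega_finite k g a b : a < b -> cont_on a b g ->
  exists2 w, 0 <= w & omega k g a b = w%:E.
Proof.
move=> ab gc; have [c cab cM] := cont_on_bounded (ltW ab) gc.
have M0 : 0 <= 2 ^+ k * `|g c| by rewrite mulr_ge0// exprn_ge0.
have wM : (omega k g a b <= (2 ^+ k * `|g c|)%:E)%E.
  apply: omega_le => // h x h0 xa xb; apply: fdiff_le => i ik; apply: cM.
  have : i%:R * h <= k%:R * h by rewrite ler_pM2r// ler_nat.
  by have : 0 <= i%:R * h by [rewrite mulr_ge0// ltW]; clear -xa xb; lra.
have w0 := omega_ge0 k g ab.
have wf : omega k g a b \is a fin_num.
  by rewrite ge0_fin_numE// (le_lt_trans wM)// ltry.
by exists (fine (omega k g a b)); [rewrite fine_ge0|rewrite fineK].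
Qed.

End Norms.

(** * From polynomial pieces to splines on a remesh *)
Section Pieces.
Context {R : realType}.
Implicit Types (p P Q : {poly R}) (f : R -> R) (z zt y mu E : nat -> R) (a b x u v t e : R) (i j k m n q r N : nat).

(** Two neighbouring pieces that approximate the same function are close to each other:
    both are close to one polynomial by Whitney's inequality, first on their own sides of the
    common point and then, as polynomials do not grow fast, on both sides. *)
Lemma pieces_close r k : (k <= r.+1)%N -> exists2 C : R, 0 < C & forall f (c nu : R) P Q e (C1 : R),
  0 < nu -> 0 <= C1 -> cont_on (c - nu) (c + nu) f -> mod_le k f (c - nu) (c + nu) e ->
  (size P <= r.+1)%N -> (size Q <= r.+1)%N ->
  (forall x, c - nu <= x <= c -> `|f x - P.[x]| <= C1 * e) ->
  (forall x, c <= x <= c + nu -> `|f x - Q.[x]| <= C1 * e) ->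
  forall x, c - nu <= x <= c + nu -> `|Q.[x] - P.[x]| <= C * (1 + C1) * e.
Proof.
move=> kr; have [C C0 CP] := @whitney R k; have [G G0 GP] := @poly_growth R r.+1.
exists (2 * G * (C + 1)); first by rewrite !mulr_gt0// addr_gt0.
move=> f c nu P Q e C1 nu0 C10 fc fe sP sQ fP fQ x xc.
have cc : c - nu < c + nu by clear -nu0; lra.
have e0 := mod_le_ge0 cc fe.
have [p sp pP] := CP f _ _ e cc fc fe.
have sd (S : {poly R}) : (size S <= r.+1)%N -> (size (S - p)%R <= r.+1)%N.
  by move=> sS; rewrite (leq_trans (size_polyD _ _))// geq_max sS size_polyN (leq_trans sp).
have near (S : {poly R}) x1 x2 : (size S <= r.+1)%N -> x2 - x1 = nu -> c - nu <= x1 -> x2 <= c + nu -> x1 - nu <= x <= x2 + nu ->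
    (forall t, x1 <= t <= x2 -> `|f t - S.[t]| <= C1 * e) -> `|S.[x] - p.[x]| <= G * ((C + C1) * e).
  move=> sS x12 x1c x2c xx Sf.
  have := GP (S - p) x1 x2 ((C + C1) * e) (sd S sS) _ _ x _.
  rewrite x12 hornerD hornerN => H; apply: (H _ _ xx).1; first by clear -x12 nu0; lra.
  move=> t yx; have := Sf t yx; have := pP t (ltac:(clear -yx x1c x2c; lra)).
  rewrite hornerD hornerN mulrDl; set a1 := C * e; set a2 := C1 * e; clear; rewrite !ler_norml; lra.
have nP := near P (c - nu) c sP (ltac:(clear; lra)) (lexx _) (ltac:(clear -nu0; lra)) (ltac:(clear -xc nu0; lra)) fP.
have nQ := near Q c (c + nu) sQ (ltac:(clear; lra)) (ltac:(clear -nu0; lra)) (lexx _) (ltac:(clear -xc nu0; lra)) fQ.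
have h1 : `|Q.[x] - P.[x]| <= 2 * (G * ((C + C1) * e)).
  by move: nP nQ; set g := G * _; clear; rewrite !ler_norml; lra.
apply: (le_trans h1).
have -> : 2 * G * (C + 1) * (1 + C1) * e = 2 * (G * ((C + 1) * (1 + C1) * e)) by ring.
rewrite ler_pM2l// ler_pM2l// ler_wpM2r//.
have : 0 <= C * C1 by rewrite mulr_ge0// ltW.
by rewrite mulrDl mulrDr !mul1r mulr1; clear; lra.
Qed.

(** The smoothing of a piecewise polynomial approximation [F] of [f]: [E i] is the error
    allowed near the breakpoint [y i], and the density of the knots required does not depend
    on the quality [C1] of the approximation. *)
Lemma spline_from_pieces q r k : q = 1%N \/ q = 2%N -> (q <= r)%N -> (k <= r.+1)%N ->
  exists2 rho : R, 0 < rho & forall C1 : R, 0 <= C1 -> exists2 C : R, 0 < C &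
  forall (K : R -> Prop) N y mu E (F : nat -> {poly R}) f,
    (forall i, (i <= N)%N -> y i < y i.+1) ->
    (forall i, 0 <= mu i) -> (forall i, (i < N)%N -> 0 < mu i.+1) ->
    (forall i, (i <= N)%N -> y i + mu i <= y i.+1 - mu i.+1) ->
    (forall i, (i < N)%N -> dense_in K (y i.+1 - mu i.+1) (y i.+1 + mu i.+1) (rho * mu i.+1)) ->
    (forall i, (i <= N)%N -> (size (F i) <= r.+1)%N) ->
    (forall i x, (i <= N)%N -> y i <= x <= y i.+1 -> 0 <= (F i)^`(q).[x]) ->
    (forall i, (i < N)%N -> (F i).[y i.+1] = (F i.+1).[y i.+1]) ->
    (forall i, (i < N)%N -> q = 2%N -> (F i)^`().[y i.+1] <= (F i.+1)^`().[y i.+1]) ->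
    cont_on (y 0%N) (y N.+1) f ->
    (forall i, (i < N)%N -> mod_le k f (y i.+1 - mu i.+1) (y i.+1 + mu i.+1) (E i.+1)) ->
    (forall i x, (i < N)%N -> y i.+1 - mu i.+1 <= x <= y i.+1 -> `|f x - (F i).[x]| <= C1 * E i.+1) ->
    (forall i x, (i < N)%N -> y i.+1 <= x <= y i.+1 + mu i.+1 -> `|f x - (F i.+1).[x]| <= C1 * E i.+1) ->
    exists l, [/\ knots_in K (y 0%N) (y N.+1) l,
      forall x, y 0%N <= x <= y N.+1 -> 0 <= (F 0%N)^`(q).[x] + spl (r - q) l x &
      forall i x e, (i <= N)%N -> y i <= x <= y i.+1 -> 0 <= e -> `|f x - (F i).[x]| <= C1 * e ->
        ((0 < i)%N -> x <= y i + mu i -> E i <= e) ->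
        ((i < N)%N -> y i.+1 - mu i.+1 <= x -> E i.+1 <= e) ->
        `|f x - ((F 0%N).[x] + spl r l x)| <= C * e].
Proof.
move=> q12 qr kr; have [rho [A [rho0 A0 AP]]] := @assemble R q r q12 qr.
have [B B0 BP] := pieces_close kr.
exists rho => // C1 C10; have B10 : 0 < B * (1 + C1) by rewrite mulr_gt0// ltr_pwDl.
exists (A * (B * (1 + C1)) + C1); first by rewrite ltr_pwDl// mulr_gt0.
move=> K N y mu E F f Hy mu0 Hmu Hdis HK HsF HF HFy HFy' fc fE FE1 FE2.
have [|l [kl l0 lE]] := AP K N y mu (fun i => B * (1 + C1) * E i) F Hy mu0 Hmu Hdis HK HsF HF HFy HFy'.
- move=> i x iN xi; apply: BP (fE i iN) _ _ _ _ x xi => //.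
  + exact: Hmu.
  + apply: cont_on_sub fc.
      have := incr_seq_le (fun i iN => Hy i (ltnSE iN)) (leq0n i) (leqW (ltnW iN)).
      by have := Hdis i (ltnW iN); have := mu0 i; clear; lra.
    have := incr_seq_le (fun i iN => Hy i (ltnSE iN)) (_ : (i.+2 <= N.+1)%N) (leqnn _).
    by move=> /(_ iN); have := Hdis i.+1 iN; have := mu0 i.+2; clear; lra.
  + exact: HsF (ltnW _).
  + exact: HsF.
  + by move=> x'; apply: FE1.
  + by move=> x'; apply: FE2.
exists l; split=> // i x e iN xi e0 fF De1 De2.
have := lE i x (B * (1 + C1) * e) iN xi (mulr_ge0 (ltW B10) e0) _ _.
rewrite mulrDl; move=> H; have {}H : `|(F 0%N).[x] + spl r l x - (F i).[x]| <= A * (B * (1 + C1) * e).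
  by apply: H => h1 h2; rewrite ler_pM2l//; [exact: De1|exact: De2].
move: H fF; rewrite -!mulrA; set a1 := A * _; set a2 := C1 * e; clear; rewrite !ler_norml; lra.
Qed.

(** ** Density of the knots of a remesh *)

Lemma partition_cell m zt u v : is_partition m zt -> -1 <= u -> u < v -> v <= 1 ->
  (exists2 t, u < t < v & knot_of m zt t) \/ (exists i, [/\ (i < m)%N, zt i <= u & v <= zt i.+1]).
Proof.
move=> [z0 z1 zinc] u1 uv v1.
have ex : exists i, u < zt i by exists m; rewrite z1 (lt_le_trans uv).
have := ex_minnP ex; case: ex_minnP => i ui imin _.
have i0 : (0 < i)%N by case: i ui {imin} => //; rewrite z0 ltNge u1.
have im : (i <= m)%N by apply: imin; rewrite z1 (lt_le_trans uv).
have [iv|vi] := ltP (zt i) v.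
  left; exists (zt i); first by rewrite ui.
  exists i => //; rewrite i0 ltn_neqAle im andbT; apply/eqP => iE.
  by move: iv; rewrite iE z1 ltNge v1.
right; exists i.-1; rewrite prednK//; split=> //.
by rewrite leNgt; apply/negP => /imin; rewrite leqNgt prednK ?leqnn.
Qed.

Lemma is_remesh_cell delta n z m zt i j : is_partition n z -> 0 < delta -> is_remesh delta n z m zt ->
  (j < n)%N -> (i < m)%N -> `[zt i, zt i.+1] `&` `]z j, z j.+1[ !=set0 ->
  [/\ zt i.+1 - zt i <= delta * (z j.+1 - z j),
     (0 < j)%N -> zt i.+1 - zt i <= delta * (z j - z j.-1) &
     (j.+1 < n)%N -> zt i.+1 - zt i <= delta * (z j.+2 - z j.+1)].
Proof.
move=> zP d0 [_ H] jn im ne; have {ne} := H j jn i im ne.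
set lmin := Order.min _ _ => Hl.
have knotE k : (k <= n)%N -> knot n z k%:Z = z k by move=> kn; rewrite /knot (minn_idPr kn).
have eJE k : (k < n)%N -> eJ_len n z k%:Z = (z k.+1 - z k)%:E.
  move=> kn; rewrite /eJ_len (_ : k%:Z + 1 = k.+1%:Z); last by rewrite -PoszD addn1.
  by rewrite /eknot /= !ltz_nat (ltnNge n k.+1) kn (ltnNge n k) (ltnW kn) /= !knotE// ltnW.
have le k : (k < n)%N -> (lmin <= eJ_len n z k%:Z)%E -> zt i.+1 - zt i <= delta * (z k.+1 - z k).
  move=> kn; rewrite (eJE k kn) => lk; rewrite -lee_fin (le_trans Hl)// EFinM.
  by apply: lee_wpmul2l => //; rewrite lee_fin ltW.
split.
- by apply: le => //; rewrite /lmin !ge_min lexx !orbT.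
- move=> j0; have jE : j%:Z - 1 = j.-1%:Z by rewrite -[in LHS](prednK j0) intS addrC addKr.
  have := le j.-1; rewrite prednK//; apply; first exact: ltnW.
  by rewrite /lmin ge_min; apply/orP; left; rewrite jE.
- move=> jn'; apply: le => //; rewrite /lmin !ge_min; apply/orP; right; apply/orP; right.
  by rewrite intS addrC.
Qed.

Lemma remesh_knot delta n z m zt j u v : is_partition n z -> 0 < delta -> is_remesh delta n z m zt ->
  (j < n)%N -> -1 <= u -> u < v -> v <= 1 -> z j < v -> u < z j.+1 ->
  [\/ delta * (z j.+1 - z j) < v - u,
      (0 < j)%N /\ delta * (z j - z j.-1) < v - u |
      (j.+1 < n)%N /\ delta * (z j.+2 - z j.+1) < v - u] ->
  exists2 t, u < t < v & knot_of m zt t.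
Proof.
move=> zP d0 zr jn u1 uv v1 jv uj H; have [zt1 _] := zr.
have [//|[i [im iu vi]]] := partition_cell zt1 u1 uv v1.
have zj : z j < z j.+1 by have [_ _] := zP; apply.
pose t := (Num.max u (z j) + Num.min v (z j.+1)) / 2.
have lt : Num.max u (z j) < Num.min v (z j.+1) by rewrite gt_max !lt_min uv uj jv zj.
have [|h1 h2 h3] := is_remesh_cell zP d0 zr jn im.
  exists t; have := lt; have : u <= Num.max u (z j) by rewrite le_max lexx.
  have : z j <= Num.max u (z j) by rewrite le_max lexx orbT.
  have : Num.min v (z j.+1) <= v by rewrite ge_min lexx.
  have : Num.min v (z j.+1) <= z j.+1 by rewrite ge_min lexx orbT.
  rewrite /= !in_itv /= /t; move: (Num.max _ _) (Num.min _ _) => M M' a1 a2 a3 a4 a5.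
  by split; clear -a1 a2 a3 a4 a5 iu vi; lra.
exfalso; case: H => [|[j0]|[jn']].
- by clear -h1 iu vi; lra.
- by have {}h2 := h2 j0; clear -h2 iu vi; lra.
- by have {}h3 := h3 jn'; clear -h3 iu vi; lra.
Qed.

End Pieces.

Section Coarse.
Context {R : realType}.
Implicit Types (p P Q : {poly R}) (f : R -> R) (z zt y mu e : nat -> R) (a b x u v t : R) (i j k m n q r N : nat).

Lemma partition_lt n z i j : is_partition n z -> (i < j)%N -> (j <= n)%N -> z i < z j.
Proof.
move=> [_ _ zinc] ij jn; apply: (lt_le_trans (zinc i (leq_trans ij jn))).
exact: (incr_seq_le zinc).
Qed.

Lemma partition_le n z i j : is_partition n z -> (i <= j)%N -> (j <= n)%N -> z i <= z j.
Proof. by move=> [_ _ zinc] ij jn; exact: (incr_seq_le zinc). Qed.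

Lemma partition_m11 n z i : is_partition n z -> (i <= n)%N -> -1 <= z i <= 1.
Proof.
move=> zP i_n; have [z0 z1 _] := zP.
by rewrite -{1}z0 -z1 !(partition_le zP).
Qed.

Lemma partition_gt0 n z : is_partition n z -> (0 < n)%N.
Proof. by case: n => // -[z0 z1 _]; exfalso; move: z1; rewrite z0; lra. Qed.

Lemma neighbours_lt n z j : is_partition n z -> (j <= n)%N -> z j.-1 < z (minn n j.+1).
Proof.
move=> zP jn; have n0 := partition_gt0 zP.
apply: (partition_lt zP); last exact: geq_minl.
by rewrite leq_min; case: j jn => [|j] jn /=; [rewrite n0|rewrite jn ltnS leqnSn].
Qed.

(** The bounds required of the spline near each point of the partition, in the absence of
    norms and moduli: [e j] is the error allowed on the half cells around [z j]. *)
Definition locally_close (n : nat) z e (f s : R -> R) := forall j x, (j <= n)%N ->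
  (z j.-1 + z j) / 2 <= x <= (z j + z (minn n j.+1)) / 2 -> `|f x - s x| <= e j.

(** The pieces live on the cells of the given partition, and the corner at each inner point is
    smoothed within a quarter of the shorter one of the two adjacent cells, where the remesh
    has enough knots. *)
Lemma fine_from_coarse q r k : q = 1%N \/ q = 2%N -> (q <= r)%N -> (k <= r.+1)%N ->
  exists2 rho : R, 0 < rho & forall C1 : R, 0 <= C1 -> exists2 C : R, 0 < C &
  forall (delta : R) n z m zt e (F : nat -> {poly R}) f,
    is_partition n z -> 0 < delta -> delta <= rho -> is_remesh delta n z m zt ->
    (forall i, (i < n)%N -> (size (F i) <= r.+1)%N) ->
    (forall i x, (i < n)%N -> z i <= x <= z i.+1 -> 0 <= (F i)^`(q).[x]) ->
    (forall i, (i.+1 < n)%N -> (F i).[z i.+1] = (F i.+1).[z i.+1]) ->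
    (forall i, (i.+1 < n)%N -> q = 2%N -> (F i)^`().[z i.+1] <= (F i.+1)^`().[z i.+1]) ->
    cont_on (-1) 1 f ->
    (forall j, (j <= n)%N -> mod_le k f (z j.-1) (z (minn n j.+1)) (e j)) ->
    (forall i j x, (i < n)%N -> j = i \/ j = i.+1 -> z i <= x <= z i.+1 -> `|f x - (F i).[x]| <= C1 * e j) ->
    exists p l, [/\ (size p <= r.+1)%N, forall c, c \in l -> knot_of m zt c.2,
      forall x, -1 <= x <= 1 -> 0 <= p^`(q).[x] + spl (r - q) l x &
      locally_close n z (fun j => C * e j) f (fun x => p.[x] + spl r l x)].
Proof.
move=> q12 qr kr; have [rho rho0 H] := @spline_from_pieces R q r k q12 qr kr.
exists (rho / 8); first by rewrite divr_gt0.
move=> C1 C10; have [C C0 CP] := H C1 C10; exists C => //.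
move=> delta n z m zt e F f zP d0 dr zr sF F0 Fz Fz' fc fe fF.
have [N nE] : exists N, n = N.+1 by exists n.-1; rewrite prednK// (partition_gt0 zP).
have [z0 z1 zinc] := zP; have [ztP _] := zr.
pose mu i := if (0 < i < n)%N then Num.min (z i - z i.-1) (z i.+1 - z i) / 4 else 0.
have muE i : (0 < i < n)%N -> [/\ 0 < mu i, 4 * mu i <= z i - z i.-1, 4 * mu i <= z i.+1 - z i &
    mu i = (z i - z i.-1) / 4 \/ mu i = (z i.+1 - z i) / 4].
  move=> /[dup] i0n /andP[i0 i_n]; rewrite /mu i0n.
  have h1 : z i.-1 < z i by apply: (partition_lt zP); rewrite ?prednK// ltnW.
  have h2 := zinc i i_n; split.
  - by rewrite divr_gt0// lt_min !subr_gt0 h1.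
  - by rewrite mulrC divfK// ge_min lexx.
  - by rewrite mulrC divfK// ge_min lexx orbT.
  - by case: (leP (z i - z i.-1)) => _; [left|right].
have mu0 i : 0 <= mu i.
  have [/muE[/ltW]//|h] := boolP (0 < i < n)%N.
  by rewrite /mu (negPf h).
have mu4 i : (i < n)%N -> 4 * mu i <= z i.+1 - z i /\ 4 * mu i.+1 <= z i.+1 - z i.
  move=> i_n; have zi : 0 <= z i.+1 - z i by rewrite subr_ge0 ltW// zinc.
  split.
    have [/muE[]//|h] := boolP (0 < i < n)%N.
    by rewrite /mu (negPf h) mulr0.
  have [/muE[]//|h] := boolP (0 < i.+1 < n)%N.
  by rewrite /mu (negPf h) mulr0.
have iN i : (i < N)%N -> (0 < i.+1 < n)%N by rewrite nE ltnS.
have iN1 i : (i < N)%N -> (i < n)%N by move=> h; rewrite nE ltnW// ltnS.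
have iN2 i : (i <= N)%N -> (i < n)%N by rewrite nE ltnS.
have e0 j : (j <= n)%N -> 0 <= e j.
  by move=> jn; apply: mod_le_ge0 (fe j jn); exact: neighbours_lt.
have mnE i : (i < n)%N -> minn n i.+1 = i.+1 by move=> ?; apply/minn_idPr.
have [|||||||||||||l [kl l0 lE]] := CP (knot_of m zt) N z mu e F f.
- by move=> i /iN2; apply: zinc.
- exact: mu0.
- by move=> i /iN/muE[].
- move=> i /iN2 i_n; have [a1 a2] := mu4 i i_n; have a3 := zinc i i_n.
  by clear -a1 a2 a3; lra.
- move=> i i_N u v u1 uv v1 uvr; have [a0 a1 a2 a3] := muE i.+1 (iN i i_N).
  have lt1 := zinc i (iN1 i i_N); have lt2 : z i.+1 < z i.+2 by apply: zinc; rewrite nE.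
  have /andP[b1 _] := partition_m11 zP (ltnW (iN1 i i_N)).
  have /andP[_ b2] := @partition_m11 n z i.+2 zP (ltac:(by rewrite nE)).
  have um1 : -1 <= u by clear -u1 b1 a1 a0 lt1; simpl in *; lra.
  have vm1 : v <= 1 by clear -v1 b2 a2 a0 lt2; simpl in *; lra.
  have small w : mu i.+1 = w / 4 -> delta * w < v - u.
    move=> mE; have w0 : 0 < w by clear -mE a0; lra.
    apply: lt_le_trans uvr; rewrite mE (le_lt_trans (ler_wpM2r (ltW w0) dr))//.
    by rewrite -mulrA ltr_pM2l//; clear -w0; lra.
  have [vz|zv] := leP v (z i.+1).
    apply: (remesh_knot zP d0 zr (j := i)) => //.
    + exact: iN1.
    + by clear -u1 a1 a0 uv lt1; simpl in *; lra.
    + by clear -uv vz; lra.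
    + case: a3 => /small s; first by constructor 1.
      by constructor 3; split=> //; rewrite nE.
  apply: (remesh_knot zP d0 zr (j := i.+1)) => //.
  + by rewrite nE.
  + by clear -v1 a2 a0 uv lt2; simpl in *; lra.
  + by case: a3 => /small s; [constructor 2|constructor 1].
- by move=> i /iN2; apply: sF.
- by move=> i x /iN2; apply: F0.
- by move=> i i_N; apply: Fz; rewrite nE.
- by move=> i i_N; apply: Fz'; rewrite nE.
- by rewrite z0 -nE z1.
- move=> i i_N; have [a0 a1 a2 _] := muE i.+1 (iN i i_N).
  have := fe i.+1 (iN1 i i_N); rewrite /= mnE ?nE//; apply: mod_le_sub.
    by clear -a0 a1; simpl in *; lra.
  by clear -a0 a2; lra.
- move=> i x i_N xi; have [a0 a1 a2 _] := muE i.+1 (iN i i_N).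
  by apply: fF; [exact: iN1|right|clear -xi a0 a1; simpl in *; lra].
- move=> i x i_N xi; have [a0 a1 a2 _] := muE i.+1 (iN i i_N).
  by apply: fF; [rewrite nE|left|clear -xi a0 a2; simpl in *; lra].
exists (F 0%N), l; split.
- by apply: sF; rewrite nE.
- by move=> c /kl[].
- by move=> x x1; apply: l0; rewrite z0 -nE z1.
- move=> j x jn /andP[xl xr]; have ej := e0 j jn.
  have [xz|zx] := leP x (z j).
    case: j jn xl xr ej xz => [|j] jn xl xr ej xz.
      have xE : x = z 0%N by apply/le_anti; rewrite xz /=; clear -xl; simpl in *; lra.
      apply: (lE 0%N) => //.
      + by rewrite xE lexx ltW// zinc// nE.
      + by apply: fF; [rewrite nE|left|rewrite xE lexx ltW// zinc// nE].
      + move=> N0; have [a1 a2] := mu4 0%N (iN1 0%N N0); have a3 := zinc 0%N (iN1 0%N N0).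
        by rewrite xE; clear -a2 a3; lra.
    have jn' : (j <= N)%N by rewrite -ltnS -nE.
    have zj := zinc j jn; have [a1 a2] := mu4 j jn; simpl in xl.
    apply: (lE j) => //.
    + by rewrite xz andbT; clear -xl zj; lra.
    + by apply: fF => //; [right|rewrite xz andbT; clear -xl zj; lra].
    + by clear -a1 xl zj; lra.
  have jn' : (j < n)%N.
    rewrite ltn_neqAle jn andbT; apply/eqP => jE; move: xr zx.
    by rewrite jE (minn_idPl (leqnSn n)); clear; lra.
  rewrite mnE// in xr; have zj := zinc j jn'; have [a1 a2] := mu4 j jn'.
  apply: (lE j) => //.
  + by rewrite -ltnS -nE.
  + by rewrite ltW//=; clear -xr zj; lra.
  + by apply: fF => //; [left|rewrite ltW//=; clear -xr zj; lra].
  + by clear -a2 xr zj; lra.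
Qed.

End Coarse.

(** * Shape preserving approximation on one interval *)
Section LocalPieces.
Context {R : realType}.
Implicit Types (p P Q F : {poly R}) (f g : R -> R) (a b c e h s t u v w x y : R) (i j k n r : nat).

Lemma affine_le p a b x M : (size p <= 2)%N -> a <= x <= b -> `|p.[a]| <= M -> `|p.[b]| <= M -> `|p.[x]| <= M.
Proof.
move=> sp /andP[ax xb]; rewrite !(horner_coef_wide _ sp) !big_ord_recl !big_ord0 /= !addr0 !expr0 !mulr1 !expr1.
have [c0|c0] := lerP 0 p`_1.
  have h1 := ler_wpM2l c0 ax; have h2 := ler_wpM2l c0 xb.
  by rewrite !ler_norml; clear -h1 h2; lra.
have h1 := ler_wnM2l (ltW c0) ax; have h2 := ler_wnM2l (ltW c0) xb.
by rewrite !ler_norml; clear -h1 h2; lra.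
Qed.

Definition chord f a b : {poly R} := (f a)%:P + ((f b - f a) / (b - a)) *: ('X - a%:P).

Lemma chordE f a b x : (chord f a b).[x] = f a + (f b - f a) / (b - a) * (x - a).
Proof. by rewrite /chord hornerD hornerC hornerZ hornerXsubC. Qed.

Lemma chord_left f a b : (chord f a b).[a] = f a.
Proof. by rewrite chordE subrr mulr0 addr0. Qed.

Lemma chord_right f a b : a < b -> (chord f a b).[b] = f b.
Proof. by move=> ab; rewrite chordE divfK ?subr_eq0 ?gt_eqF// addrC subrK. Qed.

Lemma size_chord f a b : (size (chord f a b) <= 2)%N.
Proof.
rewrite /chord (leq_trans (size_polyD _ _))// geq_max (leq_trans (size_polyC_leq1 _))//=.
by rewrite (leq_trans (size_scale_leq _ _))// size_XsubC.
Qed.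

Lemma deriv_chord f a b : (chord f a b)^`() = ((f b - f a) / (b - a))%:P.
Proof. by rewrite /chord derivD derivC add0r derivZ derivXsubC alg_polyC. Qed.

Lemma hornerB p1 p2 x : (p1 - p2).[x] = p1.[x] - p2.[x].
Proof. by rewrite hornerD hornerN. Qed.

Lemma linear_piece : exists2 C : R, 0 < C & forall f a b e, a < b -> cont_on a b f ->
  mod_le 2 f a b e -> forall x, a <= x <= b -> `|f x - (chord f a b).[x]| <= C * e.
Proof.
have [C C0 CP] := @whitney R 2; exists (2 * C); first by rewrite mulr_gt0.
move=> f a b e ab fc fe x xab; have [p sp pP] := CP f a b e ab fc fe.
have := @affine_le (chord f a b - p) a b x (C * e) _ xab.
rewrite !hornerB chord_left chord_right// => H.
have sg : (size (chord f a b - p)%R <= 2)%N.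
  by rewrite (leq_trans (size_polyD _ _))// geq_max size_chord size_polyN.
have {}H := H sg (pP a (ltac:(rewrite lexx ltW//))) (pP b (ltac:(rewrite lexx ltW//))).
have := pP x xab; rewrite -[2 * C * e]mulrA; move: (C * e) H => X; clear; rewrite !ler_norml; lra.
Qed.

Definition antiderivative p : {poly R} := \poly_(i < (size p).+1) (p`_i.-1 / i%:R).

Lemma deriv_antiderivative p : (antiderivative p)^`() = p.
Proof.
apply/polyP => i; rewrite coef_deriv coef_poly ltnS /=; case: ltnP => ip; last by rewrite mul0rn nth_default.
by rewrite -[LHS]mulr_natr divfK// pnatr_eq0.
Qed.

Lemma size_antiderivative p n : (size p <= n)%N -> (size (antiderivative p) <= n.+1)%N.
Proof. by move=> sp; apply: leq_trans (size_poly _ _) _; rewrite ltnS. Qed.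

Lemma diff_on_nondecr a b g g' : a <= b -> diff_on a b g g' ->
  (forall x, a < x < b -> 0 <= g' x) -> g a <= g b.
Proof.
rewrite le_eqVlt => /orP[/eqP->//|ab] gd g0; have [c cab ce] := mean_value ab gd.
by rewrite -subr_ge0 ce mulr_ge0 ?g0// subr_ge0 ltW.
Qed.

(** Whitney's polynomial, raised by its error. *)
Lemma whitney_above k : (0 < k)%N -> exists2 C : R, 0 < C & forall g a b w, a < b -> cont_on a b g ->
  mod_le k g a b w -> exists2 p : {poly R}, (size p <= k)%N &
    forall x, a <= x <= b -> 0 <= p.[x] - g x <= C * w.
Proof.
move=> k0; have [C C0 CP] := @whitney R k; exists (2 * C); first by rewrite mulr_gt0.
move=> g a b w ab gc gw; have [p sp pP] := CP g a b w ab gc gw.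
exists (p + (C * w)%:P).
  by rewrite (leq_trans (size_polyD _ _))// geq_max sp (leq_trans (size_polyC_leq1 _)).
move=> x xab; have := pP x xab; rewrite hornerD hornerC -[2 * C * w]mulrA ler_norml.
by move: (C * w) => X; clear; lra.
Qed.

(** A monotone polynomial through the end points of the graph. The integral of a one-sided
    approximation of the derivative rises too much, and is scaled down. *)
Lemma monotone_piece k : (0 < k)%N -> exists2 C : R, 0 < C & forall f f' a b w, a < b ->
  diff_on a b f f' -> cont_on a b f' -> (forall x, a <= x <= b -> 0 <= f' x) -> mod_le k f' a b w ->
  exists F, [/\ (size F <= k.+1)%N, forall x, a <= x <= b -> 0 <= F^`().[x],
    F.[a] = f a, F.[b] = f b & forall x, a <= x <= b -> `|f x - F.[x]| <= C * ((b - a) * w)].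
Proof.
move=> k0; have [C C0 CP] := whitney_above k0; exists (2 * C); first by rewrite mulr_gt0.
move=> f f' a b w ab fd fc' f'0 fw; have [p sp pP] := CP f' a b w ab fc' fw.
have w0 := mod_le_ge0 ab fw; have Cw0 : 0 <= C * w by rewrite mulr_ge0// ltW.
pose F0 := antiderivative p - (antiderivative p).[a]%:P.
have F0' : F0^`() = p by rewrite derivB derivC subr0 deriv_antiderivative.
have F0a : F0.[a] = 0 by rewrite hornerB hornerC subrr.
have sF0 : (size F0 <= k.+1)%N.
  rewrite (leq_trans (size_polyD _ _))// geq_max size_antiderivative// size_polyN.
  by rewrite (leq_trans (size_polyC_leq1 _)).
clearbody F0.
have F0d u v : diff_on u v (horner F0) (horner p) by rewrite -F0'; exact: diff_on_poly.
have p0 x : a <= x <= b -> 0 <= p.[x].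
  by move=> xab; have := pP x xab; have := f'0 x xab; clear; lra.
have F0mono u v : a <= u -> u <= v -> v <= b -> F0.[u] <= F0.[v].
  move=> au uv vb; apply: diff_on_nondecr uv (F0d u v) _ => x xuv.
  by apply: p0; clear -xuv au vb; lra.
have fmono u v : a <= u -> u <= v -> v <= b -> f u <= f v.
  move=> au uv vb; apply: (diff_on_nondecr uv (diff_on_sub au vb fd)) => x xuv.
  by apply: f'0; clear -xuv au vb; lra.
have near x : a <= x <= b -> 0 <= F0.[x] - (f x - f a) <= C * w * (b - a).
  move=> /andP[ax xb].
  have /andP[] := @diff_on_incr_le R a x (fun t => F0.[t] - f t) (fun t => p.[t] - f' t) 0 (C * w) ax
    (diff_onB (F0d a x) (diff_on_sub (lexx a) xb fd)) (fun t tax => pP t (ltac:(clear -tax xb; lra))).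
  rewrite F0a mul0r => h1 h2.
  have : C * w * (x - a) <= C * w * (b - a) by rewrite ler_wpM2l// lerD2r.
  by clear -h1 h2; lra.
pose X := F0.[b]; pose Y := f b - f a; pose m := Y / X.
have bab : a <= b <= b by rewrite lexx ltW.
have YX : 0 <= X - Y <= C * w * (b - a) := near b bab.
have Y0 : 0 <= Y by rewrite subr_ge0 fmono ?lexx ?ltW.
have mX : m * X = Y.
  rewrite /m; have [X0|X0] := eqVneq X 0; last by rewrite divfK.
  by rewrite X0 mulr0; clear -YX X0 Y0; lra.
have m0 : 0 <= m by rewrite divr_ge0//; clear -YX Y0; lra.
have m1 : m <= 1.
  rewrite /m; have [X0|X0] := eqVneq X 0; first by rewrite X0 invr0 mulr0 ler01.
  rewrite ler_pdivrMr; first by clear -YX; lra.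
  by rewrite lt_neqAle eq_sym X0; clear -YX Y0; lra.
exists ((f a)%:P + m *: F0); split.
- rewrite (leq_trans (size_polyD _ _))// geq_max (leq_trans (size_polyC_leq1 _))//=.
  by rewrite (leq_trans (size_scale_leq _ _)).
- by move=> x xab; rewrite derivD derivC add0r derivZ F0' hornerZ mulr_ge0// p0.
- by rewrite hornerD hornerC hornerZ F0a mulr0 addr0.
- by rewrite hornerD hornerC hornerZ -/X mX addrC subrK.
- move=> x xab; rewrite hornerD hornerC hornerZ; have h1 := near x xab.
  have /andP[ax xb] := xab.
  have F0x0 : 0 <= F0.[x] by rewrite -F0a F0mono.
  have F0xX : F0.[x] <= X by rewrite F0mono.
  have h2 : (1 - m) * F0.[x] <= (1 - m) * X by rewrite ler_wpM2l// subr_ge0.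
  have h3 : 0 <= (1 - m) * F0.[x] by rewrite mulr_ge0// subr_ge0.
  have -> : 2 * C * ((b - a) * w) = 2 * (C * w * (b - a)) by ring.
  rewrite ler_norml; move: (C * w * (b - a)) h1 YX => Z h1 YX.
  by clear -h1 h2 h3 YX mX; lra.
Qed.

(** The derivative increases, and it vanishes somewhere inside by Rolle's theorem; so the
    function lies below 0 and above its tangents at the ends. *)
Lemma convex_sag a b g g' g'' M : a < b -> diff_on a b g g' -> diff_on a b g' g'' ->
  (forall x, a <= x <= b -> 0 <= g'' x <= M) -> g a = 0 -> g b = 0 ->
  [/\ g' a <= 0, 0 <= g' b, g' b - g' a <= M * (b - a) &
     forall x, a <= x <= b -> [/\ g x <= 0, g' a * (x - a) <= g x & g' b * (x - b) <= g x]].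
Proof.
move=> ab gd gd' gM ga gb.
have g'mono u v : a <= u -> u <= v -> v <= b -> g' u <= g' v.
  move=> au uv vb; apply: (diff_on_nondecr uv (diff_on_sub au vb gd')) => x xuv.
  by have /andP[] := gM x (ltac:(clear -xuv au vb; lra)).
have [c /andP[ac cb] ce] := mean_value ab gd.
have c0 : g' c = 0.
  move: ce; rewrite ga gb subrr => /esym/eqP; rewrite mulf_eq0 subr_eq0 (gt_eqF ab) orbF.
  by move/eqP.
split.
- by rewrite -c0 g'mono// ltW.
- by rewrite -c0 g'mono// ltW.
- by have /andP[] := @diff_on_incr_le R a b g' g'' 0 M (ltW ab) gd' (fun x xab => gM x (ltac:(clear -xab; lra))).
move=> x /andP[ax xb]; have h1 : g' a * (x - a) <= g x.
  have : g a - g' a * a <= g x - g' a * x; last by rewrite ga; clear; lra.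
  have dl : diff_on a x (fun t => g t - g' a * t) (fun t => g' t - g' a).
    apply: diff_onB (diff_on_sub (lexx a) xb gd) _.
    have := diff_on_poly a x (g' a *: 'X); rewrite derivZ derivX => -[dc dd]; split.
      by apply: cont_on_eq dc => t _; rewrite hornerZ hornerX.
    move=> t tx; have := dd t tx; rewrite hornerZ hornerC mulr1.
    by congr is_derive; apply/funext => t'; rewrite hornerZ hornerX.
  apply: (diff_on_nondecr ax dl) => t /andP[at' tx]; rewrite subr_ge0 g'mono// ?ltW//.
  exact: lt_le_trans xb.
have h2 : g' b * (x - b) <= g x.
  have : g' b * x - g x <= g' b * b - g b; last by rewrite gb; clear; lra.
  have dl : diff_on x b (fun t => g' b * t - g t) (fun t => g' b - g' t).
    apply: diff_onB _ (diff_on_sub ax (lexx b) gd).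
    have := diff_on_poly x b (g' b *: 'X); rewrite derivZ derivX => -[dc dd]; split.
      by apply: cont_on_eq dc => t _; rewrite hornerZ hornerX.
    move=> t tx; have := dd t tx; rewrite hornerZ hornerC mulr1.
    by congr is_derive; apply/funext => t'; rewrite hornerZ hornerX.
  apply: (diff_on_nondecr xb dl) => t /andP[xt tb]; rewrite subr_ge0 g'mono// ?ltW//.
  exact: le_lt_trans xt.
split=> //.
have [xc|cx] := leP x c.
  rewrite -oppr_ge0 -[g x]opprK; have dn : diff_on a x (fun t => (0 : {poly R}).[t] - g t) (fun t => (0 : {poly R})^`().[t] - g' t).
    by apply: diff_onB; [exact: diff_on_poly|exact: diff_on_sub (lexx a) xb gd].
  have := diff_on_nondecr ax dn; rewrite !horner0 ga !sub0r oppr0 opprK; apply=> t /andP[at' tx].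
  rewrite deriv0 horner0 sub0r oppr_ge0 -c0 g'mono// ?ltW//; exact: lt_le_trans xc.
have := diff_on_nondecr xb (diff_on_sub ax (lexx b) gd); rewrite gb; apply=> t /andP[xt tb].
rewrite -c0 g'mono// ?ltW//; exact: lt_trans xt.
Qed.

End LocalPieces.

Section LocalPieces2.
Context {R : realType}.
Implicit Types (p P Q F : {poly R}) (f g : R -> R) (a b c e h s t u v w x y : R) (i j k n r : nat).

(** A convex polynomial through the end points of the graph, whose slopes there leave room for
    the slopes of [f].  It is the chord plus a multiple [m H] of a function vanishing at the
    end points; [m] is the largest factor, at most 1, allowed by the two slopes. *)
Lemma convex_piece k : (0 < k)%N -> exists2 C : R, 0 < C & forall f f' f'' a b w, a < b ->
  diff_on a b f f' -> diff_on a b f' f'' -> cont_on a b f'' ->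
  (forall x, a <= x <= b -> 0 <= f'' x) -> mod_le k f'' a b w ->
  exists F, [/\ (size F <= k.+2)%N, forall x, a <= x <= b -> 0 <= F^`(2).[x],
    F.[a] = f a /\ F.[b] = f b, f' a <= F^`().[a] /\ F^`().[b] <= f' b &
    forall x, a <= x <= b -> `|f x - F.[x]| <= C * ((b - a) ^+ 2 * w)].
Proof.
move=> k0; have [C C0 CP] := @whitney_above R k k0; exists (2 * C); first by rewrite mulr_gt0.
move=> f f' f'' a b w ab fd fd' fc f0 fw; have [p sp pP] := CP f'' a b w ab fc fw.
have w0 := mod_le_ge0 ab fw; have Cw0 : 0 <= C * w by rewrite mulr_ge0// ltW.
pose l := chord f a b; pose S := (f b - f a) / (b - a).
have l' : l^`() = S%:P by rewrite deriv_chord.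
have la : l.[a] = f a := chord_left f a b.
have lb : l.[b] = f b := chord_right f ab.
have sl : (size l <= 2)%N := size_chord f a b.
clearbody l S.
pose H1 := antiderivative (antiderivative p); pose h1 := chord (horner H1) a b.
pose H := H1 - h1.
have h1' : h1^`()^`() = 0 by rewrite deriv_chord derivC.
have H'' : H^`()^`() = p by rewrite !derivB h1' subr0 !deriv_antiderivative.
have Ha : H.[a] = 0 by rewrite hornerB chord_left subrr.
have Hb : H.[b] = 0 by rewrite hornerB chord_right// subrr.
have sH : (size H <= k.+2)%N.
  rewrite (leq_trans (size_polyD _ _))// geq_max size_polyN; apply/andP; split.
    by do 2!apply: size_antiderivative.
  by apply: leq_trans (size_chord _ _ _) _.
clearbody H; clear h1 h1' H1.
have p0 x : a <= x <= b -> 0 <= p.[x].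
  by move=> xab; have := pP x xab; have := f0 x xab; clear; lra.
have Hd : diff_on a b (horner H) (horner H^`()) := diff_on_poly _ _ _.
have Hd' : diff_on a b (horner H^`()) (horner p) by rewrite -H''; exact: diff_on_poly.
have [c cab cM] := cont_on_bounded (ltW ab) (@cont_on_poly R a b p).
have [HA HB _ HS] := @convex_sag R a b _ _ _ `|p.[c]| ab Hd Hd'
  (fun x xab => ltac:(rewrite p0//= (le_trans (ler_norm _))// cM//)) Ha Hb.
pose u x := f x - l.[x]; pose u' x := f' x - l^`().[x]; pose u'' x := f'' x - l^`()^`().[x].
have ud : diff_on a b u u' := diff_onB fd (diff_on_poly _ _ _).
have ud' : diff_on a b u' u'' := diff_onB fd' (diff_on_poly _ _ _).
have u''E x : u'' x = f'' x by rewrite /u'' l' derivC horner0 subr0.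
have u'E x : u' x = f' x - S by rewrite /u' l' hornerC.
have [c' cab' cM'] := cont_on_bounded (ltW ab) fc.
have [uA uB _ _] := @convex_sag R a b _ _ _ `|f'' c'| ab ud ud'
  (fun x xab => ltac:(rewrite u''E f0//= (le_trans (ler_norm _))// cM'//))
  (ltac:(by rewrite /u la subrr)) (ltac:(by rewrite /u lb subrr)).
have vH x : a <= x <= b -> 0 <= p.[x] - u'' x <= C * w by rewrite u''E; exact: pP.
have [vA vB vM vS] := convex_sag ab (diff_onB Hd ud) (diff_onB Hd' ud') vH
  (ltac:(by rewrite /u la subrr subr0 Ha)) (ltac:(by rewrite /u lb subrr subr0 Hb)).
rewrite !u'E in uA uB vA vB vM vS.
set A := H^`().[a] in HA HS vA vM vS; set B := H^`().[b] in HB HS vB vM vS.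
pose al := S - f' a; pose be := f' b - S.
have fracP x y : 0 <= x -> x <= y -> [/\ 0 <= x / y, x / y <= 1 & x / y * y = x].
  move=> x0 xy; have [y0|y0] := eqVneq y 0.
    by rewrite y0 invr0 !mulr0; split=> //; clear -x0 xy y0; lra.
  have yp : 0 < y by rewrite lt_neqAle eq_sym y0 (le_trans x0).
  by rewrite divr_ge0 ?(ltW yp)// ler_pdivrMr// mul1r divfK.
have [a0 a1 aE] := fracP al (- A) (ltac:(rewrite /al; clear -uA; lra)) (ltac:(rewrite /al; clear -vA; lra)).
have [b0 b1 bE] := fracP be B (ltac:(rewrite /be; clear -uB; lra)) (ltac:(rewrite /be; clear -vB; lra)).
pose m := Num.min (al / - A) (be / B).
have m0 : 0 <= m by rewrite le_min a0.
have ma : m <= al / - A by rewrite ge_min lexx.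
have mb : m <= be / B by rewrite ge_min lexx orbT.
have m12 : m = al / - A \/ m = be / B by rewrite /m; case: leP; [left|right].
clearbody m; have m1 : m <= 1 := le_trans ma a1.
have mA : m * - A <= al by rewrite -aE ler_wpM2r// oppr_ge0.
have mB : m * B <= be by rewrite -bE ler_wpM2r.
exists (l + m *: H); split.
- rewrite (leq_trans (size_polyD _ _))// geq_max (leq_trans sl)//=.
  by rewrite (leq_trans (size_scale_leq _ _)).
- move=> x xab; rewrite derivnS derivn1 derivD derivZ derivD derivZ l' derivC add0r H'' hornerZ.
  by rewrite mulr_ge0// p0.
- by rewrite !hornerD !hornerZ Ha Hb mulr0 !addr0.
- rewrite !derivD !derivZ !hornerD !hornerZ l' !hornerC -/A -/B.
  by split; [move: mA; rewrite /al; clear; lra|move: mB; rewrite /be; clear; lra].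
- move=> x xab; rewrite hornerD hornerZ; have [Hx HxA HxB] := HS x xab.
  have [v0 vxA vxB] := vS x xab; have /andP[ax xb] := xab.
  pose Z := C * w * (b - a); have Z0 : 0 <= Z by rewrite mulr_ge0// subr_ge0 ltW.
  have vMZ : B - be - (A + al) <= Z by rewrite /be /al; move: vM; rewrite /Z; clear; lra.
  have -> : 2 * C * ((b - a) ^+ 2 * w) = 2 * (Z * (b - a)) by rewrite /Z; ring.
  have xa0 : 0 <= x - a by rewrite subr_ge0.
  have bx0 : 0 <= b - x by rewrite subr_ge0.
  have Zx : Z * (x - a) <= Z * (b - a) by rewrite ler_wpM2l// lerD2r.
  have Zb : Z * (b - x) <= Z * (b - a) by rewrite ler_wpM2l// lerD2l lerN2.
  have vZ : - (Z * (b - a)) <= H.[x] - u x.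
    apply: le_trans vxA; rewrite lerNl -mulNr; apply: le_trans Zx; rewrite ler_wpM2r//.
    by move: vMZ vA vB; rewrite /al /be; clear; lra.
  have m10 : 0 <= 1 - m by rewrite subr_ge0.
  have mH : (1 - m) * - H.[x] <= Z * (b - a).
    case: m12 => mE.
      apply: le_trans Zx; apply: (@le_trans _ _ ((1 - m) * (- A * (x - a)))).
        by rewrite ler_wpM2l// mulNr lerN2.
      rewrite mulrA ler_wpM2r// mulrBl mul1r mE aE.
      by move: vMZ vB; rewrite /be; clear; lra.
    apply: le_trans Zb; apply: (@le_trans _ _ ((1 - m) * (B * (b - x)))).
      by rewrite ler_wpM2l// lerNl -mulrN opprB.
    rewrite mulrA ler_wpM2r// mulrBl mul1r mE bE.
    by move: vMZ vA; rewrite /al; clear; lra.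
  have mH0 : 0 <= (1 - m) * - H.[x] by rewrite mulr_ge0// oppr_ge0.
  rewrite ler_norml; move: mH mH0 v0 vZ; rewrite /u; move: (Z * (b - a)) => ZZ; clear; lra.
Qed.

(** Quadratic pieces. On two adjacent cells [p0, p1] and [p1, p2] with middles [u] and [v], the
    piece interpolates [f] at [u] and [v]; its second derivative is the largest one for which
    the slopes of the piece at [u] and [v] lie between the slopes of the chords of [f] over the
    two cells. A piece and the next one, which share a cell, then meet at a convex corner. *)
Definition quad_piece f (p0 p1 p2 : R) : {poly R} :=
  let u := (p0 + p1) / 2 in let v := (p1 + p2) / 2 in
  let al := f v - f u - (f p1 - f p0) / (p1 - p0) * (v - u) in
  let be := f u - f v + (f p2 - f p1) / (p2 - p1) * (v - u) in
  chord f u v + (Num.min al be / (v - u) ^+ 2) *: (('X - u%:P) * ('X - v%:P)).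

Lemma size_quad_piece f (p0 p1 p2 : R) : (size (quad_piece f p0 p1 p2) <= 3)%N.
Proof.
rewrite /quad_piece (leq_trans (size_polyD _ _))// geq_max (leq_trans (size_chord _ _ _))//=.
rewrite (leq_trans (size_scale_leq _ _))// (leq_trans (size_polyMleq _ _))//.
by rewrite !size_XsubC.
Qed.

Lemma quad_piece_props f (p0 p1 p2 : R) (u := (p0 + p1) / 2) (v := (p1 + p2) / 2) :
  chord_convex f -> -1 <= p0 -> p0 < p1 -> p1 < p2 -> p2 <= 1 ->
  let F := quad_piece f p0 p1 p2 in
  [/\ F.[u] = f u, F.[v] = f v, forall x, 0 <= F^`(2).[x],
   (f p1 - f p0) / (p1 - p0) <= F^`().[u] & F^`().[v] <= (f p2 - f p1) / (p2 - p1)].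
Proof.
move=> fc p01 pp1 pp2 p21 F.
have uv : u < v by rewrite /u /v; clear -pp1 pp2; lra.
have vu0 : 0 < v - u by rewrite subr_gt0.
have up : u < p1 by rewrite /u; clear -pp1; lra.
have pv : p1 < v by rewrite /v; clear -pp2; lra.
have mid x y : -1 <= x -> x < y -> y <= 1 -> f ((x + y) / 2) <= (f x + f y) / 2.
  move=> x1 xy y1; have := fc x ((x + y) / 2) y x1 (ltac:(clear -xy; lra)) (ltac:(clear -xy; lra)) y1.
  have -> : y - (x + y) / 2 = (y - x) / 2 by field.
  have -> : (x + y) / 2 - x = (y - x) / 2 by field.
  have xy0 : 0 < (y - x) / 2 by clear -xy; lra.
  by rewrite ler_pM2r//; clear; lra.
have hu := mid p0 p1 p01 pp1 (ltac:(clear -pp2 p21; lra)).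
have hv := mid p1 p2 (ltac:(clear -pp1 p01; lra)) pp2 p21.
rewrite -/u in hu; rewrite -/v in hv.
pose d1 := (f p1 - f p0) / (p1 - p0); pose d2 := (f p2 - f p1) / (p2 - p1).
have d1E : f p1 - f p0 = d1 * (2 * (p1 - u)).
  by rewrite /d1 /u; field; rewrite subr_eq0 gt_eqF.
have d2E : f p2 - f p1 = d2 * (2 * (v - p1)).
  by rewrite /d2 /v; field; rewrite subr_eq0 gt_eqF.
have fconv := fc u p1 v (ltac:(rewrite /u; clear -p01 pp1; lra)) up pv (ltac:(rewrite /v; clear -p21 pp2; lra)).
pose al := f v - f u - d1 * (v - u); pose be := f u - f v + d2 * (v - u).
have pu0 : 0 < p1 - u by rewrite subr_gt0.
have vp0 : 0 < v - p1 by rewrite subr_gt0.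
have al0 : 0 <= al.
  have h1 : d1 * (p1 - u) <= f p1 - f u by clear -hu d1E; lra.
  have h2 : d1 * (v - p1) <= f v - f p1.
    rewrite -(ler_pM2r pu0); apply: le_trans fconv; rewrite mulrAC.
    by rewrite ler_wpM2r// ltW.
  by rewrite /al; clear -h1 h2; lra.
have be0 : 0 <= be.
  have h1 : f v - f p1 <= d2 * (v - p1) by clear -hv d2E; lra.
  have h2 : f p1 - f u <= d2 * (p1 - u).
    rewrite -(ler_pM2r vp0); apply: (le_trans fconv); rewrite [leRHS]mulrAC.
    by rewrite ler_wpM2r// ltW.
  by rewrite /be; clear -h1 h2; lra.
pose m := Num.min al be; pose S := (f v - f u) / (v - u).
have m0 : 0 <= m by rewrite le_min al0.
have ma : m <= al by rewrite ge_min lexx.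
have mb : m <= be by rewrite ge_min lexx orbT.
have FE : F = chord f u v + (m / (v - u) ^+ 2) *: (('X - u%:P) * ('X - v%:P)) by [].
have F' x : F^`().[x] = S + m / (v - u) ^+ 2 * ((x - u) + (x - v)).
  rewrite FE derivD deriv_chord hornerD hornerC derivZ derivM !derivXsubC mul1r mulr1.
  by rewrite hornerZ hornerD !hornerXsubC [in RHS](addrC (x - u)).
have SE : S * (v - u) = f v - f u by rewrite /S divfK// gt_eqF.
split.
- by rewrite FE hornerD chord_left hornerZ hornerM !hornerXsubC subrr mul0r mulr0 addr0.
- by rewrite FE hornerD chord_right// hornerZ hornerM !hornerXsubC subrr !mulr0 addr0.
- move=> x; rewrite FE derivnS derivn1 derivD deriv_chord derivD derivC add0r derivZ.
  rewrite derivM !derivXsubC mul1r mulr1 derivZ derivD !derivXsubC hornerZ hornerD hornerC.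
  by rewrite mulr_ge0// ?divr_ge0 ?exprn_ge0 ?(ltW vu0)//; clear; lra.
- rewrite F' subrr add0r -/d1 -(ler_pM2r vu0) mulrDl SE.
  rewrite (_ : m / (v - u) ^+ 2 * (u - v) * (v - u) = - m); last by field; rewrite gt_eqF.
  by move: ma; rewrite /al; clear; lra.
- rewrite F' subrr addr0 -/d2 -(ler_pM2r vu0) mulrDl SE.
  rewrite (_ : m / (v - u) ^+ 2 * (v - u) * (v - u) = m); last by field; rewrite gt_eqF.
  by move: mb; rewrite /be; clear; lra.
Qed.

(** For a quadratic polynomial both numbers [al] and [be] are its leading coefficient times
    the square of the distance of [u] and [v]; by Whitney's inequality they, and hence their
    minimum, are not far from that for [f]. *)
Lemma quad_piece_close (T : R) : 1 <= T -> exists2 C : R, 0 < C & forall f (p0 p1 p2 e : R),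
  p0 < p1 -> p1 < p2 -> p2 - p1 <= T * (p1 - p0) -> p1 - p0 <= T * (p2 - p1) ->
  cont_on p0 p2 f -> mod_le 3 f p0 p2 e ->
  forall x, p0 <= x <= p2 -> `|f x - (quad_piece f p0 p1 p2).[x]| <= C * e.
Proof.
move=> T1; have [W W0 WP] := @whitney R 3.
exists (W * (17 + 4 * T)); first by rewrite mulr_gt0//; clear -T1; lra.
move=> f p0 p1 p2 e pp1 pp2 T12 T21 fc fe x xp.
have p02 : p0 < p2 := lt_trans pp1 pp2.
have [p sp pP] := WP f p0 p2 e p02 fc fe.
set u := (p0 + p1) / 2; set v := (p1 + p2) / 2.
have uv : u < v by rewrite /u /v; clear -pp1 pp2; lra.
pose L := v - u; have L0 : 0 < L by rewrite subr_gt0.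
pose E := W * e; have E0 : 0 <= E by rewrite mulr_ge0 ?(ltW W0)// (mod_le_ge0 p02 fe).
pose g y := f y - p.[y].
have gE y : p0 <= y <= p2 -> `|g y| <= E by exact: pP.
pose c := p`_2.
have pE y : p.[y] = p`_0 + p`_1 * y + c * y ^+ 2.
  by rewrite (horner_coef_wide _ sp) !big_ord_recl big_ord0 /= expr0 expr1 mulr1 addr0 addrA.
have fE y : f y = g y + p.[y] by rewrite /g subrK.
pose al := f v - f u - (f p1 - f p0) / (p1 - p0) * L.
pose be := f u - f v + (f p2 - f p1) / (p2 - p1) * L.
have L1 : L <= (1 + T) / 2 * (p1 - p0) by rewrite /L /u /v; clear -T12; lra.
have L2 : L <= (1 + T) / 2 * (p2 - p1) by rewrite /L /u /v; clear -T21; lra.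
have [gp0 gp1 gp2] : [/\ `|g p0| <= E, `|g p1| <= E & `|g p2| <= E].
  by split; apply: gE; clear -pp1 pp2; lra.
have [gu gv] : `|g u| <= E /\ `|g v| <= E.
  by split; apply: gE; rewrite /u /v; clear -pp1 pp2; lra.
have slope s1 s2 : s1 < s2 -> L <= (1 + T) / 2 * (s2 - s1) -> `|g s1| <= E -> `|g s2| <= E ->
    `|(g s2 - g s1) / (s2 - s1) * L| <= (1 + T) * E.
  move=> s12 Ls g1 g2; have s0 : 0 < s2 - s1 by rewrite subr_gt0.
  rewrite mulrAC normrM normfV (gtr0_norm s0) ler_pdivrMr// normrM (gtr0_norm L0).
  apply: (@le_trans _ _ (2 * E * ((1 + T) / 2 * (s2 - s1)))).
    rewrite ler_pM ?(ltW L0)//; move: g1 g2; clear; rewrite !ler_norml; lra.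
  by clear; lra.
have alE : `|al - c * L ^+ 2| <= (3 + T) * E.
  have -> : al - c * L ^+ 2 = g v - g u - (g p1 - g p0) / (p1 - p0) * L.
    rewrite /al !fE !pE /L /u /v; field; by rewrite subr_eq0 gt_eqF.
  have := slope p0 p1 pp1 L1 gp0 gp1; move: (_ / _ * L) => X hX.
  have -> : (3 + T) * E = 2 * E + (1 + T) * E by ring.
  by move: ((1 + T) * E) hX => Y; move: gu gv; clear; rewrite !ler_norml; lra.
have beE : `|be - c * L ^+ 2| <= (3 + T) * E.
  have -> : be - c * L ^+ 2 = g u - g v + (g p2 - g p1) / (p2 - p1) * L.
    rewrite /be !fE !pE /L /u /v; field; by rewrite subr_eq0 gt_eqF.
  have := slope p1 p2 pp2 L2 gp1 gp2; move: (_ / _ * L) => X hX.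
  have -> : (3 + T) * E = 2 * E + (1 + T) * E by ring.
  by move: ((1 + T) * E) hX => Y; move: gu gv; clear; rewrite !ler_norml; lra.
have mE : `|Num.min al be - c * L ^+ 2| <= (3 + T) * E by case: (leP al be).
pose m := Num.min al be; rewrite -/m in mE.
have QE : (quad_piece f p0 p1 p2).[x] = f u + (f v - f u) / L * (x - u) + m / L ^+ 2 * ((x - u) * (x - v)).
  by rewrite hornerD chordE hornerZ hornerM !hornerXsubC.
have xu : `|x - u| <= 2 * L by rewrite /L /u /v; move: xp; clear -pp1 pp2; rewrite ler_norml; lra.
have xv : `|x - v| <= 2 * L by rewrite /L /u /v; move: xp; clear -pp1 pp2; rewrite ler_norml; lra.
have key : f x - (quad_piece f p0 p1 p2).[x] =
    g x - g u * ((v - x) / L) - g v * ((x - u) / L) - (m - c * L ^+ 2) * ((x - u) / L * ((x - v) / L)).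
  by rewrite QE !fE !pE /L; field; rewrite subr_eq0 gt_eqF.
have xuL : `|(x - u) / L| <= 2 by rewrite normrM normfV (gtr0_norm L0) ler_pdivrMr.
have xvL : `|(x - v) / L| <= 2 by rewrite normrM normfV (gtr0_norm L0) ler_pdivrMr.
have vxL : `|(v - x) / L| <= 2 by rewrite -opprB mulNr normrN.
have t1 : `|g u * ((v - x) / L)| <= E * 2 by rewrite normrM ler_pM.
have t2 : `|g v * ((x - u) / L)| <= E * 2 by rewrite normrM ler_pM.
have t3 : `|(m - c * L ^+ 2) * ((x - u) / L * ((x - v) / L))| <= (3 + T) * E * (2 * 2).
  rewrite normrM; apply: ler_pM => //; rewrite normrM; exact: ler_pM.
have gx := gE x xp; rewrite key.
have -> : W * (17 + 4 * T) * e = E + E * 2 + E * 2 + (3 + T) * E * (2 * 2) by rewrite /E; ring.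
move: t1 t2 t3; set X1 := g u * _; set X2 := g v * _; set X3 := (m - _) * _; set X4 := _ * (2 * 2).
by move: gx; clear; rewrite !ler_norml; lra.
Qed.

End LocalPieces2.

(** * From moduli and norms to pointwise bounds *)
Section Bridge.
Context {R : realType}.
Implicit Types (p F : {poly R}) (f g s : R -> R) (z zt w : nat -> R) (a b c d e x y t theta : R) (i j k m n q r nu : nat).

Lemma knotS n z j : knot n z (j%:Z + 1) = z (minn n j.+1).
Proof. by rewrite -PoszD addn1. Qed.

Lemma knotP n z j : (j <= n)%N -> knot n z (j%:Z - 1) = z j.-1.
Proof.
case: j => [|j] jn; first by rewrite /knot /= minn0.
by rewrite intS addrC addKr /knot (minn_idPr (ltnW jn)).
Qed.

Lemma J_len_nat n z j : (j < n)%N -> J_len n z j%:Z = z j.+1 - z j.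
Proof. by move=> jn; rewrite /J_len knotS (minn_idPr jn) /knot (minn_idPr (ltnW jn)). Qed.

Lemma scale_ge0 n z : 0 <= scale n z.
Proof. exact: bigmax_ge_id. Qed.

Lemma scale_neighbours n z j : is_partition n z -> (j < n)%N ->
  z j - z j.-1 <= scale n z * (z j.+1 - z j) /\
  z (minn n j.+2) - z j.+1 <= scale n z * (z j.+1 - z j).
Proof.
move=> zP jn; have [_ _ zinc] := zP; have l0 : 0 < z j.+1 - z j by rewrite subr_gt0 zinc.
have := @le_bigmax _ _ _ 0 (fun j : 'I_n => Num.max (J_len n z (j%:Z - 1) / J_len n z j%:Z)
            (J_len n z (j%:Z + 1) / J_len n z j%:Z)) (Ordinal jn).
rewrite -/(scale n z) /= ge_max J_len_nat// => /andP[h1 h2].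
rewrite -(ler_pdivrMr _ _ l0) -(ler_pdivrMr _ _ l0); split.
  apply: le_trans h1; rewrite /J_len knotP ?(ltnW jn)// addrNK /knot (minn_idPr (ltnW jn)) //.
apply: le_trans h2; rewrite /J_len -PoszD addn1 knotS.
by rewrite addn1 /knot (minn_idPr jn).
Qed.

(** The interval [z_(j-1), z_(j+1)] is reduced to a single cell for [j = 0] and [j = n]. *)
Definition width n z j := z (minn n j.+1) - z j.-1.

Lemma width_gt0 n z j : is_partition n z -> (j <= n)%N -> 0 < width n z j.
Proof. by move=> zP jn; rewrite subr_gt0 neighbours_lt. Qed.

Lemma width_le n z j : is_partition n z -> (j <= n)%N ->
  width n z j <= (1 + scale n z) * J_len n z (minn j n.-1)%:Z.
Proof.
move=> zP jn; have n0 := partition_gt0 zP; have [_ _ zinc] := zP.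
have [jn'|jn'] := ltnP j n.
  have -> : minn j n.-1 = j by apply/minn_idPl; rewrite -ltnS prednK.
  rewrite J_len_nat// /width (minn_idPr jn'); have [+ _] := scale_neighbours zP jn'.
  by rewrite mulrDl mul1r; clear; lra.
have -> : j = n by apply/eqP; rewrite eqn_leq jn.
rewrite (minn_idPr (leq_pred n)) /width (minn_idPl (leqnSn n)) J_len_nat ?prednK//.
rewrite mulrDl mul1r lerDl mulr_ge0// ?scale_ge0// subr_ge0 (partition_le zP)//.
exact: leq_pred.
Qed.

(** The moduli are finite because the derivative is continuous on [-1, 1]. The powers of the
    length of one cell are compared with those of the two cells around [z j] by means of the
    scale. *)
Lemma local_estimate_of_pointwise k nu n z f : is_partition n z -> Cn `[-1, 1] nu f ->
  exists w : nat -> R,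
    (forall j, (j <= n)%N ->
       mod_le k (derive_on_n `[-1, 1] nu f) (z j.-1) (z (minn n j.+1)) (w j)) /\
    forall (C : R) c s, 0 <= C -> C * (1 + scale n z) ^+ nu <= c ->
      locally_close n z (fun j => C * (width n z j ^+ nu * w j)) f s ->
      local_estimate k nu n z c f s.
Proof.
move=> zP fC; set fnu := derive_on_n _ _ _.
have fc j : (j <= n)%N -> cont_on (z j.-1) (z (minn n j.+1)) fnu.
  move=> jn; apply: cont_on_sub (Cn_cont_on fC (leqnn nu)).
    by have /andP[] := partition_m11 zP (leq_trans (leq_pred j) jn).
  by have /andP[] := partition_m11 zP (geq_minl n j.+1).
have /choice[w wP] : forall j, exists c : R, (j <= n)%N ->
    0 <= c /\ omega k fnu (z j.-1) (z (minn n j.+1)) = c%:E.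
  move=> j; have [jn|_] := boolP (j <= n)%N; last by exists 0.
  by have [c c0 cE] := omega_finite k (neighbours_lt zP jn) (fc j jn); exists c.
exists w; split=> [j jn|C c s C0 Cc sf fnu' j jn].
  apply: omega_mod_le (neighbours_lt zP jn) (fc j jn) _.
  by have [_ ->] := wP j jn.
have [w0 wE] := wP j jn.
cbv zeta; rewrite (knotP z jn) knotS wE -EFinM.
set l := J_len _ _ _; have l0 : 0 <= l.
  have jn' : (minn j n.-1 < n)%N.
    by rewrite (leq_ltn_trans (geq_minr _ _))// prednK// (partition_gt0 zP).
  by rewrite /l J_len_nat// subr_ge0 (partition_le zP).
apply: (@le_trans _ _ (C * (width n z j ^+ nu * w j))%:E).
  apply: Linfty_norm_le; first by rewrite !mulr_ge0// exprn_ge0// ltW// width_gt0.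
  move=> x; rewrite /I_set (knotP z jn) knotS /= in_itv /= {1 2}/knot (minn_idPr jn); exact: sf.
rewrite lee_fin mulrA ler_wpM2r//.
apply: (@le_trans _ _ (C * ((1 + scale n z) ^+ nu * l ^+ nu))); last first.
  by rewrite mulrA ler_wpM2r// exprn_ge0.
rewrite ler_wpM2l// -exprMn; apply: lerXn2r; rewrite ?nnegrE.
- exact/ltW/width_gt0.
- by rewrite mulr_ge0// addr_ge0// scale_ge0.
- exact: width_le.
Qed.

(** By the mean value theorem one order of the difference can be traded for one derivative and
    a factor [b - a]. *)
Lemma mod_le_derive_on k nu i f a b c : (i <= nu)%N -> Cn `[-1, 1] nu f ->
  -1 <= a -> a < b -> b <= 1 -> mod_le k (derive_on_n `[-1, 1] nu f) a b c ->
  mod_le (nu - i + k) (derive_on_n `[-1, 1] i f) a b ((b - a) ^+ (nu - i) * c).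
Proof.
move=> inu fC a1 ab b1 fk; move e : (nu - i)%N => d.
elim: d i inu e => [|d IH] i inu e.
  have -> : i = nu by apply/eqP; rewrite eqn_leq inu -subn_eq0 e.
  by rewrite expr0 mul1r.
have inu' : (i < nu)%N by rewrite -subn_gt0 e.
rewrite exprS -mulrA addSn.
have fd : diff_on a b (derive_on_n `[-1, 1] i f) (derive_on_n `[-1, 1] i.+1 f).
  by apply: diff_on_sub a1 b1 _; exact: Cn_diff_on fC inu'.
by apply: mod_le_deriv ab fd _; apply: IH => //; rewrite subnS e.
Qed.

Lemma Cn_has_wderiv nu f i x : Cn `[-1, 1] nu f -> (i < nu)%N -> -1 <= x <= 1 ->
  has_wderiv (derive_on_n `[-1, 1] i f) x (derive_on_n `[-1, 1] i.+1 f x).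
Proof. by move=> [fd _] inu x1; apply: derivable_on_has_wderiv => //; apply: fd. Qed.

Lemma Cn_sub nu i f : Cn `[-1, 1] nu f -> (i <= nu)%N -> Cn `[-1, 1] i f.
Proof.
move=> fC inu; split=> [j ji x x1|]; last by apply/cont_onP; exact: Cn_cont_on fC inu.
by have [fd _] := fC; apply: fd => //; exact: leq_trans inu.
Qed.

(** A lower bound for the increments to one side of a point bounds the derivative there;
    at the ends of [-1, 1] only one side is available. *)
Lemma has_wderiv_ge f x y d (S : R) : -1 <= x <= 1 -> -1 <= y <= 1 -> x != y -> has_wderiv f x d ->
  (forall t, Num.min x y <= t <= Num.max x y -> S * (t - x) ^+ 2 <= (f t - f x) * (t - x)) -> S <= d.
Proof.
move=> x1 y1 xy fd fS; rewrite leNgt; apply/negP => dS.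
have e0 : 0 < (S - d) / 2 by clear -dS; lra.
have [del del0 dP] := fd _ e0.
have yx0 : 0 < `|y - x| by rewrite normr_gt0 subr_eq0 eq_sym.
pose a := Num.min 1 (del / (2 * `|y - x|)).
have a0 : 0 < a by rewrite lt_min ltr01 divr_gt0// mulr_gt0.
have a1 : a <= 1 by rewrite ge_min lexx.
have ad : a * `|y - x| < del.
  apply: (@le_lt_trans _ _ (del / (2 * `|y - x|) * `|y - x|)).
    by rewrite ler_pM2r// ge_min lexx orbT.
  by rewrite invfM mulrA divfK ?gt_eqF//; clear -del0; lra.
pose t := x + a * (y - x).
have tx : t - x = a * (y - x) by rewrite /t addrAC subrr add0r.
have tin u v : u <= x <= v -> u <= y <= v -> u <= t <= v.
  move=> xuv yuv; have h1 : 0 <= a * (y - u) by rewrite (mulr_ge0 (ltW a0))//; clear -yuv; lra.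
  have h2 : 0 <= (1 - a) * (x - u) by rewrite mulr_ge0 ?subr_ge0//; clear -xuv; lra.
  have h3 : 0 <= a * (v - y) by rewrite (mulr_ge0 (ltW a0))//; clear -yuv; lra.
  have h4 : 0 <= (1 - a) * (v - x) by rewrite mulr_ge0 ?subr_ge0//; clear -xuv; lra.
  by rewrite /t; clear -h1 h2 h3 h4; lra.
have txd : `|t - x| < del by rewrite tx normrM (gtr0_norm a0).
have tx0 : 0 < (t - x) ^+ 2.
  by rewrite exprn_even_gt0//= tx mulf_neq0 ?(gt_eqF a0)// subr_eq0 eq_sym.
have := dP t (tin _ _ x1 y1) txd.
have := fS t (tin _ _ _ _); rewrite !ge_min !le_max !lexx !orbT => /(_ isT isT) h1 h2.
have h3 : (f t - f x - d * (t - x)) * (t - x) <= (S - d) / 2 * (t - x) ^+ 2.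
  apply: (le_trans (ler_norm _)); rewrite normrM (le_trans (ler_wpM2r _ h2))//.
  by rewrite -[_ * _ * `|_|]mulrA -normrM -expr2 ger0_norm// ltW.
have h4 : (S - d) / 2 * (t - x) ^+ 2 < (S - d) * (t - x) ^+ 2.
  by rewrite ltr_pM2r//; clear -dS; lra.
move: h1 h3 h4; rewrite [(_ - _ - _) * _]mulrBl -(mulrA d (t - x)) -expr2; move: ((t - x) ^+ 2) ((_ - _) * _) => X Y.
by clear; lra.
Qed.

Lemma other_point x : -1 <= x <= 1 -> exists2 y, -1 <= y <= 1 & x != y.
Proof.
move=> x1; have [->|x0] := eqVneq x 0; last by exists 0 => //; clear; lra.
by exists 1; [clear; lra|rewrite lt_eqF].
Qed.

Lemma monotone_wderiv_ge0 f x d : (forall u v, -1 <= u -> u <= v -> v <= 1 -> f u <= f v) ->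
  -1 <= x <= 1 -> has_wderiv f x d -> 0 <= d.
Proof.
move=> fm x1 fd; have [y y1 xy] := other_point x1.
apply: (has_wderiv_ge x1 y1 xy fd) => t txy; rewrite mul0r.
have t1 : -1 <= t <= 1.
  move: txy; rewrite ge_min le_max => /andP[/orP h1 /orP h2].
  by case: h1 => h1; case: h2 => h2; clear -h1 h2 x1 y1; lra.
have [xt|/ltW tx] := leP x t.
  by rewrite mulr_ge0// subr_ge0// fm//; clear -x1 t1; lra.
by rewrite -mulrNN !opprB mulr_ge0// subr_ge0// fm//; clear -x1 t1; lra.
Qed.

Lemma convex_wderiv f x y d : chord_convex f -> -1 <= x -> x < y -> y <= 1 ->
  (has_wderiv f x d -> d <= (f y - f x) / (y - x)) /\
  (has_wderiv f y d -> (f y - f x) / (y - x) <= d).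
Proof.
move=> fc x1 xy y1; set S := _ / _; have yx0 : 0 < y - x by rewrite subr_gt0.
have SE : S * (y - x) = f y - f x by rewrite /S divfK// gt_eqF.
have xx : -1 <= x <= 1 by clear -x1 xy y1; lra.
have yy : -1 <= y <= 1 by clear -x1 xy y1; lra.
(* the graph lies below the chord *)
have below t : x <= t <= y -> f t - f x <= S * (t - x) /\ S * (y - t) <= f y - f t.
  move=> /andP[xt ty]; suff h : f t - f x <= S * (t - x).
    by split=> //; move: h SE; clear; lra.
  move: xt ty; rewrite le_eqVlt => /orP[/eqP<-|xt]; first by rewrite !subrr mulr0.
  rewrite le_eqVlt => /orP[/eqP->|ty]; first by rewrite SE.
  have := fc x t y x1 xt ty y1 => h.
  rewrite -(ler_pM2r yx0) mulrAC SE.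
  by move: h; clear; lra.
split=> fd.
  have fd' : has_wderiv (fun t => - f t) x (- d).
    move=> e e0; have [del del0 dP] := fd e e0; exists del => // t t1 tx.
    have := dP t t1 tx; rewrite -normrN; congr (`|_| <= _); ring.
  rewrite -lerN2; apply: (has_wderiv_ge xx yy _ fd'); first by rewrite lt_eqF.
  move=> t; rewrite (min_idPl (ltW xy)) (max_idPr (ltW xy)) => /[dup] /andP[xt _] /below[h _].
  rewrite expr2 mulrA ler_wpM2r// ?subr_ge0//; move: h; clear; lra.
apply: (has_wderiv_ge yy xx _ fd); first by rewrite gt_eqF.
move=> t; rewrite (min_idPr (ltW xy)) (max_idPl (ltW xy)) => /[dup] /andP[_ ty] /below[_ h].
by rewrite -[leRHS]mulrNN !opprB -sqrrN opprB expr2 mulrA ler_wpM2r// subr_ge0.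
Qed.

Lemma derive_ge0_of_monotone f x : q_monotone 1 f -> Cn `[-1, 1] 1 f -> -1 <= x <= 1 ->
  0 <= derive_on_n `[-1, 1] 1 f x.
Proof.
move=> /q_monotone1P fm fC x1.
exact: monotone_wderiv_ge0 fm x1 (Cn_has_wderiv fC (ltnSn 0) x1).
Qed.

Lemma derive2_ge0_of_convex f x : q_monotone 2 f -> Cn `[-1, 1] 2 f -> -1 <= x <= 1 ->
  0 <= derive_on_n `[-1, 1] 2 f x.
Proof.
move=> /q_monotone2P fc fC x1.
apply: (monotone_wderiv_ge0 _ x1 (Cn_has_wderiv fC (ltnSn 1) x1)) => u v u1 uv v1.
move: uv; rewrite le_eqVlt => /orP[/eqP->//|uv].
have D t : -1 <= t <= 1 -> has_wderiv f t (derive_on_n `[-1, 1] 1 f t).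
  by move=> t1; exact: (Cn_has_wderiv fC (ltn0Sn 1) t1).
have [h1 _] := convex_wderiv (derive_on_n `[-1, 1] 1 f u) fc u1 uv v1.
have [_ h2] := convex_wderiv (derive_on_n `[-1, 1] 1 f v) fc u1 uv v1.
by apply: le_trans (h1 (D u _)) (h2 (D v _)); clear -u1 uv v1; lra.
Qed.

End Bridge.

(** * Approximation by splines on a remesh *)
Section Approximation.
Context {R : realType}.
Implicit Types (p F : {poly R}) (f g s : R -> R) (z zt w : nat -> R) (a b c d e u v x y t theta delta C : R) (i j k m n q r N nu : nat).

(** One scheme of approximation by splines of degree [r], governed by the moduli of order [k]
    of the [i]-th derivative. The density [rho] is chosen before the bound [theta] of the
    scale, on which it must not depend. *)
Definition approximable q r i k := exists2 rho : R, 0 < rho & forall theta, exists2 C : R, 0 < C &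
  forall delta n z m zt f w, is_partition n z -> 0 < delta -> delta <= rho ->
    is_remesh delta n z m zt -> scale n z <= theta -> q_monotone q f -> Cn `[-1, 1] i f ->
    (forall j, (j <= n)%N ->
       mod_le k (derive_on_n `[-1, 1] i f) (z j.-1) (z (minn n j.+1)) (w j)) ->
    exists s, [/\ is_smooth_spline r m zt s, q_monotone q s &
      locally_close n z (fun j => C * (width n z j ^+ i * w j)) f s].

(** ** Interpolation at the knots of the remesh *)

(** The truncated powers with knots to the left of [x] telescope. *)
Lemma spl_of_jumps r m zt (F : nat -> {poly R}) (c : nat -> R) i x : is_partition m zt ->
  (forall j, (j.+1 < m)%N -> F j.+1 = F j + (c j / r`!%:R) *: ('X - (zt j.+1)%:P) ^+ r) ->
  (i < m)%N -> zt i <= x -> x < zt i.+1 \/ (i.+1 = m) ->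
  (F 0%N).[x] + spl r [seq (c j, zt j.+1) | j <- iota 0 m.-1] x = (F i).[x].
Proof.
move=> zP HF im ix xi; have [z0 z1 zinc] := zP.
have im' : (i <= m.-1)%N by rewrite -ltnS prednK// (leq_ltn_trans _ im).
rewrite /spl big_map -{1}[m.-1]subn0 -/(index_iota 0 m.-1) (big_cat_nat _ im')//=.
rewrite [X in _ + (_ + X)]big_nat_cond [X in _ + (_ + X)]big1 => [|j]; last first.
  rewrite andbT => /andP[ij jm].
  have xj : x < zt j.+1.
    case: xi => [xi|iE]; last by exfalso; clear -iE ij jm; lia.
    by apply: lt_le_trans xi _; apply: (partition_le zP) => //; clear -jm; lia.
  by rewrite /tpow subr_ge0 leNgt xj mulr0.
rewrite addr0 -[RHS](subrK (F 0%N).[x]) addrC; congr (_ + _).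
rewrite -(telescope_sumr (fun j => (F j).[x]))//; apply: eq_big_nat => j /= ji.
have jm : (j.+1 < m)%N by rewrite (leq_ltn_trans ji).
rewrite HF// hornerD addrAC subrr add0r hornerZ horner_exp hornerXsubC /tpow subr_ge0.
by rewrite (le_trans _ ix) ?(partition_le zP)// ?(ltnW im)// mulrA mulrAC.
Qed.

Lemma spl0_nondecr (l : seq (R * R)) x y : (forall c : R * R, c \in l -> 0 <= c.1) -> x <= y -> spl 0 l x <= spl 0 l y.
Proof.
move=> l0 xy; rewrite /spl big_seq [leRHS]big_seq; apply: ler_sum => c cl.
rewrite ler_wpM2l ?l0// /tpow !subr_ge0; case: ifP => [cx|_].
  by rewrite (le_trans cx xy).
by case: ifP => // _; rewrite expr0 divr1.
Qed.

(** A cell of the remesh that reached from one of the half cells around [z j] beyond a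
    neighbour of [z j] would contain half a cell of the partition properly, and be too long. *)
Lemma remesh_cell_near delta n z m zt j i x : is_partition n z -> 0 < delta -> delta <= 1/2 ->
  is_remesh delta n z m zt -> (j <= n)%N -> (i < m)%N -> zt i <= x <= zt i.+1 ->
  (z j.-1 + z j) / 2 <= x <= (z j + z (minn n j.+1)) / 2 ->
  z j.-1 <= zt i /\ zt i.+1 <= z (minn n j.+1).
Proof.
move=> zP d0 d12 zr jn im /andP[ix xi] /andP[xl xr]; have [ztP _] := zr.
have [z0 z1 zinc] := zP.
have small l : 0 < l -> delta * l <= 1/2 * l by move=> l0; rewrite ler_pM2r.
split; rewrite leNgt; apply/negP => lt.
  case: j jn xl xr lt => [|j] jn xl xr lt.
    have /andP[h _] := partition_m11 ztP (ltnW im).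
    by move: lt; rewrite /= z0 ltNge h.
  simpl in *; have zj := zinc j jn.
  have [|h _ _] := is_remesh_cell zP d0 zr jn im.
    exists (z j + (z j.+1 - z j) / 4); rewrite /= !in_itv /=.
    by clear -lt xi xl zj; split; lra.
  have l0 : 0 < z j.+1 - z j by rewrite subr_gt0.
  by have := small _ l0; clear -h lt xl xi; lra.
have jn' : (j < n)%N.
  rewrite ltn_neqAle jn andbT; apply/eqP => jE; move: lt.
  rewrite jE (minn_idPl (leqnSn n)) z1 ltNge.
  by have /andP[_ ->] := partition_m11 ztP im.
rewrite (minn_idPr jn') in lt xr; have zj := zinc j jn'.
have [|h _ _] := is_remesh_cell zP d0 zr jn' im.
  exists (z j.+1 - (z j.+1 - z j) / 4); rewrite /= !in_itv /=.
  by clear -lt ix xr zj; split; lra.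
have l0 : 0 < z j.+1 - z j by rewrite subr_gt0.
by have := small _ l0; clear -h lt xr ix; lra.
Qed.

Lemma partition_locate m zt x : is_partition m zt -> -1 <= x <= 1 ->
  exists i, [/\ (i < m)%N, zt i <= x <= zt i.+1 & x < zt i.+1 \/ i.+1 = m].
Proof.
move=> zP /andP[x1 x2]; have [z0 z1 zinc] := zP; have m0 := partition_gt0 zP.
have [xm|mx] := ltP x (zt m.-1.+1); last first.
  exists m.-1; rewrite prednK//; split; [by []| |by right].
  rewrite z1 x2 andbT (le_trans _ mx)// prednK// (partition_le zP)//; exact: leq_pred.
have ex : exists i, x < zt i.+1 by exists m.-1.
case: (ex_minnP ex) => i xi imin; exists i; split; last by left.
  by rewrite -[m]prednK// ltnS; apply: imin.
rewrite (ltW xi) andbT; case: i xi imin => [|i] xi imin; first by rewrite z0.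
by rewrite leNgt; apply/negP => /imin; rewrite ltnn.
Qed.

Lemma half_cells_m11 n z j x : is_partition n z -> (j <= n)%N ->
  (z j.-1 + z j) / 2 <= x <= (z j + z (minn n j.+1)) / 2 -> -1 <= x <= 1.
Proof.
move=> zP jn; have := partition_m11 zP (leq_trans (leq_pred j) jn).
have := partition_m11 zP jn; have := partition_m11 zP (geq_minl n j.+1); clear; lra.
Qed.

(** For splines of degree [q - 1], which have just one free coefficient per knot, pieces are
    taken on the cells of the remesh itself. *)
Lemma approximable_of_jumps r (G : (R -> R) -> R -> R -> {poly R}) C : r = 0%N \/ r = 1%N -> 0 < C ->
  (forall f u v, (size (G f u v) <= r.+1)%N) ->
  (forall f u v t, q_monotone r.+1 f -> -1 <= u -> u < v -> v < t -> t <= 1 ->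
     exists2 c, 0 <= c & G f v t = G f u v + (c / r`!%:R) *: ('X - v%:P) ^+ r) ->
  (forall f u v e, u < v -> cont_on u v f -> mod_le r.+1 f u v e ->
     forall x, u <= x <= v -> `|f x - (G f u v).[x]| <= C * e) ->
  approximable r.+1 r 0 r.+1.
Proof.
move=> r01 C0 sG jG fG; exists (1/2) => [|theta]; first by clear; lra.
exists C => // delta n z m zt f w zP d0 d12 zr _ fm fC fw; have [ztP _] := zr.
have [zt0 zt1 ztinc] := ztP.
pose F i := G f (zt i) (zt i.+1).
have /choice[c cP] : forall i, exists c, (i.+1 < m)%N ->
    0 <= c /\ F i.+1 = F i + (c / r`!%:R) *: ('X - (zt i.+1)%:P) ^+ r.
  move=> i; have [im|_] := boolP (i.+1 < m)%N; last by exists 0.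
  have /andP[u1 _] := partition_m11 ztP (ltnW (ltnW im)).
  have /andP[_ t1] := partition_m11 ztP im.
  have [c c0 cE] := jG f _ _ _ fm u1 (ztinc i (ltnW im)) (ztinc i.+1 im) t1.
  by exists c.
pose l := [seq (c j, zt j.+1) | j <- iota 0 m.-1].
have lP (d : R * R) : d \in l -> exists2 j, (j.+1 < m)%N & d = (c j, zt j.+1).
  move=> /mapP[j]; rewrite mem_iota add0n => /= jm ->; exists j => //.
  by clear -jm; lia.
exists (fun x => (F 0%N).[x] + spl r l x); split.
- by apply: is_smooth_spline_spl => // [|d /lP[j jm ->]]; [exact: sG|exists j.+1].
- apply: (@q_monotone_spl R r.+1 0); first by case: r01 => ->; [left|right].
  move=> x y _ xy _ /=; apply: lerD.
    have /size1_polyC -> : (size (F 0%N)^`(r) <= 1)%N.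
      by rewrite (leq_trans (size_derivn_le _ (sG _ _ _)))// subSnn.
    by rewrite !hornerC.
  by apply: spl0_nondecr => // d /lP[j jm ->]; have [] := cP j jm.
move=> j x jn xj; have x1 := half_cells_m11 zP jn xj.
have [i [im xi xi']] := partition_locate ztP x1.
have /andP[ix _] := xi.
rewrite (spl_of_jumps ztP _ im ix xi'); last by move=> k km; have [] := cP k km.
have [h1 h2] := remesh_cell_near zP d0 d12 zr jn im xi xj.
rewrite expr0 mul1r; apply: fG xi; first exact: ztinc.
  apply: cont_on_sub (Cn_cont_on fC (leqnn 0)).
    by have /andP[] := partition_m11 ztP (ltnW im).
  by have /andP[] := partition_m11 ztP im.
exact: mod_le_sub h1 h2 (fw j jn).
Qed.

Lemma approximable_step : approximable 1 0 0 1.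
Proof.
have [C C0 CP] := @whitney R 1.
apply: (@approximable_of_jumps 0 (fun f u v => (f u)%:P) (2 * C)); [by left|by rewrite mulr_gt0| | |].
- by move=> f u v; exact: size_polyC_leq1.
- move=> f u v t /q_monotone1P fm u1 uv vt t1; exists (f v - f u).
    rewrite subr_ge0; apply: fm => //; [exact: ltW|exact: ltW (lt_le_trans vt t1)].
  by rewrite expr0 divr1 alg_polyC -polyCD addrC subrK.
- move=> f u v e uv fc fe x xuv; have [p sp pP] := CP f u v e uv fc fe.
  have := pP x xuv; have := pP u; rewrite lexx ltW// => /(_ isT).
  rewrite (size1_polyC sp) !hornerC -[2 * C * e]mulrA; move: (C * e) => X.
  by clear; rewrite !ler_norml; lra.
Qed.

Lemma approximable_polygon : approximable 2 1 0 2.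
Proof.
have [C C0 CP] := @linear_piece R.
apply: (@approximable_of_jumps 1 chord C); [by right|by []| | |].
- exact: size_chord.
- move=> f u v t /q_monotone2P fm u1 uv vt t1.
  exists ((f t - f v) / (t - v) - (f v - f u) / (v - u)).
    rewrite subr_ge0 ler_pdivrMr ?subr_gt0// mulrAC ler_pdivlMr ?subr_gt0//.
    exact: fm.
  have vu0 : v - u != 0 by rewrite subr_eq0 gt_eqF.
  rewrite /chord divr1 expr1 scalerBl; set S := _ / (v - u).
  have fE : f v = f u + S * (v - u) by rewrite /S divfK// addrC subrK.
  rewrite {1}fE polyCD polyCM polyCB -!mul_polyC; ring.
- exact: CP.
Qed.

End Approximation.

Section CoarsePieces.
Context {R : realType}.
Implicit Types (p F : {poly R}) (f g s : R -> R) (z zt w : nat -> R) (a b c d e u v x y t theta delta C : R) (i j k m n q r N nu : nat).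

(** ** One polynomial for each cell of the given partition *)

(** Pieces that match [f] at the ends of the interval; in the convex case their slopes there
    leave room for the slope of [f], so that adjacent pieces form convex corners. *)
Definition matching_pieces q r i k := exists2 C : R, 0 < C & forall f a b e,
  q_monotone q f -> Cn `[-1, 1] i f -> -1 <= a -> a < b -> b <= 1 ->
  mod_le k (derive_on_n `[-1, 1] i f) a b e -> exists F,
  [/\ (size F <= r.+1)%N, forall x, a <= x <= b -> 0 <= F^`(q).[x],
      F.[a] = f a /\ F.[b] = f b,
      q = 2%N -> derive_on_n `[-1, 1] 1 f a <= F^`().[a] /\ F^`().[b] <= derive_on_n `[-1, 1] 1 f b &
      forall x, a <= x <= b -> `|f x - F.[x]| <= C * ((b - a) ^+ i * e)].

Lemma approximable_of_matching_pieces q r i k : q = 1%N \/ q = 2%N -> (q <= r)%N ->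
  (i + k <= r.+1)%N -> matching_pieces q r i k -> approximable (R := R) q r i k.
Proof.
move=> q12 qr ikr [C1 C10 C1P].
have [rho rho0 H] := @fine_from_coarse R q r (i + k) q12 qr ikr.
have [C C0 CP] := H C1 (ltW C10); exists rho => // theta; exists C => //.
move=> delta n z m zt f w zP d0 dr zr _ fm fC fw; have [ztP _] := zr.
have [z0 z1 zinc] := zP.
have w0 j : (j <= n)%N -> 0 <= w j.
  by move=> jn; exact: mod_le_ge0 (neighbours_lt zP jn) (fw j jn).
have fw2 j : (j < n)%N -> mod_le k (derive_on_n `[-1, 1] i f) (z j) (z j.+1) (Num.min (w j) (w j.+1)).
  move=> jn; have h1 : mod_le k (derive_on_n `[-1, 1] i f) (z j) (z j.+1) (w j).
    apply: mod_le_sub (fw j (ltnW jn)); last by rewrite (minn_idPr jn).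
    by rewrite (partition_le zP) ?leq_pred// ltnW.
  have h2 : mod_le k (derive_on_n `[-1, 1] i f) (z j) (z j.+1) (w j.+1).
    apply: mod_le_sub (fw j.+1 jn) => //=.
    by rewrite (partition_le zP) ?geq_minl// leq_min jn leqnSn.
  by case: (leP (w j)).
have z11 j : (j <= n)%N -> -1 <= z j <= 1 := partition_m11 zP.
have /choice[F FP] : forall j, exists F, (j < n)%N ->
  [/\ (size F <= r.+1)%N, forall x, z j <= x <= z j.+1 -> 0 <= F^`(q).[x],
      F.[z j] = f (z j) /\ F.[z j.+1] = f (z j.+1),
      q = 2%N -> derive_on_n `[-1, 1] 1 f (z j) <= F^`().[z j] /\
                 F^`().[z j.+1] <= derive_on_n `[-1, 1] 1 f (z j.+1) &
      forall x, z j <= x <= z j.+1 ->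
        `|f x - F.[x]| <= C1 * ((z j.+1 - z j) ^+ i * Num.min (w j) (w j.+1))].
  move=> j; have [jn|_] := boolP (j < n)%N; last by exists 0.
  have /andP[zl _] := z11 j (ltnW jn); have /andP[_ zr'] := z11 j.+1 jn.
  by have [F FF] := C1P f _ _ _ fm fC zl (zinc j jn) zr' (fw2 j jn); exists F.
have [|||||||p [l [sp kl l0 lE]]] := CP delta n z m zt (fun j => width n z j ^+ i * w j) F f zP d0 dr zr.
- by move=> j /FP[].
- by move=> j x /FP[_ + _ _ _]; apply.
- by move=> j jn; have [_ _ [_ ->]] := FP j (ltnW jn); have [_ _ [->]] := FP j.+1 jn.
- move=> j jn q2; have [_ _ _ /(_ q2)[_ h1] _] := FP j (ltnW jn).
  by have [_ _ _ /(_ q2)[h2 _] _] := FP j.+1 jn; exact: le_trans h1 h2.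
- exact: Cn_cont_on fC (leq0n i).
- move=> j jn; have /andP[zl _] := z11 j.-1 (leq_trans (leq_pred j) jn).
  have /andP[_ zr'] := z11 _ (geq_minl n j.+1).
  by have := mod_le_derive_on (leq0n i) fC zl (neighbours_lt zP jn) zr' (fw j jn); rewrite subn0.
- move=> a j x an ja xa; have [_ _ _ _ /(_ x xa) h] := FP a an; apply: (le_trans h).
  have l0 : 0 <= z a.+1 - z a by rewrite subr_ge0 ltW// zinc.
  have m0 : 0 <= Num.min (w a) (w a.+1) by rewrite le_min !w0// ltnW.
  have jn : (j <= n)%N by case: ja => ->; rewrite // ltnW.
  rewrite ler_pM2l//; apply: ler_pM => //; first exact: exprn_ge0.
    apply: lerXn2r; rewrite ?nnegrE//; first exact/ltW/width_gt0.
    rewrite /width; case: ja jn => -> jn /=.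
      by rewrite (minn_idPr an) lerD2l lerN2 (partition_le zP)// leq_pred.
    by rewrite lerD2r (partition_le zP)// ?geq_minl// leq_min jn leqnSn.
  by case: ja => ->; rewrite ge_min lexx ?orbT.
exists (fun x => p.[x] + spl r l x); split => //.
- exact: is_smooth_spline_spl.
- exact: q_monotone_spl_ge0.
Qed.

Lemma chord_matching r : (0 < r)%N -> matching_pieces 1 r 0 2.
Proof.
move=> r0; have [C C0 CP] := @linear_piece R; exists C => // f a b e /q_monotone1P fm fC a1 ab b1 fe.
exists (chord f a b); split.
- exact: leq_trans (size_chord _ _ _) _.
- move=> x _; rewrite derivn1 deriv_chord hornerC divr_ge0 ?subr_ge0 ?fm// ltW//.
- by rewrite chord_left chord_right.
- by [].
- move=> x xab; rewrite expr0 mul1r; apply: CP => //.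
  exact: cont_on_sub a1 b1 (Cn_cont_on fC (leqnn 0)).
Qed.

Lemma monotone_matching r : (0 < r)%N -> matching_pieces 1 r 1 r.
Proof.
move=> r0; have [C C0 CP] := @monotone_piece R r r0; exists C => // f a b e fm fC a1 ab b1 fe.
have [|||F [sF F0 Fa Fb FE]] := CP f (derive_on_n `[-1, 1] 1 f) a b e ab _ _ _ fe.
- exact: diff_on_sub a1 b1 (Cn_diff_on fC (ltnSn 0)).
- exact: cont_on_sub a1 b1 (Cn_cont_on fC (leqnn 1)).
- move=> x xab; apply: derive_ge0_of_monotone => //; clear -xab a1 b1; lra.
by exists F; split=> // x xab; rewrite derivn1; exact: F0.
Qed.

Lemma convex_matching r : (1 < r)%N -> matching_pieces 2 r 2 r.-1.
Proof.
move=> r1; have r0 : (0 < r.-1)%N by rewrite -subn1 subn_gt0.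
have rE : r.-1.+1 = r by rewrite prednK// ltnW.
have [C C0 CP] := @convex_piece R r.-1 r0; exists C => // f a b e fm fC a1 ab b1 fe.
have [||||F [sF F0 Fab Fs FE]] := CP f (derive_on_n `[-1, 1] 1 f) (derive_on_n `[-1, 1] 2 f) a b e ab _ _ _ _ fe.
- exact: diff_on_sub a1 b1 (Cn_diff_on fC (ltn0Sn 1)).
- exact: diff_on_sub a1 b1 (Cn_diff_on fC (ltnSn 1)).
- exact: cont_on_sub a1 b1 (Cn_cont_on fC (leqnn 2)).
- move=> x xab; apply: derive2_ge0_of_convex => //; clear -xab a1 b1; lra.
by exists F; split=> //; rewrite -rE.
Qed.

End CoarsePieces.

Section QuadraticPieces.
Context {R : realType}.
Implicit Types (p F : {poly R}) (f g s : R -> R) (z zt w : nat -> R) (a b d e u v x y t theta delta C : R) (c i j k m n q r N nu : nat).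

(** ** Convex approximation by quadratic pieces *)

(** The interval around [z j] in the estimate consists of the half cells adjacent to [z j]. *)
Definition bisect z k : R := if odd k then (z k./2 + z k./2.+1) / 2 else z k./2.

Lemma half_ltn n k : (k < n.*2)%N -> (k./2 < n)%N.
Proof. lia. Qed.

Lemma bisectS z k : bisect z k.+1 - bisect z k = (z k./2.+1 - z k./2) / 2.
Proof. by rewrite /bisect /= uphalf_half; case: (odd k); rewrite /= ?add1n ?add0n; field. Qed.

Lemma bisect_lt n z k : is_partition n z -> (k < n.*2)%N -> bisect z k < bisect z k.+1.
Proof.
move=> [_ _ zinc] kn; rewrite -subr_gt0 bisectS divr_gt0// subr_gt0 zinc//.
exact: half_ltn.
Qed.

Lemma bisect_in_cell n z k : is_partition n z -> (k < n.*2)%N ->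
  z k./2 <= bisect z k /\ bisect z k.+1 <= z k./2.+1.
Proof.
move=> [_ _ zinc] kn; have := zinc _ (half_ltn kn).
rewrite /bisect /= uphalf_half; case: (odd k); rewrite /= ?add1n ?add0n; clear; lra.
Qed.

Lemma bisect_pair n z k c : is_partition n z -> (k.+2 <= n.*2)%N -> c = uphalf k \/ c = uphalf k.+1 ->
  [/\ (c <= n)%N, z c.-1 <= bisect z k & bisect z k.+2 <= z (minn n c.+1)].
Proof.
move=> zP kn cE.
have c1 : (c <= n)%N by clear -kn cE; lia.
have [h1 _] := bisect_in_cell zP (ltnW kn : (k < n.*2)%N).
have [_ h2] := bisect_in_cell zP kn.
split=> //.
  by apply: le_trans h1; apply: (partition_le zP); clear -kn cE; lia.
have [ok|ok] := boolP (odd k).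
  by apply: (le_trans h2); apply: (partition_le zP); clear -kn cE ok; lia.
by rewrite /bisect /= negbK (negPf ok) (partition_le zP)//; clear -kn cE ok; lia.
Qed.

Lemma bisect_ratio n z k : is_partition n z -> (k.+2 <= n.*2)%N ->
  let T := 1 + scale n z in
  bisect z k.+2 - bisect z k.+1 <= T * (bisect z k.+1 - bisect z k) /\
  bisect z k.+1 - bisect z k <= T * (bisect z k.+2 - bisect z k.+1).
Proof.
move=> zP kn T; rewrite !bisectS; have [_ _ zinc] := zP.
have k1n : (k./2 < n)%N by clear -kn; lia.
have l1 := zinc _ k1n; have s0 := scale_ge0 n z.
have pos a : 0 <= a -> 0 <= scale n z * a by exact: mulr_ge0.
rewrite /= uphalf_half; have [ok|_] := boolP (odd k); rewrite /= ?add1n ?add0n; last first.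
  by have := pos (z k./2.+1 - z k./2); rewrite /T; clear -l1; lra.
have k2n : (k./2.+1 < n)%N by clear -kn ok; lia.
have l2 := zinc _ k2n.
have [_] := scale_neighbours zP k1n; rewrite (minn_idPr k2n) => h1.
have [h2 _] := scale_neighbours zP k2n; move: h2 => /= h2.
by rewrite /T; clear -h1 h2 l1 l2; lra.
Qed.

(** The breakpoints of the pieces are the middles of the half cells, except that the first and
    the last piece extend to the ends of [-1, 1]. *)
Lemma approximable_quadratic r : (1 < r)%N -> approximable (R := R) 2 r 0 3.
Proof.
move=> r1; have [|rho rho0 H] := @spline_from_pieces R 2 r 3 (or_intror erefl) r1; first by [].
exists (rho / 16) => [|theta]; first by rewrite divr_gt0.
pose T : R := 1 + `|theta|; have T1 : 1 <= T by rewrite /T lerDl.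
have [C1 C10 C1P] := quad_piece_close T1.
have [C C0 CP] := H C1 (ltW C10); exists C => //.
move=> delta n z m zt f w zP d0 dr zr zth fm fC fw; have [ztP _] := zr.
have fc : cont_on (-1) 1 f := Cn_cont_on fC (leqnn 0).
have fconv : chord_convex f by apply/q_monotone2P.
have [z0 z1 zinc] := zP; have n0 := partition_gt0 zP.
have [N nE] : exists N, n.*2 = N.+2 by exists (n.*2 - 2)%N; clear -n0; lia.
pose P := bisect z; pose X k := (P k + P k.+1) / 2.
have Plt k : (k <= N.+1)%N -> P k < P k.+1.
  by move=> kN; apply: (bisect_lt zP); rewrite nE ltnS.
have P0 : P 0%N = -1 by rewrite /P /bisect /= z0.
have PN : P N.+2 = 1 by rewrite /P /bisect -nE odd_double doubleK z1.
have Ple i k : (i <= k)%N -> (k <= N.+2)%N -> P i <= P k.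
  by move=> ik kN; apply: (incr_seq_le (N := N.+2)) => // j jN; exact: Plt.
have P11 k : (k <= N.+2)%N -> -1 <= P k <= 1 by move=> kN; rewrite -P0 -PN !Ple.
pose y k := if k == 0%N then -1 else if (k <= N)%N then X k else 1.
pose mu k := if (0 < k <= N)%N then (P k.+1 - P k) / 4 else 0.
pose E k := w (uphalf k).
pose F k := quad_piece f (P k) (P k.+1) (P k.+2).
have yX k : (0 < k <= N)%N -> y k = X k /\ mu k = (P k.+1 - P k) / 4.
  by move=> kN; rewrite /y /mu kN; case/andP: kN => k0 ->; rewrite gtn_eqF.
have y0 : y 0%N = -1 by [].
have yN : y N.+1 = 1 by rewrite /y /= ltnn.
have mu00 : mu 0%N = 0 by [].
have muN : mu N.+1 = 0 by rewrite /mu /= ltnn.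
have yr k : (k <= N)%N -> y k + mu k <= P k.+1 /\ ((0 < k)%N -> y k + mu k < P k.+1).
  case: k => [|k] kN.
    by rewrite y0 mu00 addr0 -P0; split=> //; apply: Ple.
  have [-> ->] := yX k.+1 kN; have lt := Plt k.+1 (leqW kN).
  by rewrite /X; clear -lt; split=> [|_]; lra.
have yl k : (k <= N)%N -> P k.+1 <= y k.+1 - mu k.+1 /\ ((k < N)%N -> P k.+1 < y k.+1 - mu k.+1).
  rewrite leq_eqVlt => /orP[/eqP->|kN].
    by rewrite yN muN subr0 -PN ltnn; split=> //; apply: Ple.
  have [-> ->] := yX k.+1 kN; have lt := Plt k.+1 (leqW kN).
  by rewrite /X; clear -lt; split=> [|_]; lra.
have mu0 k : 0 <= mu k.
  rewrite /mu; case: ifP => // /andP[_ kN]; rewrite divr_ge0// subr_ge0 ltW// Plt//.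
  exact: leqW.
have yl' k : (k <= N.+1)%N -> P k <= y k.
  case: k => [|k] kN; first by rewrite P0.
  by have [h _] := yl k kN; have := mu0 k.+1; clear -h; lra.
have yr' k : (k <= N)%N -> y k < P k.+1.
  case: k => [|k] kN; first by rewrite y0 -P0 Plt.
  by have [_ /(_ isT) h] := yr k.+1 kN; have := mu0 k.+1; clear -h; lra.
have kn2 k : (k <= N)%N -> (k.+2 <= n.*2)%N by rewrite nE.
have props k (kN : (k <= N)%N) := quad_piece_props fconv (proj1 (andP (P11 k (leqW (leqW kN)))))
  (Plt k (leqW kN)) (Plt k.+1 kN) (proj2 (andP (P11 k.+2 kN))).
have close k c x : (k <= N)%N -> c = uphalf k \/ c = uphalf k.+1 -> P k <= x <= P k.+2 ->
    `|f x - (F k).[x]| <= C1 * w c.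
  move=> kN cE xk; have [cn h1 h2] := bisect_pair zP (kn2 k kN) cE.
  have [r1' r2'] := bisect_ratio zP (kn2 k kN).
  have sT : 1 + scale n z <= T by rewrite lerD2l (le_trans zth)// ler_norm.
  have l1 := Plt k (leqW kN); have l2 := Plt k.+1 kN.
  apply: C1P xk => //.
  - by apply: le_trans r1' _; rewrite ler_wpM2r// subr_ge0 ltW.
  - by apply: le_trans r2' _; rewrite ler_wpM2r// subr_ge0 ltW.
  - have /andP[a1 _] := P11 k (leqW (leqW kN)); have /andP[_ a2] := P11 k.+2 kN.
    exact: cont_on_sub a1 a2 fc.
  - exact: mod_le_sub h1 h2 (fw c cn).
have w0 j : (j <= n)%N -> 0 <= w j.
  by move=> jn; exact: mod_le_ge0 (neighbours_lt zP jn) (fw j jn).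
have [|||||||||||||l [kl l0 lE]] := CP (knot_of m zt) N y mu E F f.
- by move=> k kN; apply: (lt_le_trans (yr' k kN)); exact: yl'.
- exact: mu0.
- by move=> k kN; have [_ ->] := yX k.+1 kN; rewrite divr_gt0// subr_gt0 Plt// leqW.
- by move=> k kN; apply: le_trans (proj1 (yr k kN)) (proj1 (yl k kN)).
- move=> k kN u v u1 uv v1 uvr; have [_ muE] := yX k.+1 kN.
  have k2n : (k.+1 < n.*2)%N by rewrite nE ltnS leqW// ltnW.
  have [h1 h2] := bisect_in_cell zP k2n.
  have [_ /(_ kN) h3] := yl k (ltnW kN); have [_ /(_ isT) h4] := yr k.+1 kN.
  have /andP[a1 _] := P11 k.+1 (leqW (leqW kN)); have /andP[_ a2] := P11 k.+2 (leqW kN).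
  have l0 : 0 < z (k.+1)./2.+1 - z (k.+1)./2 by rewrite subr_gt0 zinc// half_ltn.
  apply: (remesh_knot zP d0 zr (half_ltn k2n)) => //.
  + by clear -h3 u1 a1; lra.
  + by clear -h4 v1 a2; lra.
  + by apply: le_lt_trans h1 _; clear -h3 u1 uv; rewrite /P in h3; lra.
  + by apply: lt_le_trans h2; clear -h4 v1 uv; rewrite /P in h4; lra.
  + constructor 1; apply: lt_le_trans uvr; rewrite muE /P bisectS.
    apply: (le_lt_trans (ler_wpM2r (ltW l0) dr)).
    have := mulr_gt0 rho0 l0; clear; lra.
- by move=> k kN; apply: leq_trans (size_quad_piece _ _ _ _) _.
- by move=> k x kN _; have [_ _ + _ _] := props k kN; apply.
- move=> k kN; have [-> _] := yX k.+1 kN.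
  by have [_ -> _ _ _] := props k (ltnW kN); have [-> _ _ _ _] := props k.+1 kN.
- move=> k kN _; have [-> _] := yX k.+1 kN.
  have [_ _ _ _ h1] := props k (ltnW kN); have [_ _ _ h2 _] := props k.+1 kN.
  exact: le_trans h1 h2.
- by rewrite y0 yN.
- move=> k kN; have [cn h1 h2] := bisect_pair zP (kn2 k (ltnW kN)) (or_intror erefl).
  have [h3 _] := yl k (ltnW kN); have [h4 _] := yr k.+1 kN.
  apply: mod_le_sub (fw _ cn); [rewrite (le_trans h1)// (le_trans (ltW (Plt k (leqW (ltnW kN)))))//; exact: h3|].
  by apply: le_trans h2; exact: h4.
- move=> k x kN xk; apply: close (ltnW kN) (or_intror erefl) _.
  have [h3 _] := yl k (ltnW kN); have := yr' k.+1 kN; have := Plt k (leqW (ltnW kN)).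
  by clear -h3 xk; lra.
- move=> k x kN xk; have [h4 _] := yr k.+1 kN; have h5 := yl' k.+1 (leqW kN).
  by apply: (close k.+1) => //; [left|have := Plt k.+2 kN; clear -h4 h5 xk; lra].
exists (fun x => (F 0%N).[x] + spl r l x); split.
- apply: is_smooth_spline_spl => //; first exact: leq_trans (size_quad_piece _ _ _ _) _.
  by move=> c /kl[].
- by apply: q_monotone_spl_ge0 => //; [right|move=> x x1; apply: l0; rewrite y0 yN].
move=> j x jn xj; rewrite expr0 mul1r; have x1 := half_cells_m11 zP jn xj.
have wj0 := w0 j jn.
have [k [kN kj xk]] : exists k, [/\ (k <= N.+1)%N, uphalf k = j & P k <= x <= P k.+1].
  have PE i : (i <= n)%N -> P i.*2 = z i by rewrite /P /bisect odd_double doubleK.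
  have PO i : P i.*2.+1 = (z i + z i.+1) / 2.
    by rewrite /P /bisect /= odd_double /= uphalf_double.
  have /andP[xl xr] := xj.
  have [xz|zx] := leP x (z j); last first.
    have jn' : (j < n)%N.
      rewrite ltn_neqAle jn andbT; apply/eqP => jE; move: xr zx.
      by rewrite jE (minn_idPl (leqnSn n)); clear; lra.
    exists j.*2; rewrite uphalf_double PE// PO (ltW zx) -(minn_idPr jn') xr.
    by split=> //; clear -nE jn'; lia.
  case: j jn xj wj0 xl xr xz => [|j] jn xj wj0 xl xr xz.
    exists 0%N; split=> //; rewrite P0; have lt := Plt 0%N isT; rewrite P0 in lt.
    by rewrite z0 in xz xl; clear -lt xz xl; simpl in *; lra.
  exists j.*2.+1; rewrite /= doubleK PO -doubleS PE// xl xz.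
  by split=> //; clear -nE jn; lia.
have [xX|Xx] := leP x (X k).
  case: k kN kj xk xX => [|k] kN kj xk xX.
    (* the left half of the first half cell *)
    have lt := Plt 0%N isT; have xP : x < P 1%N by move: xX; rewrite /X; clear -lt; lra.
    apply: (lE 0%N) => //.
    + rewrite y0 -P0; have := yl' 1%N isT; clear -xk xP; lra.
    + apply: close => //; first by left.
      by have := Ple 1%N 2 isT isT; clear -xk; lra.
    + by move=> N0; have [_ /(_ N0)] := yl 0%N isT; clear -xP; lra.
  have kN' : (k <= N)%N by [].
  apply: (lE k) => //.
  + have /andP[xk1 _] := xk; rewrite (le_trans (ltW (yr' k kN')) xk1)/=.
    move: kN'; rewrite leq_eqVlt => /orP[/eqP->|kN2]; first by rewrite yN; have /andP[_] := x1.
    by have [-> _] := yX k.+1 kN2.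
  + apply: close => //; first by right.
    by have := Plt k (leqW kN'); clear -xk; lra.
  + by move=> k0; have [_ /(_ k0)] := yr k kN'; clear -xk; lra.
  + by rewrite /E kj.
move: kN; rewrite leq_eqVlt => /orP[/eqP kE|kN].
  (* the right half of the last half cell *)
  apply: (lE N) => //.
  + have /andP[xk1 _] := xk; have /andP[_ x2] := x1.
    by rewrite yN x2 andbT (le_trans (ltW (yr' N (leqnn N))))// -kE.
  + apply: close => //; [by right; rewrite -kE kj|].
    by have := Plt N (leqnSn N); rewrite -kE; clear -xk; lra.
  + by move=> N0; have [_ /(_ N0)] := yr N (leqnn N); rewrite -kE; clear -xk; lra.
  + by rewrite ltnn.
apply: (lE k) => //.
+ have := yl' k.+1 kN; have /andP[_ xk2] := xk; move=> h; rewrite (le_trans xk2 h) andbT.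
  have [k0|k0] := posnP k; first by rewrite k0 y0; have /andP[] := x1.
  have [-> _] := yX k (ltac:(by rewrite k0 -ltnS)).
  exact: ltW.
+ apply: close => //; first by left.
  by have := Plt k.+1 kN; clear -xk; lra.
+ by rewrite /E kj.
+ by move=> kN2; have [_ /(_ kN2)] := yl k kN; clear -xk; lra.
Qed.

End QuadraticPieces.

Section Jackson.
Context {R : realType}.
Implicit Types (p F : {poly R}) (f g s : R -> R) (z zt w : nat -> R) (a b d e u v x y t theta rho delta C : R) (c i j k m n q r N nu : nat).

(** ** The estimate in terms of a modulus of the highest derivative *)

(** Every larger constant [b] is admitted, so that several constants can be replaced by their
    maximum. *)
Definition jackson rho q r k nu := forall theta, exists2 C : R, 0 < C &
  forall delta n z m zt f b, is_partition n z -> 0 < delta -> delta <= rho ->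
    is_remesh delta n z m zt -> scale n z <= theta -> q_monotone q f -> Cn `[-1, 1] nu f -> C <= b ->
    exists s, [/\ is_smooth_spline r m zt s, q_monotone q s & local_estimate k nu n z b f s].

Lemma jackson_of_approximable q r i m : approximable (R := R) q r i m -> exists2 rho, 0 < rho &
  forall rho' k nu, rho' <= rho -> (i <= nu)%N -> (nu - i + k <= m)%N -> jackson rho' q r k nu.
Proof.
move=> [rho rho0 H]; exists rho => // rho' k nu rr inu dm theta; have [C C0 CP] := H theta.
set d := (nu - i + k)%N in dm; pose D := C * 2 ^+ (m - d).
have D0 : 0 < D by rewrite mulr_gt0// exprn_gt0.
have t1 : 0 < 1 + `|theta| by rewrite ltr_pwDl.
exists (D * (1 + `|theta|) ^+ nu); first by rewrite mulr_gt0// exprn_gt0.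
move=> delta n z m' zt f b zP d0 dr zr zth fm fC Cb.
have [w [fw est]] := local_estimate_of_pointwise k zP fC.
have [|s [ss sm sf]] := CP delta n z m' zt f
    (fun j => 2 ^+ (m - d) * (width n z j ^+ (nu - i) * w j)) zP d0 (le_trans dr rr) zr zth fm (Cn_sub fC inu).
  move=> j jn; have /andP[zl _] := partition_m11 zP (leq_trans (leq_pred j) jn).
  have /andP[_ zr'] := partition_m11 zP (geq_minl n j.+1).
  have := mod_le_derive_on inu fC zl (neighbours_lt zP jn) zr' (fw j jn).
  by move=> /(mod_le_addn (m := m - d)); rewrite subnK.
exists s; split=> //; apply: (est D) => //; first exact: ltW.
  apply: le_trans Cb; rewrite ler_pM2l//; apply: lerXn2r; rewrite ?nnegrE ?addr_ge0 ?scale_ge0//.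
  by rewrite lerD2l (le_trans zth)// ler_norm.
move=> j x jn xj; apply: le_trans (sf j x jn xj) _.
have -> : width n z j ^+ nu = width n z j ^+ (nu - i) * width n z j ^+ i by rewrite -exprD subnK.
by rewrite le_eqVlt; apply/orP; left; apply/eqP; rewrite /D; ring.
Qed.

(** Low orders are handled through moduli of [f] itself; otherwise [f] has a [q]-th derivative,
    and its modulus of order [r - q + 1] controls the pieces. *)
Lemma jackson_admissible q r : q = 1%N \/ q = 2%N -> exists2 rho, 0 < rho &
  forall rho' k nu, rho' <= rho -> admissible q k nu -> (k + nu - 1 <= r)%N -> jackson rho' q r k nu.
Proof.
rewrite /admissible; case=> ->.
- have [->|r0] := posnP r.
    have [rho rho0 H] := jackson_of_approximable (@approximable_step R).
    by exists rho => // rho' k nu rr kn kr; apply: H => //; clear -kn kr; lia.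
  have [rho1 rho10 H1] := jackson_of_approximable
    (@approximable_of_matching_pieces R 1 r 0 2 (or_introl erefl) r0 r0 (@chord_matching R r r0)).
  have [rho2 rho20 H2] := jackson_of_approximable
    (@approximable_of_matching_pieces R 1 r 1 r (or_introl erefl) r0 (leqnn _) (@monotone_matching R r r0)).
  exists (Num.min rho1 rho2) => [|rho' k nu + kn kr]; first by rewrite lt_min rho10.
  rewrite le_min => /andP[rr1 rr2].
  have [kn2|kn2] := leqP (k + nu) 2.
    by apply: H1 => //; clear -kn2; lia.
  by apply: H2 => //; clear -kn kn2 kr; lia.
- have [r1|r1] := leqP r 1.
    have [rho rho0 H] := jackson_of_approximable (@approximable_polygon R).
    exists rho => // rho' k nu rr kn kr; have -> : r = 1%N by clear -kn kr r1; lia.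
    by apply: H => //; clear -kn kr r1; lia.
  have [rho1 rho10 H1] := jackson_of_approximable (@approximable_quadratic R r r1).
  have r2 : (2 + r.-1 <= r.+1)%N by clear -r1; lia.
  have [rho2 rho20 H2] := jackson_of_approximable
    (@approximable_of_matching_pieces R 2 r 2 r.-1 (or_intror erefl) r1 r2 (@convex_matching R r r1)).
  exists (Num.min rho1 rho2) => [|rho' k nu + kn kr]; first by rewrite lt_min rho10.
  rewrite le_min => /andP[rr1 rr2].
  have [kn2|kn2] := leqP (k + nu) 3.
    by apply: H1 => //; clear -kn2; lia.
  by apply: H2 => //; clear -kn kn2 kr; lia.
Qed.

(** One density and one constant serve both values of [q]. *)
Lemma shape_preserving_estimate :
  exists (delta : nat -> R) (C : nat -> nat -> nat -> R -> R),
    [/\ (forall r : nat, 0 < delta r),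
        (forall (k nu r : nat) (theta : R), 0 < C k nu r theta) &
        forall q k nu : nat, q = 1%N \/ q = 2%N -> admissible q k nu ->
        forall r : nat, (k + nu - 1 <= r)%N ->
        forall (n : nat) (z : nat -> R), is_partition n z ->
        forall (m : nat) (zt : nat -> R), is_remesh (delta r) n z m zt ->
        forall f : R -> R, q_monotone q f -> Cn `[-1, 1] nu f ->
        exists s : R -> R,
          [/\ is_smooth_spline r m zt s, q_monotone q s &
              local_estimate k nu n z (C k nu r (scale n z)) f s]].
Proof.
have /choice[delta dP] : forall r, exists rho, 0 < rho /\ forall q k nu, q = 1%N \/ q = 2%N ->
    admissible q k nu -> (k + nu - 1 <= r)%N -> jackson rho q r k nu.
  move=> r; have [rho1 rho10 H1] := jackson_admissible r (or_introl erefl).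
  have [rho2 rho20 H2] := jackson_admissible r (or_intror erefl).
  exists (Num.min rho1 rho2); split=> [|q k nu]; first by rewrite lt_min rho10.
  by case=> -> kn kr; [apply: H1|apply: H2]; rewrite // ge_min lexx ?orbT.
pose ok k nu r theta C := forall q, q = 1%N \/ q = 2%N -> admissible q k nu -> (k + nu - 1 <= r)%N ->
  forall n z m zt f, is_partition n z -> is_remesh (delta r) n z m zt -> scale n z <= theta ->
  q_monotone q f -> Cn `[-1, 1] nu f ->
  exists s, [/\ is_smooth_spline r m zt s, q_monotone q s & local_estimate k nu n z C f s].
have /choice[C CP] : forall u : nat * nat * nat * R,
    exists C : R, 0 < C /\ ok u.1.1.1 u.1.1.2 u.1.2 u.2 C.
  move=> [[[k nu] r] theta] /=.
  have one q : q = 1%N \/ q = 2%N -> exists2 C : R, 0 < C & admissible q k nu -> (k + nu - 1 <= r)%N ->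
      forall n z m zt f b, is_partition n z -> is_remesh (delta r) n z m zt -> scale n z <= theta ->
      q_monotone q f -> Cn `[-1, 1] nu f -> C <= b ->
      exists s, [/\ is_smooth_spline r m zt s, q_monotone q s & local_estimate k nu n z b f s].
    move=> q12; have [d0 H] := dP r; have [kn|kn] := pselect (admissible q k nu); last by exists 1.
    have [kr|kr] := boolP (k + nu - 1 <= r)%N; last by exists 1.
    have [C C0 CP] := H q k nu q12 kn kr theta; exists C => // _ _ n z m zt f b zP zr zth.
    exact: CP zr zth.
  have [C1 C10 H1] := one 1%N (or_introl erefl); have [C2 C20 H2] := one 2%N (or_intror erefl).
  exists (Num.max C1 C2); split=> [|q]; first by rewrite lt_max C10.
  by case=> -> kn kr n z m zt f zP zr zth fm fC; [apply: H1|apply: H2]; rewrite // le_max lexx ?orbT.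
exists delta, (fun k nu r theta => C (k, nu, r, theta)); split.
- by move=> r; have [] := dP r.
- by move=> k nu r theta; have [] := CP (k, nu, r, theta).
- move=> q k nu q12 kn r kr n z zP m zt zr f fm fC.
  by have [_ H] := CP (k, nu, r, scale n z); apply: (H q).
Qed.

End Jackson.

(** * Functions that cannot be approximated *)
Section Counterexample.
Context {R : realType}.
Implicit Types (p P Q F : {poly R}) (f g s : R -> R) (z zt : nat -> R) (a b c d e t u v w x y M C D delta : R)
  (i j k m n q r nu : nat).

Lemma derivn_growth n : exists2 C : R, 0 < C & forall p a b M i, (size p <= n)%N -> a < b ->
  (forall x, a <= x <= b -> `|p.[x]| <= M) ->
  forall x, a - (b - a) <= x <= b + (b - a) -> `|p^`(i).[x]| <= C * (C / (b - a)) ^+ i * M.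
Proof.
have [C C0 CP] := @poly_growth R n; exists C => // p a b M i sp ab pM.
have ba0 : 0 < b - a by rewrite subr_gt0.
elim: i => [|i IH] x xab.
  by rewrite derivn0 expr0 mulr1; have [] := CP p a b M sp ab pM x xab.
have sp' : (size p^`(i) <= n)%N by rewrite (leq_trans (size_derivn_le i sp))// leq_subr.
have [|_] := CP p^`(i) a b (C * (C / (b - a)) ^+ i * M) sp' ab _ x xab.
  by move=> t tab; apply: IH; clear -tab ba0; lra.
rewrite -ler_pdivlMr// derivnS => h; apply: (le_trans h).
by rewrite le_eqVlt exprS; apply/orP; left; apply/eqP; ring.
Qed.

(** By the mean value theorem, a negative [q]-th derivative would make divided differences
    negative. *)
Lemma q_monotone_poly q f p a b : q = 1%N \/ q = 2%N -> q_monotone q f -> -1 <= a -> a < b -> b <= 1 ->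
  (forall x, a < x < b -> f x = p.[x]) -> exists2 x, a < x < b & 0 <= p^`(q).[x].
Proof.
move=> q12 fm a1 ab b1 fp.
have mv (P : {poly R}) u v : u < v -> exists2 x, u < x < v & P.[v] - P.[u] = P^`().[x] * (v - u).
  by move=> uv; exact: mean_value uv (diff_on_poly u v P).
pose x i := a + (b - a) * (i%:R / 4).
have xE i : x i = a + (b - a) * (i%:R / 4) by [].
clearbody x.
have [x1 x2 x3] : [/\ x 1%N = a + (b - a) / 4, x 2%N = a + (b - a) / 2 & x 3%N = a + (b - a) * 3 / 4].
  by rewrite !xE; split; field.
case: q12 fm => -> fm.
  have /q_monotone1P/(_ (x 1%N) (x 2%N)) := fm; rewrite !fp; [|rewrite ?x1 ?x2; clear -ab; lra..].
  have [|c cx cE] := mv p (x 1%N) (x 2%N); first by rewrite x1 x2; clear -ab; lra.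
  move=> h; exists c; first by move: cx; rewrite x1 x2; clear -ab; lra.
  rewrite derivn1 -(pmulr_lge0 _ (_ : 0 < x 2%N - x 1%N)) -?cE ?subr_ge0 ?h//.
    by rewrite x1; clear -a1 ab; lra.
  by rewrite x1 x2; clear -ab; lra.
  by rewrite x2; clear -b1 ab; lra.
  by rewrite subr_gt0 x1 x2; clear -ab; lra.
have /q_monotone2P/(_ (x 1%N) (x 2%N) (x 3%N)) := fm; rewrite !fp; [|rewrite ?x1 ?x2 ?x3; clear -ab; lra..].
have [x12 x23] : x 1%N < x 2%N /\ x 2%N < x 3%N by rewrite x1 x2 x3; clear -ab; lra.
have [c cx ->] := mv p _ _ x12; have [d dx ->] := mv p _ _ x23.
move=> h; have {h} cd : p^`().[c] <= p^`().[d].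
  have h1 : 0 < x 2%N - x 1%N by rewrite subr_gt0.
  have h2 : 0 < x 3%N - x 2%N by rewrite subr_gt0.
  rewrite -(ler_pM2r h1) -(ler_pM2r h2) [leRHS]mulrAC; apply: h => //.
    by rewrite x1; clear -a1 ab; lra.
  by rewrite x3; clear -b1 ab; lra.
have lt : c < d by clear -cx dx; lra.
have [e ex eE] := mv p^`() _ _ lt; exists e.
  by move: ex cx dx; rewrite x1 x2 x3; clear -ab; lra.
by rewrite derivnS derivn1 -(pmulr_lge0 _ (_ : 0 < d - c)) -?eE ?subr_ge0 ?subr_gt0.
Qed.

(** The weight turns the truncated power of degree [q + 1] into [(x + 1 - b)_+^(q + 1)]. *)
Definition corner q b : seq (R * R) := [:: (q.+1`!%:R, -1 + b)].

Lemma spl_corner n q b x : spl n (corner q b) x = q.+1`!%:R * tpow n (x - (-1 + b)).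
Proof. by rewrite /spl big_seq1. Qed.

Lemma right_poly_corner n q b x : (right_poly n (corner q b)).[x] = q.+1`!%:R / n`!%:R * (x - (-1 + b)) ^+ n.
Proof. by rewrite /right_poly big_seq1 hornerZ horner_exp hornerXsubC. Qed.

Lemma spl_corner_right n q b x : -1 + b <= x -> spl n (corner q b) x = (right_poly n (corner q b)).[x].
Proof. by move=> bx; apply: spl_right => c; rewrite inE => /eqP->. Qed.

Lemma spl_corner_close n q b x : (1 < n)%N -> 0 < b -> b <= 1 -> -1 <= x ->
  `|spl n (corner q b) x - (right_poly n (corner q b)).[x]| <= q.+1`!%:R * b ^+ 2.
Proof.
move=> n1 b0 b1 x1; have K0 : 0 <= q.+1`!%:R :> R by [].
have B0 : 0 <= q.+1`!%:R * b ^+ 2 by rewrite mulr_ge0 ?exprn_ge0// ltW.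
have [bx|xb] := leP (-1 + b) x; first by rewrite spl_corner_right// subrr normr0.
rewrite spl_left; last by move=> c; rewrite inE => /eqP->.
rewrite sub0r normrN right_poly_corner normrM ler_pM//.
  rewrite ger0_norm ?divr_ge0// ler_pdivrMr ?ltr0n ?fact_gt0//.
  by rewrite ler_peMr// ler1n fact_gt0.
rewrite normrX; apply: (@le_trans _ _ (b ^+ n)).
  apply: lerXn2r; rewrite ?nnegrE ?(ltW b0)// ler_norml.
  by clear -xb x1 b0; lra.
by apply: ler_wiXn2l => //; exact: ltW.
Qed.

Definition ramp q b : R -> R := fun x => (0 : {poly R}).[x] + spl q.+1 (corner q b) x.

Lemma ramp_smooth q b : Cn `[-1, 1] q (ramp q b).
Proof. by have [] := Cn_spl q 0 (corner q b). Qed.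

Lemma ramp_monotone q b : q = 1%N \/ q = 2%N -> q_monotone q (ramp q b).
Proof.
move=> q12; apply: q_monotone_spl_ge0 => // x _.
rewrite linear0 spl_corner addr_ge0// ?horner0// mulr_ge0// /tpow; case: ifP => // h.
by rewrite divr_ge0// exprn_ge0.
Qed.

(** Up to a perturbation of order [b^2], the [nu]-th derivative is a polynomial of degree less
    than [k]. *)
Lemma ramp_modulus k nu q b v (g := derive_on_n `[-1, 1] nu (ramp q b)) :
  (nu < q)%N -> (q.+2 <= k + nu)%N -> 0 < b -> b <= 1 -> v <= 1 ->
  (omega k g (-1)%R v <= (2 ^+ k * (q.+1`!%:R * b ^+ 2))%:E)%E.
Proof.
move=> nuq kq b0 b1 v1; set B := q.+1`!%:R * b ^+ 2.
have B0 : 0 <= B by rewrite mulr_ge0// exprn_ge0// ltW.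
apply: omega_le => [|h x h0 x1 xv]; first by rewrite mulr_ge0// exprn_ge0.
pose Q := right_poly (q.+1 - nu) (corner q b).
have sQ : (size Q <= k)%N by rewrite (leq_trans (size_right_poly _ _))//; clear -nuq kq; lia.
have kh : 0 <= k%:R * h by rewrite mulr_ge0// ltW.
have Q0 : fdiff h k (horner Q) x = 0.
  apply/eqP; rewrite -normr_le0.
  apply: (@mod_le_poly R k Q x (x + k%:R * h + 1) _ sQ h x h0) => //; clear -kh; lra.
rewrite -[fdiff _ _ _ _]subr0 -Q0 -fdiffB; apply: fdiff_le => i ik.
have ih : 0 <= i%:R * h by rewrite mulr_ge0// ltW.
have ihk : i%:R * h <= k%:R * h by rewrite ler_pM2r// ler_nat.
have [_ E] := Cn_spl q 0 (corner q b); rewrite /g /ramp E ?(ltnW nuq)//; last first.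
  by clear -ih ihk x1 xv v1; lra.
rewrite linear0 horner0 add0r; apply: spl_corner_close => //; first by clear -nuq; lia.
by clear -ih x1; lra.
Qed.

(** Near -1 the spline is a polynomial [sp]. On an interval that does not shrink with [b] it is
    within [D b ^ 2] of the polynomial [P] that the ramp follows to the right of its corner;
    so the [q]-th derivatives of [sp] and [P] differ by at most a multiple of [b ^ 2] on the whole
    neighbourhood of -1. But that of [P] is at most [- b / 2] at distances up to [b / 2] from
    -1, and [sp] would not be [q]-monotone for small [b]. *)
Lemma not_approximable q k nu r n z delta m zt c : q = 1%N \/ q = 2%N -> (nu < q)%N -> (q.+2 <= k + nu)%N ->
  is_partition n z -> is_remesh delta n z m zt ->
  exists b, ~ exists s,
    [/\ is_smooth_spline r m zt s, q_monotone q s & local_estimate k nu n z c (ramp q b) s].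
Proof.
move=> q12 nuq kq zP [ztP _]; have n0 := partition_gt0 zP; have m0 := partition_gt0 ztP.
have [z0 z1 zinc] := zP; have [zt0 zt1 ztinc] := ztP.
have zl := zinc 0%N n0; have ztl := ztinc 0%N m0; rewrite z0 in zl; rewrite zt0 in ztl.
pose a := Num.min (zt 1%N) ((-1 + z 1%N) / 2).
have a1 : -1 < a by rewrite lt_min ztl; clear -zl; lra.
have azt : a <= zt 1%N by rewrite ge_min lexx.
have az : a <= (-1 + z 1%N) / 2 by rewrite ge_min lexx orbT.
clearbody a.
have z11 : z 1%N <= 1 by have /andP[] := partition_m11 zP n0.
pose eta := (a + 1) / 3; have eta0 : 0 < eta by rewrite /eta; clear -a1; lra.
pose u := -1 + eta; pose v := -1 + 2 * eta.
have uv : u < v by rewrite /u /v; clear -eta0; lra.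
have va : v < a by rewrite /v /eta; clear -a1; lra.
pose S := maxn r.+1 q.+2.
have [C C0 CP] := derivn_growth S.
pose K := 2 ^+ k * q.+1`!%:R : R; have K0 : 0 <= K by rewrite mulr_ge0// exprn_ge0.
pose D : R := `|c| * (z 1%N - z 0%N) ^+ nu * K.
have D0 : 0 <= D by rewrite !mulr_ge0// exprn_ge0// subr_ge0 z0 ltW.
pose G := C * (C / (v - u)) ^+ q * D.
have G0 : 0 <= G.
  have vu0 : 0 <= v - u by rewrite subr_ge0 ltW.
  by rewrite /G mulr_ge0// mulr_ge0 ?exprn_ge0 ?divr_ge0// ltW.
pose b := Num.min (Num.min eta 1) (1 / (2 * G + 1)).
have b0 : 0 < b by rewrite !lt_min eta0 ltr01 divr_gt0// ltr_wpDl// mulr_ge0.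
have [be b1 bG] : [/\ b <= eta, b <= 1 & b <= 1 / (2 * G + 1)] by rewrite !ge_min !lexx !orbT.
clearbody b; exists b => -[s [[ss _] sm est]].
have [sp ssp sE] := ss 0%N m0; rewrite zt0 in sE.
pose P := right_poly q.+1 (corner q b).
have sP : (size (P - sp)%R <= S)%N.
  rewrite (leq_trans (size_polyD _ _))// size_polyN geq_max !leq_max ssp orTb andbT.
  by rewrite size_right_poly orbT.
have fP x : -1 + b <= x -> ramp q b x = P.[x].
  by move=> bx; rewrite /ramp horner0 add0r spl_corner_right.
have close x : u <= x <= v -> `|(P - sp).[x]| <= D * b ^+ 2.
  move=> xuv; rewrite hornerB -fP; last by clear -xuv be; rewrite /u in xuv; lra.
  have xs y : u <= y <= v -> s y = sp.[y].
    by move=> yuv; apply: sE; clear -yuv eta0 va azt; rewrite /u in yuv; lra.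
  have fc : cont_on u v (fun y => ramp q b y - s y).
    apply: (@cont_on_eq _ _ _ (horner (P - sp))); last exact: cont_on_poly.
    by move=> y yuv; rewrite hornerB xs// fP//; clear -yuv be; rewrite /u in yuv; lra.
  have uvJ y : u <= y <= v -> I_set n z 0%:Z y.
    rewrite /I_set (knotP z (leq0n n)) knotS (minn_idPr n0) /= in_itv /= /knot minn0 z0 => yuv.
    by clear -yuv va az eta0; rewrite /u in yuv; lra.
  suff H : (Linfty_norm (I_set n z 0%:Z) (fun y => (ramp q b y - s y)%R) <= (D * b ^+ 2)%:E)%E.
    by rewrite -xs//; exact: Linfty_norm_point H uv uvJ fc xuv.
  have := est 0%N (leq0n n); cbv zeta; rewrite (knotP z (leq0n n)) knotS (minn_idPr n0) min0n J_len_nat// z0.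
  move=> /le_trans; apply.
  pose g := derive_on_n `[-1, 1] nu (ramp q b); rewrite -/g.
  have om := ramp_modulus nuq kq b0 b1 z11; cbv zeta in om; rewrite -/g in om.
  have om0 := omega_ge0 k g zl.
  have L0 : 0 <= (z 1%N - -1) ^+ nu by rewrite exprn_ge0// subr_ge0 ltW.
  apply: (@le_trans _ _ ((`|c| * (z 1%N - -1) ^+ nu)%:E * (2 ^+ k * (q.+1`!%:R * b ^+ 2))%:E)%E).
    apply: (@le_trans _ _ ((`|c| * (z 1%N - -1) ^+ nu)%:E * omega k g (-1)%R (z 1%N))%E).
      by apply: lee_wpmul2r => //; rewrite lee_fin ler_wpM2r// ler_norm.
    by apply: lee_wpmul2l => //; rewrite lee_fin mulr_ge0.
  by rewrite -EFinM lee_fin /D /K z0 !mulrA.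
have [x xb p0] := @q_monotone_poly q s sp (-1) (-1 + b / 2) q12 sm (lexx _)
  (ltac:(clear -b0; lra)) (ltac:(clear -b1; lra))
  (fun x xb => sE x (ltac:(clear -xb be azt a1 b0; rewrite /eta in be; lra))).
have /andP[x1 x2] := xb.
have := CP (P - sp) u v (D * b ^+ 2) q sP uv close x.
have -> : u - (v - u) = -1 by rewrite /u /v; ring.
have xv : -1 <= x <= v + (v - u) by rewrite /v /u; clear -x1 x2 be eta0 b0; lra.
move=> /(_ xv); rewrite mulrA -/G derivnB hornerB => h.
have P'E : P^`(q).[x] = q.+1`!%:R * (x - (-1 + b)).
  by rewrite /P derivn_right_poly// subSn// subnn right_poly_corner divr1 expr1.
have fq : 1 <= q.+1`!%:R :> R by rewrite ler1n fact_gt0.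
have P'le : P^`(q).[x] <= - (b / 2).
  rewrite P'E -lerN2 opprK -mulrN; apply: (@le_trans _ _ (- (x - (-1 + b)))).
    by clear -x2; lra.
  by rewrite ler_peMl//; clear -x2 b0; lra.
have : b * (2 * G + 1) <= 1 by rewrite -ler_pdivlMr//; clear -G0; lra.
rewrite -(ler_pM2l b0) mulr1 => h2; have b20 : 0 < b ^+ 2 by rewrite exprn_gt0.
move: h; rewrite ler_norml => /andP[h3 _].
have h4 : 2 * (G * b ^+ 2) + b ^+ 2 <= b by apply: le_trans h2; rewrite le_eqVlt; apply/orP; left; apply/eqP; ring.
by clear -h3 h4 b20 P'le p0; lra.
Qed.

End Counterexample.

Unset Implicit Arguments.

Theorem corollary2p2 (R : realType) :
  (exists (delta : nat -> R) (c : nat -> nat -> nat -> R -> R),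
    [/\ (forall r : nat, 0 < delta r),
        (forall (k nu r : nat) (theta : R), 0 < c k nu r theta) &
        forall q k nu : nat, q = 1%N \/ q = 2%N -> admissible q k nu ->
        forall r : nat, (k + nu - 1 <= r)%N ->
        forall (n : nat) (z : nat -> R), is_partition n z ->
        forall (m : nat) (zt : nat -> R), is_remesh (delta r) n z m zt ->
        forall f : R -> R, q_monotone q f -> Cn `[-1, 1] nu f ->
        exists s : R -> R,
          [/\ is_smooth_spline r m zt s, q_monotone q s &
              local_estimate k nu n z (c k nu r (scale n z)) f s]])
  /\
  (forall q k nu : nat, q = 1%N \/ q = 2%N ->
   (q <= k + nu)%N -> ~ admissible q k nu ->
   forall r : nat, (k + nu - 1 <= r)%N ->
   forall (n : nat) (z : nat -> R), is_partition n z ->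
   forall delta : R, 0 < delta ->
   forall (m : nat) (zt : nat -> R), is_remesh delta n z m zt ->
   forall c : R,
   exists f : R -> R,
     [/\ q_monotone q f, Cn `[-1, 1] nu f &
         ~ exists s : R -> R,
             [/\ is_smooth_spline r m zt s, q_monotone q s &
                 local_estimate k nu n z c f s]]).
Proof.
split; first exact: shape_preserving_estimate.
move=> q k nu q12 qk nadm r _ n z zP delta _ m zt zr c.
have [nuq kq] : (nu < q)%N /\ (q.+2 <= k + nu)%N.
  have [nuq|qnu] := ltnP nu q; last by case: nadm; left.
  split=> //; rewrite ltnNge; apply/negP => kq; case: nadm; right.
  by rewrite qk.
have [b bP] := not_approximable r c q12 nuq kq zP zr.
exists (ramp q b); split; [exact: ramp_monotone| |exact: bP].
exact: Cn_sub (ramp_smooth q b) (ltnW nuq).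
Qed.
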